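(* There is a randomized algorithm with the following guarantee. Let $n=p^d$ where $p$ and $d$ are positive integers, let $x\in\mathbb{C}^{[p]^d}$, and let $k\in\{1,\dots,n\}$. Let $\mu=\frac{1}{\sqrt{k}}\|\widehat{x}_{-k}\|_2$, assume $\mu>0$, and let $R^*\ge \|\widehat{x}\|_\infty/\mu$ with $\log R^*=O(\log n)$. Given $n,k,\mu,R^*$ and query access to the entries of $x$, the algorithm takes $O(k\log k\log n)$ samples from $x$ (i.e. reads that many entries $x_t$), runs in $O(n\log^3 n\,\log k)$ time, and outputs an $O(k)$-sparse vector $y\in\mathbb{C}^{[p]^d}$ such that $$\|\widehat{x}-y\|_\infty\le \frac{1}{\sqrt{k}}\min_{x'\ k\text{-sparse}}\|\widehat{x}-x'\|_2=\frac{1}{\sqrt k}\|\widehat{x}_{-k}\|_2$$ holds with probability at least $1-1/\mathrm{poly}(n)$ over the algorithm's internal randomness.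
   Context: $[p]=\{1,\dots,p\}$; elements of $[p]^d$ index both the time and the frequency domain and are read modulo $p$, i.e. as elements of $(\mathbb{Z}/p)^d$. Let $\omega=e^{2\pi \mathrm{i}/p}$. The normalized $d$-dimensional Fourier transform of $x\in\mathbb{C}^{[p]^d}$ is $\widehat{x}_f=\frac{1}{\sqrt{n}}\sum_{t\in[p]^d}x_t\,\omega^{f^\top t}$ for $f\in[p]^d$. For a vector $v$ and an integer $k$, $v_{-k}$ denotes the vector obtained from $v$ by setting its $k$ largest coordinates in absolute value to zero. A vector is $m$-sparse if it has at most $m$ nonzero coordinates. Conventions: the constants hidden in $O(\cdot)$ do not depend on $p,d,k,x$ (they may depend only on the constant in the assumption $\log R^*=O(\log n)$); inside $O(\cdot)$, $\log k$ is read as $\max\{1,\log k\}$; $1/\mathrm{poly}(n)$ means $n^{-c}$ for an absolute constant $c>0$. The algorithm performs exact arithmetic on complex numbers at unit cost (rounding errors are neglected), and may draw uniformly random elements of $[p]^d$ and of squares in $\mathbb{C}$. *)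

(* Defs.v *)
From mathcomp Require Import all_boot all_order all_algebra.
From mathcomp Require Import all_classical all_reals all_analysis.
From mathcomp Require Import complex.

Set Implicit Arguments.
Unset Strict Implicit.
Unset Printing Implicit Defensive.

Import Order.TTheory GRing.Theory Num.Theory.
Local Open Scope ring_scope.

(* The index set [p]^d: a coordinate is stored as its residue 0, ..., p - 1,
   the value p being read as 0. *)
Definition grid (p d : nat) : finType := {ffun 'I_d -> 'I_p}.

Definition signal (R : realType) (p d : nat) := {ffun grid p d -> R[i]}.

Definition cabs (R : realType) (z : R[i]) : R :=
  Num.sqrt (complex.Re z ^+ 2 + complex.Im z ^+ 2).

Definition root_of_unity (R : realType) (m : nat) : R[i] :=
  Complex (cos (pi *+ 2 / m%:R)) (sin (pi *+ 2 / m%:R)).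

Definition fourier (R : realType) (p d : nat) (x : signal R p d) :
    signal R p d :=
  [ffun f : grid p d =>
    real_complex R (Num.sqrt (p ^ d)%:R)^-1 *
    \sum_(t : grid p d) x t * root_of_unity R p ^+ (\sum_(i < d) f i * t i)%N].

Definition linf_norm (R : realType) (p d : nat) (v : signal R p d) : R :=
  \big[Num.max/0]_(t : grid p d) cabs (v t).

Definition l2_norm (R : realType) (p d : nat) (v : signal R p d) : R :=
  Num.sqrt (\sum_(t : grid p d) cabs (v t) ^+ 2).

Definition sparse (R : realType) (p d : nat) (m : R) (v : signal R p d) : Prop :=
  #|[pred t | v t != 0]|%:R <= m.

(* Ties in absolute value are broken by the enumeration order of the grid. *)
Definition largest (R : realType) (p d k : nat) (v : signal R p d) :
    seq (grid p d) :=
  take k (sort (fun s t => cabs (v t) <= cabs (v s)) (enum (grid p d))).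

(* v_{-k} *)
Definition tail (R : realType) (p d k : nat) (v : signal R p d) :
    signal R p d :=
  [ffun t => if t \in largest k v then 0 else v t].

(* m is the minimum of || v - x' ||_2 over the k-sparse x'. *)
Definition is_min_sparse_dist (R : realType) (p d k : nat) (v : signal R p d)
    (m : R) : Prop :=
  (exists x' : signal R p d, sparse k%:R x' /\ l2_norm (v - x') = m) /\
  (forall x' : signal R p d, sparse k%:R x' -> m <= l2_norm (v - x')).

(* The machine model: a random access machine with one memory of natural
   numbers and one memory of exact complex numbers, programmed in a structured
   language. A program is a finite piece of syntax that does not depend on the
   input. No operation turns a complex number into an integer (in particular
   there is no floor function), except by branching on a comparison. *)

Inductive iexp : Type :=
| IConst of nat
| ILoad of iexp
| IAdd of iexp & iexp
| ISub of iexp & iexp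
| IMul of iexp & iexp
| IDiv of iexp & iexp
| IMod of iexp & iexp.

Inductive cexp : Type :=
| CLoad of iexp
| COfNat of iexp
| CRoot of iexp
| CAdd of cexp & cexp
| CSub of cexp & cexp
| CMul of cexp & cexp
| CDiv of cexp & cexp
| CConj of cexp
| CSqrt of cexp.

Inductive bexp : Type :=
| BILe of iexp & iexp
| BCLe of cexp & cexp
| BNot of bexp
| BAnd of bexp & bexp.

(* In the five assignments the first argument is the target address. *)
Inductive cmd : Type :=
| Skip
| ISet of iexp & iexp
| CSet of iexp & cexp
| Query of iexp & iexp
| DrawIndex of iexp
| DrawSquare of iexp & cexp & cexp
| Seq of cmd & cmd
| If of bexp & cmd & cmd
| While of bexp & cmd.

(* pos counts the random draws made so far, steps the elementary commands and
   tests executed, reads the entries of the signal that were read. *)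
Record state (R : realType) : Type := State {
  imem : nat -> nat;
  cmem : nat -> R[i];
  pos : nat;
  steps : nat;
  reads : nat }.

Fixpoint ieval (R : realType) (s : state R) (e : iexp) : nat :=
  match e with
  | IConst c => c
  | ILoad a => imem s (ieval s a)
  | IAdd e1 e2 => (ieval s e1 + ieval s e2)%N
  | ISub e1 e2 => (ieval s e1 - ieval s e2)%N
  | IMul e1 e2 => (ieval s e1 * ieval s e2)%N
  | IDiv e1 e2 => (ieval s e1 %/ ieval s e2)%N
  | IMod e1 e2 => (ieval s e1 %% ieval s e2)%N
  end.

(* CSqrt is the real square root of the real part (0 if that is negative). *)
Fixpoint ceval (R : realType) (s : state R) (e : cexp) : R[i] :=
  match e with
  | CLoad a => cmem s (ieval s a)
  | COfNat e1 => (ieval s e1)%:R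
  | CRoot e1 => root_of_unity R (ieval s e1)
  | CAdd e1 e2 => ceval s e1 + ceval s e2
  | CSub e1 e2 => ceval s e1 - ceval s e2
  | CMul e1 e2 => ceval s e1 * ceval s e2
  | CDiv e1 e2 => ceval s e1 / ceval s e2
  | CConj e1 => conjc (ceval s e1)
  | CSqrt e1 => real_complex R (Num.sqrt (complex.Re (ceval s e1)))
  end.

Fixpoint beval (R : realType) (s : state R) (b : bexp) : bool :=
  match b with
  | BILe e1 e2 => (ieval s e1 <= ieval s e2)%N
  | BCLe e1 e2 => complex.Re (ceval s e1) <= complex.Re (ceval s e2)
  | BNot b1 => ~~ beval s b1
  | BAnd b1 b2 => beval s b1 && beval s b2
  end.

Definition upd (T : Type) (m : nat -> T) (a : nat) (v : T) : nat -> T :=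
  fun b => if b == a then v else m b.

Definition tick (R : realType) (s : state R) : state R :=
  State (imem s) (cmem s) (pos s) (steps s).+1 (reads s).
Definition iset (R : realType) (a v : nat) (s : state R) : state R :=
  State (upd (imem s) a v) (cmem s) (pos s) (steps s) (reads s).
Definition cset (R : realType) (a : nat) (z : R[i]) (s : state R) : state R :=
  State (imem s) (upd (cmem s) a z) (pos s) (steps s) (reads s).
Definition count_draw (R : realType) (s : state R) : state R :=
  State (imem s) (cmem s) (pos s).+1 (steps s) (reads s).
Definition count_read (R : realType) (s : state R) : state R :=
  State (imem s) (cmem s) (pos s) (steps s) (reads s).+1.

(* The machine addresses t by the integer with base-p digits t_0, t_1, ...;
   this is a bijection from [p]^d onto {0, ..., p^d - 1}. *)
Definition code (p d : nat) (t : grid p d) : nat := (\sum_(i < d) t i * p ^ i)%N.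

(* One random draw: an element of [p]^d and a point of the unit square. *)
Definition draw (R : realType) (p d : nat) : Type := (grid p d * (R * R))%type.

(* exec W x tau c s s': from state s, with oracle x and draws tau, command c
   terminates in state s'. A step costs 1 whatever the size of its expressions,
   which is bounded because the program is fixed. A value stored in the integer
   memory must be below W: otherwise, and on a query outside the range of code,
   the machine is stuck, and there is no s'. As expressions have bounded size,
   if W is polynomial in n then so are all integers that occur in a run. *)
Inductive exec (R : realType) (p d W : nat) (x : signal R p d)
    (tau : nat -> draw R p d) : cmd -> state R -> state R -> Prop :=
| exec_skip s : exec W x tau Skip s (tick s)
| exec_iset a e s :
    (ieval s e < W)%N ->
    exec W x tau (ISet a e) s (tick (iset (ieval s a) (ieval s e) s))
| exec_cset a e s :
    exec W x tau (CSet a e) s (tick (cset (ieval s a) (ceval s e) s))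
| exec_query a e s t :
    code t = ieval s e ->
    exec W x tau (Query a e) s
      (tick (count_read (cset (ieval s a) (x t) s)))
| exec_draw_index a s :
    (code (tau (pos s)).1 < W)%N ->
    exec W x tau (DrawIndex a) s
      (tick (count_draw (iset (ieval s a) (code (tau (pos s)).1) s)))
(* a uniform point of the square with corner z and side vector r *)
| exec_draw_square a z r s :
    exec W x tau (DrawSquare a z r) s
      (tick (count_draw (cset (ieval s a)
        (ceval s z + ceval s r * Complex (tau (pos s)).2.1 (tau (pos s)).2.2)
        s)))
| exec_seq c1 c2 s s1 s2 :
    exec W x tau c1 s s1 -> exec W x tau c2 s1 s2 ->
    exec W x tau (Seq c1 c2) s s2
| exec_if_true b c1 c2 s s1 :
    beval s b -> exec W x tau c1 (tick s) s1 ->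
    exec W x tau (If b c1 c2) s s1
| exec_if_false b c1 c2 s s1 :
    ~~ beval s b -> exec W x tau c2 (tick s) s1 ->
    exec W x tau (If b c1 c2) s s1
| exec_while_true b c s s1 s2 :
    beval s b -> exec W x tau c (tick s) s1 ->
    exec W x tau (While b c) s1 s2 ->
    exec W x tau (While b c) s s2
| exec_while_false b c s :
    ~~ beval s b -> exec W x tau (While b c) s (tick s).

Definition init_state (R : realType) (p d k : nat) (mu Rs : R) : state R :=
  State (nth 0%N [:: p; d; p ^ d; k]%N)
        (nth 0 [:: real_complex R mu; real_complex R Rs]) 0 0 0.

Definition output (R : realType) (p d : nat) (s : state R) : signal R p d :=
  [ffun t => cmem s (code t)].

(* The draws tau w 0, tau w 1, ... are mutually independent, and each of them
   is uniform on [p]^d x [0,1] x [0,1]. *)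
Definition uniform_draws (R : realType) (p d : nat) (dsp : measure_display)
    (Om : measurableType dsp) (P : probability Om R)
    (tau : Om -> nat -> draw R p d) : Prop :=
  [/\ forall w i, 0 <= (tau w i).2.1 <= 1 /\ 0 <= (tau w i).2.2 <= 1,
      forall i a, measurable [set w | (tau w i).1 = a]%classic,
      forall i, measurable_fun [set: Om]%classic (fun w => (tau w i).2.1),
      forall i, measurable_fun [set: Om]%classic (fun w => (tau w i).2.2) &
      forall (N : nat) (a : 'I_N -> grid p d) (A B : 'I_N -> set R),
        (forall i, measurable (A i)) -> (forall i, measurable (B i)) ->
        P [set w | forall i : 'I_N, [/\ (tau w i).1 = a i,
                     A i (tau w i).2.1 & B i (tau w i).2.2]]%classic =
        (\prod_(i < N) (((p ^ d)%:R^-1)%:E * uniform_prob (@ltr01 R) (A i) *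
                        uniform_prob (@ltr01 R) (B i)))%E].

(* Main.v *)
(* Samples of x at uniform positions give, at every frequency, an unbiased
   estimate of the residual fourier x - y. If y is supported on the O(k) heavy
   frequencies and is within M of fourier x, with M >= 2 mu, then the residual
   has energy O(k M^2), so by Chebyshev a group of O(k) samples estimates a given
   coordinate up to M / 24 with probability 63/64, and a majority value of L
   groups is accurate to M / 8 at all n frequencies outside an event of
   probability n / 4^L. Adding to y the estimates of modulus above 3 M / 8 halves
   M and keeps the support heavy.
   Fresh samples for each of the O(log n) halvings would cost k log^2 n samples.
   Instead 2 q + 1 = O(log k) batches serve all of them, where Q = 2^q >= 32 k.
   One stage runs through all the batches, which brings the error down to
   M / (2 Q^2), and then rounds the increment of y to one of Q shifts of a grid
   coarser by a factor Q than this precision. At most 20 k + 2 < Q of the shifts can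
   separate the computed increment from the exact one fourier x - y, so for the
   chosen shift both round to the same point, and the new y depends on the samples
   only through the shift. As each stage divides M by Q, starting from 2^m mu,
   there are O(2^m) possible trajectories, and a union bound over them, paid for
   by L >= m, replaces independence. *)
Require Import Defs.
From mathcomp Require Import all_boot all_order all_algebra.
From mathcomp Require Import all_classical all_reals all_analysis.
From mathcomp Require Import complex.
From mathcomp Require Import ring lra zify.
Require Import Defs.

Set Implicit Arguments.
Unset Strict Implicit.
Unset Printing Implicit Defensive.

Import Order.TTheory GRing.Theory Num.Theory.
Local Open Scope ring_scope.

(** The obstacle is adaptivity: after the first stage the residual depends on the very samples that
    are to estimate it, so Chebyshev's bound does not apply to it. Probabilities are therefore
    counts of sample tables, multiplied out to avoid division, and each estimate is a claim about a
    fixed vector y; passing to the random y costs a union over its possible values. Hence the shift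
    is chosen from the computed increment alone, yet serves the unknown exact one. Constants: a
    union over the 2^L sets of bad groups against 64^(L/2) = 8^L leaves 4^L. The n frequencies, the
    2 q + 1 rounds, the fewer than 2^(m+1) trajectories and the target 1/n are all paid from it by L
    = m + (2 q + 1) + log n + 1. Time: a group of samples is accumulated on the grid and transformed
    once, in O(n log n) for any p, which estimates all frequencies simultaneously. With O(log n)
    groups per round, O(log k) rounds per stage and at most m stages this gives n log^3 n log k. The
    program is verified against a pure function [recover] of the draws; probability enters only
    through the uniform law of that finite table. *)

(** * The modulus of a complex number *)

Section ComplexModulus.
Variable R : realType.
Implicit Types z w : R[i].

Lemma cabsE z : cabs z = complex.ComplexField.Normc.normc z.
Proof. by case: z. Qed.

Lemma cabs_ge0 z : 0 <= cabs z.
Proof. exact: sqrtr_ge0. Qed.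

Lemma cabs0 : cabs (0 : R[i]) = 0.
Proof. by rewrite cabsE complex.ComplexField.Normc.normc0. Qed.

Lemma cabs_eq0 z : (cabs z == 0) = (z == 0).
Proof.
apply/eqP/eqP => [|->]; last exact: cabs0.
by rewrite cabsE => /complex.ComplexField.Normc.eq0_normc.
Qed.

Lemma cabsM z w : cabs (z * w) = cabs z * cabs w.
Proof. by rewrite !cabsE complex.ComplexField.Normc.normcM. Qed.

Lemma cabsN z : cabs (- z) = cabs z.
Proof. by rewrite !cabsE complex.normcN. Qed.

Lemma cabsB z w : cabs (z - w) = cabs (w - z).
Proof. by rewrite -cabsN opprB. Qed.

Lemma cabsD z w : cabs (z + w) <= cabs z + cabs w.
Proof. by rewrite !cabsE complex.le_normcD. Qed.

Lemma cabsB3 z w u : cabs (z - u) <= cabs (z - w) + cabs (w - u).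
Proof. by rewrite (le_trans _ (cabsD _ _))// addrA subrK. Qed.

Lemma cabs_sqr z : cabs z ^+ 2 = complex.Re z ^+ 2 + complex.Im z ^+ 2.
Proof. by rewrite sqr_sqrtr// addr_ge0// sqr_ge0. Qed.

Lemma cabs_sqr_conj z : (cabs z ^+ 2)%:C%C = z * conjc z.
Proof.
rewrite cabs_sqr; case: z => a b /=; apply/eqP; rewrite eq_complex /=.
by apply/andP; split; apply/eqP; ring.
Qed.

Lemma Re_mul_conj z : complex.Re (z * conjc z) = cabs z ^+ 2.
Proof. by rewrite -cabs_sqr_conj. Qed.

Lemma cabs_real (a : R) : cabs a%:C%C = `|a|.
Proof. by rewrite /cabs /= expr0n addr0 sqrtr_sqr. Qed.

Lemma conjcM z w : conjc (z * w) = conjc z * conjc w.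
Proof. exact: rmorphM. Qed.

Lemma conjcX z j : conjc (z ^+ j) = conjc z ^+ j.
Proof. exact: rmorphXn. Qed.

Lemma conjc_sum I (s : seq I) (P : pred I) (F : I -> R[i]) :
  conjc (\sum_(i <- s | P i) F i) = \sum_(i <- s | P i) conjc (F i).
Proof. exact: raddf_sum. Qed.

(** The factor 2 in place of the sharp sqrt 2 keeps the constants of the grid rounding rational. *)
Lemma cabs_le_ReIm z (a : R) :
  `|complex.Re z| <= a -> `|complex.Im z| <= a -> cabs z <= a *+ 2.
Proof.
case: z => u v /= ua va; have a0 : 0 <= a := le_trans (normr_ge0 u) ua.
rewrite -ler_sqr ?nnegrE ?cabs_ge0 ?mulrn_wge0// cabs_sqr /=.
have ? : u ^+ 2 <= a ^+ 2 by rewrite -real_normK ?num_real// ler_sqr ?nnegrE.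
have ? : v ^+ 2 <= a ^+ 2 by rewrite -real_normK ?num_real// ler_sqr ?nnegrE.
nra.
Qed.

Lemma Re_le_cabs z : `|complex.Re z| <= cabs z.
Proof.
rewrite -ler_sqr ?nnegrE ?cabs_ge0// real_normK ?num_real// cabs_sqr.
by rewrite lerDl sqr_ge0.
Qed.

Lemma Im_le_cabs z : `|complex.Im z| <= cabs z.
Proof.
rewrite -ler_sqr ?nnegrE ?cabs_ge0// real_normK ?num_real// cabs_sqr.
by rewrite lerDr sqr_ge0.
Qed.

Lemma ReB z w : complex.Re (z - w) = complex.Re z - complex.Re w.
Proof. by case: z; case: w. Qed.

Lemma ImB z w : complex.Im (z - w) = complex.Im z - complex.Im w.
Proof. by case: z; case: w. Qed.

End ComplexModulus.

(** * Primitive roots of unity and orthogonality of their powers *)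

Section RootsOfUnity.
Variables (R : realType) (m : nat).
Hypothesis m_gt0 : (0 < m)%N.
Let w := root_of_unity R m.
Let theta : R := pi *+ 2 / m%:R.

Lemma root_of_unityX j : w ^+ j = Complex (cos (j%:R * theta)) (sin (j%:R * theta)).
Proof.
elim: j => [|j IH]; first by rewrite expr0 mul0r cos0 sin0.
rewrite exprS IH -natr1 mulrDl mul1r cosD sinD /w /root_of_unity -/theta.
by apply/eqP; rewrite eq_complex /=; apply/andP; split; apply/eqP; ring.
Qed.

Lemma root_of_unity_conj : conjc w * w = 1.
Proof. by rewrite mulrC -cabs_sqr_conj cabs_sqr /= cos2Dsin2. Qed.

(** The double-angle formula gives cos (2 y) = 1 - 2 (sin y)^2, so [w ^+ j] = 1 forces sin (pi j /
    m) = 0. This is impossible for 0 < j < m, as sin is positive strictly between 0 and pi. *)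
Lemma root_of_unity_prim : m.-primitive_root w.
Proof.
have mR : (m%:R : R) != 0 by rewrite pnatr_eq0 -lt0n.
have cos2x (y : R) : cos (y *+ 2) = 1 - sin y ^+ 2 *+ 2.
  by rewrite mulr2n cosD -!expr2 (cos2sin2 y); ring.
have th j : j%:R * theta = (j%:R * (pi / m%:R)) *+ 2.
  by rewrite -mulrnAr /theta; congr (_ * _); rewrite mulrnAl.
apply/andP; split => //; apply/forallP => -[j jm] /=.
rewrite unity_rootE root_of_unityX th.
have [jE|jNm] := eqVneq j.+1 m.
  apply/eqP/eqP; rewrite jE mulrC divfK// cos2x sinpi expr0n mul0rn subr0.
  by rewrite mulr2n sinD sinpi mul0r mulr0 addr0.
rewrite eqbF_neg.
apply/negP => /eqP [] /eqP; rewrite cos2x -subr_eq0 addrAC subrr sub0r oppr_eq0.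
rewrite mulrn_eq0 /= sqrf_eq0 gt_eqF// sin_gt0_pi//.
have m0 : (0 : R) < m%:R by rewrite ltr0n.
rewrite mulr_gt0 ?divr_gt0 ?ltr0n ?pi_gt0//=.
by rewrite mulrCA gtr_pMr ?pi_gt0// ltr_pdivrMr// mul1r ltr_nat ltn_neqAle jNm.
Qed.

Lemma root_of_unity_expr_eq1 : w ^+ m = 1.
Proof. exact: prim_expr_order root_of_unity_prim. Qed.

Lemma root_of_unity_mod j : w ^+ (j %% m)%N = w ^+ j.
Proof. exact: expr_mod root_of_unity_expr_eq1. Qed.

Lemma root_of_unity_conjX j : conjc (w ^+ j) * w ^+ j = 1.
Proof. by rewrite conjcX -exprMn root_of_unity_conj expr1n. Qed.

Lemma root_of_unity_sum (z : R[i]) : z ^+ m = 1 ->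
  \sum_(a < m) z ^+ a = if z == 1 then m%:R else 0.
Proof.
move=> zm; case: eqP => [->|/eqP z1].
  by under eq_bigr do rewrite expr1n; rewrite sumr_const card_ord.
apply/eqP; move: (subrX1 z m); rewrite zm subrr => /esym/eqP.
by rewrite mulf_eq0 subr_eq0 (negbTE z1).
Qed.

Lemma root_of_unity_orth (f g : 'I_m) :
  \sum_(a < m) w ^+ (f * a) * conjc (w ^+ (g * a)) = if f == g then m%:R else 0.
Proof.
under eq_bigr do rewrite !exprM (conjcX (w ^+ g)) -exprMn.
rewrite root_of_unity_sum; last first.
  rewrite exprMn -conjcX -!exprM mulnC exprM root_of_unity_expr_eq1 expr1n.
  by rewrite mulnC exprM root_of_unity_expr_eq1 expr1n mul1r conjc1.
suff -> : (w ^+ f * conjc (w ^+ g) == 1) = (f == g) by [].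
have wf j : w ^+ j != 0.
  apply/eqP => w0; have /eqP := root_of_unity_conjX j.
  by rewrite w0 mulr0 eq_sym oner_eq0.
have -> : (w ^+ f * conjc (w ^+ g) == 1) = (w ^+ f == w ^+ g).
  by rewrite -(inj_eq (mulIf (wf g))) -mulrA root_of_unity_conjX mulr1 mul1r.
by rewrite (eq_prim_root_expr root_of_unity_prim) !modn_small.
Qed.

End RootsOfUnity.

(** * Characters of the grid, Fourier inversion and Parseval's identity *)

Section FourierTransform.
Variables (R : realType) (p d : nat).
Hypothesis p_gt0 : (0 < p)%N.
Local Notation G := (grid p d).
Local Notation n := (p ^ d)%N.
Implicit Types (x y : signal R p d) (f t : G).

Lemma card_grid : #|G| = n.
Proof. by rewrite card_ffun !card_ord. Qed.

Lemma n_gt0 : (0 < n)%N.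
Proof. by rewrite expn_gt0 p_gt0. Qed.

Lemma nR_gt0 : 0 < n%:R :> R.
Proof. by rewrite ltr0n n_gt0. Qed.

Definition character f t : R[i] := root_of_unity R p ^+ (\sum_(i < d) f i * t i)%N.

Lemma characterC f t : character f t = character t f.
Proof. by congr (_ ^+ _); apply: eq_bigr => i _; rewrite mulnC. Qed.

Lemma character_conj f t : conjc (character f t) * character f t = 1.
Proof. exact: root_of_unity_conjX. Qed.

Lemma cabs_character f t : cabs (character f t) = 1.
Proof.
apply/eqP; rewrite -sqrp_eq1 ?cabs_ge0//; apply/eqP/(@complexI R).
by rewrite cabs_sqr_conj mulrC character_conj.
Qed.

(** By distributivity the sum over the grid is a product of d one-dimensional sums; a coordinate
    where f and g differ makes one of them vanish. *)
Lemma character_orth f g :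
  \sum_(t : G) character f t * conjc (character g t) = if f == g then n%:R else 0.
Proof.
transitivity (\prod_(i < d) \sum_(a < p) root_of_unity R p ^+ (f i * a) *
    conjc (root_of_unity R p ^+ (g i * a))).
  rewrite bigA_distr_bigA /=; apply: eq_bigr => t _.
  by rewrite /character !expr_sum rmorph_prod /= -big_split.
under eq_bigr do rewrite root_of_unity_orth//.
case: eqP => [->|/eqP fg].
  by under eq_bigr do rewrite eqxx; rewrite prodr_const card_ord natrX.
have [i fgi] : exists i, f i != g i.
  apply/existsP; apply: contraR fg; rewrite negb_exists => /forallP fg.
  by apply/eqP/ffunP => i; apply/eqP; rewrite -[_ == _]negbK.
by rewrite (bigD1 i)//= (negbTE fgi) mul0r.
Qed.

Definition inverse_fourier (y : signal R p d) : signal R p d :=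
  [ffun t => ((Num.sqrt n%:R)^-1)%:C%C * \sum_(f : G) y f * conjc (character f t)].

Lemma fourierE x f :
  fourier x f = ((Num.sqrt n%:R)^-1)%:C%C * \sum_(t : G) x t * character f t.
Proof. by rewrite ffunE. Qed.

Lemma sqrt_n_sqr : ((Num.sqrt n%:R)^-1)%:C%C * ((Num.sqrt n%:R)^-1)%:C%C * n%:R = 1 :> R[i].
Proof.
have -> : (n%:R : R[i]) = (n%:R : R)%:C%C by rewrite rmorph_nat.
rewrite -!rmorphM /= -invfM -expr2 sqr_sqrtr ?ler0n//.
by rewrite mulVf// gt_eqF// nR_gt0.
Qed.

Lemma inverse_fourierK y : fourier (inverse_fourier y) = y.
Proof.
apply/ffunP => f; rewrite fourierE.
under eq_bigr do rewrite ffunE -mulrA mulr_suml.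
rewrite -mulr_sumr mulrA exchange_big /=.
under eq_bigr => g _.
  under eq_bigr do rewrite mulrAC -mulrA.
  rewrite -mulr_sumr character_orth; over.
rewrite (bigD1 f)//= eqxx big1 => [|g gf]; last by rewrite eq_sym (negbTE gf) mulr0.
by rewrite addr0 mulrCA sqrt_n_sqr mulr1.
Qed.

Lemma fourierB x y : fourier (x - y) = fourier x - fourier y.
Proof.
apply/ffunP => f; rewrite !ffunE -mulrBr -sumrB; congr (_ * _).
by apply: eq_bigr => t _; rewrite !ffunE mulrBl.
Qed.

Lemma Parseval x :
  \sum_(f : G) cabs (fourier x f) ^+ 2 = \sum_(t : G) cabs (x t) ^+ 2.
Proof.
apply: (@complexI R); rewrite !rmorph_sum /=.
under eq_bigr => f _.
  rewrite cabs_sqr_conj fourierE conjcM conjc_sum.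
  have -> : conjc ((Num.sqrt n%:R)^-1)%:C%C = ((Num.sqrt n%:R)^-1)%:C%C :> R[i].
    by rewrite /= oppr0.
  rewrite mulrACA mulr_suml; under eq_bigr do rewrite mulr_sumr; over.
rewrite -mulr_sumr exchange_big /=.
under eq_bigr => t _.
  rewrite exchange_big /=.
  under eq_bigr => s _.
    under eq_bigr => f _ do rewrite conjcM mulrACA (characterC f t) (characterC f s).
    rewrite -mulr_sumr character_orth; over.
  rewrite (bigD1 t)//= eqxx big1 => [|s st]; last first.
    by rewrite eq_sym (negbTE st) mulr0.
  rewrite addr0; over.
rewrite -mulr_suml mulrCA sqrt_n_sqr mulr1.
by apply: eq_bigr => t _; rewrite cabs_sqr_conj.
Qed.

End FourierTransform.

(** * Best k-sparse approximation, heavy frequencies and the energy of a residual *)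

Lemma energy_arith (R : realFieldType) (k a M : R) : 0 <= k -> 0 < a -> a *+ 2 <= M ->
  5 * k * M ^+ 2 + (k * a ^+ 2 + k * (a / 2) ^+ 2) <= 6 * k * M ^+ 2.
Proof.
move=> k0 a0 aM; have aM2 : a *+ 2 * (a *+ 2) <= M * M.
  by rewrite ler_pM// mulrn_wge0// ltW.
have : 0 <= k * (M ^+ 2 - a ^+ 2 - (a / 2) ^+ 2).
  by rewrite mulr_ge0//; move: aM2 (sqr_ge0 a); rewrite !expr2; nra.
by rewrite !mulrBr; lra.
Qed.

Section BestSparseApproximation.
Variables (R : realType) (p d k : nat).
Hypotheses (p_gt0 : (0 < p)%N) (k_gt0 : (0 < k)%N) (k_le : (k <= p ^ d)%N).
Local Notation G := (grid p d).
Local Notation n := (p ^ d)%N.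
Variable v : signal R p d.

Definition top : {set G} := [set t in largest k v].

Lemma card_top : #|top| = k.
Proof.
rewrite cardsE; have /card_uniqP -> : uniq (largest k v).
  by rewrite take_uniq// sort_uniq enum_uniq.
by rewrite size_takel// size_sort -cardE card_grid.
Qed.

Lemma top_ge a b : a \in top -> b \notin top -> cabs (v b) <= cabs (v a).
Proof.
rewrite !inE => aL bL.
set r := fun s t : G => cabs (v t) <= cabs (v s).
have : pairwise r (sort r (enum G)).
  rewrite -sorted_pairwise; last by move=> s1 s2 s3 h1 h2; exact: le_trans h2 h1.
  by apply: sort_sorted => s1 s2; exact: le_total.
rewrite -(cat_take_drop k (sort r (enum G))) pairwise_cat => /andP[/allrelP + _].
apply=> //; have : b \in sort r (enum G) by rewrite mem_sort mem_enum.
by rewrite -{1}(cat_take_drop k (sort r (enum G))) mem_cat (negbTE bL).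
Qed.

Lemma l2_norm_sqr (u : signal R p d) : l2_norm u ^+ 2 = \sum_t cabs (u t) ^+ 2.
Proof. by rewrite sqr_sqrtr// sumr_ge0// => t _; rewrite sqr_ge0. Qed.

Lemma l2_norm_ge0 (u : signal R p d) : 0 <= l2_norm u.
Proof. exact: sqrtr_ge0. Qed.

Lemma l2_norm_tail_sqr :
  l2_norm (tail k v) ^+ 2 = \sum_(t | t \notin top) cabs (v t) ^+ 2.
Proof.
rewrite l2_norm_sqr [RHS]big_mkcond; apply: eq_bigr => t _.
by rewrite ffunE inE; case: ifP => //; rewrite cabs0 expr0n.
Qed.

(** Exchange argument. Outside the common part it remains to compare [S :\: top] with [top :\: S].
    The latter is at least as large, because [top] has exactly k elements, and each of its entries
    dominates each entry of the former. Summing over pairs turns this into the inequality of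
    energies. *)
Lemma top_energy_max (S : {set G}) : (#|S| <= k)%N ->
  \sum_(t | t \notin top) cabs (v t) ^+ 2 <= \sum_(t | t \notin S) cabs (v t) ^+ 2.
Proof.
move=> Sk; rewrite (bigID (mem S)) [leRHS](bigID (mem top)) /=.
rewrite [X in _ <= _ + X](eq_bigl (fun t => (t \notin top) && (t \notin S))); last first.
  by move=> t; rewrite andbC.
rewrite lerD2r.
have SL : (#|S :\: top| <= #|top :\: S|)%N.
  rewrite -(leq_add2l #|S :&: top|) cardsID [S :&: top]finset.setIC cardsID.
  by rewrite card_top.
rewrite [leLHS](eq_bigl (mem (S :\: top))); last by move=> t; rewrite !inE.
rewrite [leRHS](eq_bigl (mem (top :\: S))); last by move=> t; rewrite !inE.
have [L0|L0] := posnP #|top :\: S|.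
  have S0 : S :\: top = finset.set0.
    by apply/eqP; rewrite -cards_eq0 -leqn0 (leq_trans SL)// L0.
  rewrite S0 big_pred0 ?sumr_ge0// => t; rewrite ?inE// => _; exact: sqr_ge0.
have L0R : 0 < #|top :\: S|%:R :> R by rewrite ltr0n.
rewrite -(ler_pM2l L0R).
apply: le_trans (_ : #|S :\: top|%:R * \sum_(t in top :\: S) cabs (v t) ^+ 2 <= _).
  have card_sum (T : {set G}) (X : R) : #|T|%:R * X = \sum_(a in T) X.
    by rewrite sumr_const mulr_natl.
  rewrite !card_sum exchange_big /= [leRHS]exchange_big /= exchange_big /=.
  apply: ler_sum => a; rewrite !inE => /andP[aS aL].
  apply: ler_sum => b; rewrite !inE => /andP[bL bS].
  by rewrite ler_sqr ?nnegrE ?cabs_ge0// top_ge// inE.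
by rewrite ler_wpM2r ?ler_nat// sumr_ge0// => t _; rewrite sqr_ge0.
Qed.

Lemma tail_is_min_sparse_dist : is_min_sparse_dist k v (l2_norm (tail k v)).
Proof.
split.
  exists (v - tail k v); split; last by rewrite opprB addrC subrK.
  rewrite /sparse ler_nat -{2}card_top; apply/subset_leq_card/fintype.subsetP => t.
  rewrite !inE !ffunE; case: ifP => //; by rewrite subrr eqxx.
move=> x' x'k; have := l2_norm_ge0 (v - x'); have := l2_norm_ge0 (tail k v).
move=> h1 h2; rewrite -ler_sqr ?nnegrE// l2_norm_tail_sqr l2_norm_sqr.
apply: le_trans (@top_energy_max [set t | x' t != 0] _) _.
  by rewrite cardsE; move: x'k; rewrite /sparse ler_nat.
rewrite big_mkcond; apply: ler_sum => t _; rewrite inE !ffunE negbK.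
by case: eqP => [->|_]; rewrite ?subr0// sqr_ge0.
Qed.

Definition tail_mean : R := l2_norm (tail k v) / Num.sqrt k%:R.
Local Notation mu := tail_mean.

Lemma tail_energy : \sum_(t | t \notin top) cabs (v t) ^+ 2 = k%:R * mu ^+ 2.
Proof.
rewrite -l2_norm_tail_sqr [in RHS]/tail_mean exprMn exprVn (sqr_sqrtr (ler0n R k)) mulrC divfK//.
by rewrite pnatr_eq0 -lt0n.
Qed.

(** The threshold comes from the last admissible scale M = 2 mu: an accepted estimate exceeds 3 M /
    8 and errs by at most M / 8, so the true value is at least M / 4, that is mu / 2. *)
Definition heavy : {set G} := [set t | mu / 2 <= cabs (v t)].

(** At most k heavy frequencies lie in [top]. Each of the others carries energy at least mu^2 / 4
    out of a total of k mu^2, so there are at most 4 k of them. *)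
Lemma card_heavy : 0 < mu -> (#|heavy| <= 5 * k)%N.
Proof.
move=> mu0; rewrite -(cardsID top heavy) mulSn leq_add//.
  by rewrite -[leqRHS]card_top subset_leq_card// subsetIr.
have mu2 : 0 < (mu / 2) ^+ 2 by rewrite exprn_gt0// divr_gt0.
rewrite -(ler_nat R) -(ler_pM2r mu2) natrM.
have -> : 4 * k%:R * (mu / 2) ^+ 2 = k%:R * mu ^+ 2 by field.
rewrite -tail_energy mulr_natl -sumr_const.
rewrite [leLHS]big_mkcond [leRHS]big_mkcond; apply: ler_sum => t _.
rewrite !inE; case: ifP => [/andP[-> h]|_] /=.
  by rewrite ler_sqr// nnegrE ?cabs_ge0// divr_ge0// ltW.
by case: ifP => // _; rewrite sqr_ge0.
Qed.

(** The at most 5 k heavy frequencies contribute M^2 each. Off them y vanishes: the tail contributes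
    at most k mu^2 and the light frequencies of [top] at most (mu / 2)^2 each. Since mu is at most M
    / 2, these last two terms stay below k M^2. *)
Lemma residual_energy (y : signal R p d) (M : R) : 0 < mu -> mu *+ 2 <= M ->
  (forall t, cabs (v t - y t) <= M) -> (forall t, y t != 0 -> t \in heavy) ->
  \sum_t cabs (v t - y t) ^+ 2 <= (6 * k)%:R * M ^+ 2.
Proof.
move=> mu0 muM vyM yH.
have k0 : 0 <= k%:R :> R by [].
have M0 : 0 < M by rewrite (lt_le_trans _ muM)// pmulrn_lgt0.
rewrite (bigID (mem heavy)) /=.
have A1 : \sum_(t in heavy) cabs (v t - y t) ^+ 2 <= (5 * k)%:R * M ^+ 2.
  apply: le_trans (_ : \sum_(t in heavy) M ^+ 2 <= _).
    by apply: ler_sum => t _; rewrite ler_sqr ?nnegrE ?cabs_ge0 ?(ltW M0).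
  rewrite sumr_const -[leLHS]mulr_natl ler_wpM2r ?sqr_ge0// ler_nat.
  exact: card_heavy.
have A2 : \sum_(t | t \notin heavy) cabs (v t - y t) ^+ 2 <=
    k%:R * mu ^+ 2 + k%:R * (mu / 2) ^+ 2.
  rewrite -tail_energy -[X in k%:R * X]mul1r.
  have -> : k%:R * (1 * (mu / 2) ^+ 2) = \sum_(t in top) (mu / 2) ^+ 2.
    by rewrite sumr_const card_top mul1r mulr_natl.
  rewrite [leLHS]big_mkcond [X in _ <= X + _]big_mkcond [X in _ <= _ + X]big_mkcond.
  rewrite -big_split /=; apply: ler_sum => t _.
  have sq0 (a : R) : 0 <= a ^+ 2 by exact: sqr_ge0.
  case: ifPn => tH; last by case: ifP => _; case: ifP => _; rewrite ?addr0 ?add0r ?addr_ge0.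
  have -> : y t = 0 by apply/eqP; apply: contraR tH => /yH.
  rewrite subr0; case: (boolP (t \in top)) => tT /=; last by rewrite addr0.
  rewrite add0r ler_sqr ?nnegrE ?cabs_ge0 ?divr_ge0 ?(ltW mu0)//.
    by move: tH; rewrite inE -ltNge => /ltW.
  exact: l2_norm_ge0.
rewrite (le_trans (lerD A1 A2))// !natrM; exact: energy_arith.
Qed.

End BestSparseApproximation.

(** * Independence of coordinates, in counting form *)

Section ReplaceCoordinate.
Variables (I T : finType).
Implicit Types (h : {ffun I -> T}) (i : I) (t : T).

Definition replace i h t : {ffun I -> T} := [ffun j => if j == i then t else h j].

Lemma replace_eq i h t : replace i h t i = t.
Proof. by rewrite ffunE eqxx. Qed.

Lemma replace_neq i j h t : j != i -> replace i h t j = h j.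
Proof. by rewrite ffunE => /negbTE ->. Qed.

(* The counting form of conditioning on all coordinates of h but the i-th. *)
Lemma sum_replace (V : nmodType) i (F : {ffun I -> T} -> V) :
  (\sum_h F h) *+ #|T| = \sum_h \sum_t F (replace i h t).
Proof.
pose phi (u : {ffun I -> T} * T) := (replace i u.1 u.2, u.1 i).
have phiK : involutive phi.
  move=> [h t]; rewrite /phi /= replace_eq; congr (_, _).
  by apply/ffunP => j; rewrite !ffunE; case: eqP => [->|].
transitivity (\sum_(u : {ffun I -> T} * T) F u.1).
  rewrite -(pair_big xpredT xpredT (fun h t => F h)) /= -sumrMnl.
  by apply: eq_bigr => h _; rewrite sumr_const.
rewrite (reindex_inj (inv_inj phiK)) /=.
by rewrite -(pair_big xpredT xpredT (fun h t => F (replace i h t))).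
Qed.

(** S h is the history and h i a fresh sample. As the history ignores coordinate i, that coordinate
    can be averaged first with S h held fixed, so a bound b / a on the bad fraction that is valid
    for every history holds overall. *)
Lemma card_bad_coordinate (X : Type) (S : {ffun I -> T} -> X) (bad : X -> pred T)
    (i : I) (a b : nat) :
  (forall h t, S (replace i h t) = S h) ->
  (forall h, (a * #|bad (S h)| <= b * #|T|)%N) ->
  (a * #|[pred h : {ffun I -> T} | bad (S h) (h i)]| <= b * #|{ffun I -> T}|)%N.
Proof.
move=> Si hb; have [T0|T0] := posnP #|T|.
  rewrite [X in (a * X)%N](_ : _ = 0)%N ?muln0//; apply/eqP.
  rewrite -leqn0 (leq_trans (max_card _))// card_ffun T0 exp0n//.
  by apply/card_gt0P; exists i.
rewrite -(leq_pmul2r T0).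
have -> : #|[pred h : {ffun I -> T} | bad (S h) (h i)]| =
    (\sum_(h : {ffun I -> T}) bad (S h) (h i))%N.
  by rewrite -sum1_card big_mkcond; apply: eq_bigr => h _; rewrite inE; case: (bad _ _).
have cardE h : #|bad (S h)| = (\sum_t bad (S h) t)%N.
  rewrite -sum1_card big_mkcond; apply: eq_bigr => t _; rewrite unfold_in.
  by case: (bad _ _).
have := @sum_replace nat i (fun h => (bad (S h) (h i) : nat)).
rewrite -mulr_natr natn => E; rewrite -mulnA.
rewrite (E : (_ * _ = \sum_h \sum_t _)%N) big_distrr /=.
under eq_bigr => h _.
  under [X in (_ * X)%N]eq_bigr => t _ do rewrite Si replace_eq.
  rewrite -cardE; over.
rewrite [leqRHS]mulnAC [leqRHS]mulnC /=.
rewrite -sum_nat_const; apply: leq_sum => h _.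
exact: hb.
Qed.

End ReplaceCoordinate.

(** * Amplification by majority over independent groups *)

Section Amplification.
Variables (T : finType) (R : nat) (bad : pred T).
Hypothesis bad_rare : (64 * #|bad| <= #|T|)%N.

Lemma card_all_bad (S : {set 'I_R}) :
  (64 ^ #|S| * #|[pred t : {ffun 'I_R -> T} | [forall r in S, bad (t r)]]|
     <= #|T| ^ R)%N.
Proof.
pose F (r : 'I_R) : {pred T} := if r \in S then bad else predT.
have -> : #|[pred t : {ffun 'I_R -> T} | [forall r in S, bad (t r)]]| = #|family F|.
  apply: eq_card => t; rewrite !inE; apply/forallP/familyP => h r.
    by have := h r; rewrite /F; case: ifP.
  by apply/implyP => rS; have := h r; rewrite /F rS.
rewrite card_family foldrE big_map big_enum /=.
have -> : (64 ^ #|S| = \prod_(r < R) (if r \in S then 64 else 1))%N.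
  by rewrite -big_mkcond prod_nat_const.
have -> : (#|T| ^ R = \prod_(r < R) #|T|)%N by rewrite prod_nat_const card_ord.
rewrite -big_split /=; apply: leq_prod => r _; rewrite /F.
by case: ifP => _; rewrite ?mul1n// max_card.
Qed.

(** Union bound over the 2^R index sets S. If 2 |S| >= R then all groups in S are bad for a fraction
    at most 64^(-|S|) <= 8^(-R) of the tables, and 2^R * 8^(-R) = 4^(-R). *)
Lemma card_majority_bad :
  (4 ^ R * #|[pred t : {ffun 'I_R -> T} | R <= 2 * #|[pred r | bad (t r)]|]|
     <= #|{ffun 'I_R -> T}|)%N.
Proof.
set fail := [pred t : {ffun 'I_R -> T} | _]; rewrite card_ffun card_ord.
pose allbad (S : {set 'I_R}) := [pred t : {ffun 'I_R -> T} | [forall r in S, bad (t r)]].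
have E8 : (8 ^ R * #|fail| <= 2 ^ R * #|T| ^ R)%N.
  have -> : (2 ^ R = #|{set 'I_R}|)%N by rewrite -cardsT -powersetT card_powerset cardsT card_ord.
  rewrite -sum_nat_const.
  apply: (@leq_trans (\sum_(S : {set 'I_R}) if (R <= 2 * #|S|)%N then 8 ^ R * #|allbad S| else 0)).
    rewrite -big_mkcond -big_distrr /= leq_mul2l; apply/orP; right.
    rewrite -sum1_card; under [X in (_ <= X)%N]eq_bigr do rewrite -sum1_card.
    rewrite (exchange_big_dep (mem fail)) /=; last first.
      move=> S t RS; rewrite !inE => /forall_inP St; rewrite (leq_trans RS)// leq_mul2l.
      by apply/orP; right; apply/subset_leq_card/fintype.subsetP => r /St; rewrite inE.
    apply: leq_sum => t; rewrite inE => tf.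
    rewrite (bigD1 [set r | bad (t r)]) ?leq_addr//= !inE cardsE tf /=.
    by apply/forall_inP => r; rewrite inE.
  apply: leq_sum => S _; case: ifP => // RS; apply: leq_trans (card_all_bad S).
  rewrite leq_mul2r; apply/orP; right.
  by rewrite (_ : 64 = 8 ^ 2)%N// -expnM leq_pexp2l.
rewrite -(@leq_pmul2l (2 ^ R)) ?expn_gt0//; apply: leq_trans E8.
by rewrite mulnA -expnMn.
Qed.

End Amplification.

(** * Variance and Chebyshev's inequality for a group of uniform samples *)

Section SampleVariance.
Variables (R : realType) (G : finType) (B : nat).

(** Variances of independent centred variables add. In the expanded square a term with b != c
    vanishes on averaging coordinate b alone, because phi sums to 0. *)
Lemma sum_centered_sqr (phi : G -> R[i]) : \sum_t phi t = 0 ->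
  (\sum_(h : {ffun 'I_B -> G}) cabs (\sum_b phi (h b)) ^+ 2) * #|G|%:R =
  B%:R * (#|G| ^ B)%:R * \sum_t cabs (phi t) ^+ 2.
Proof.
move=> phi0; apply: (@complexI R); rewrite !rmorphM /= !rmorph_sum /= !rmorph_nat.
under eq_bigr => h _.
  rewrite cabs_sqr_conj conjc_sum mulr_suml.
  under eq_bigr => b _ do rewrite mulr_sumr.
  over.
rewrite exchange_big mulr_suml /=.
transitivity (\sum_(b < B) (#|G| ^ B)%:R * \sum_t (cabs (phi t) ^+ 2)%:C%C); last first.
  by rewrite sumr_const card_ord -[LHS]mulr_natl mulrA.
apply: eq_bigr => b _; rewrite exchange_big /= (bigD1 b)//= [X in _ + X]big1 ?addr0.
  rewrite [LHS]mulr_natr (sum_replace b).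
  transitivity (\sum_(h : {ffun 'I_B -> G}) \sum_t (cabs (phi t) ^+ 2)%:C%C).
    by apply: eq_bigr => h _; apply: eq_bigr => t _; rewrite replace_eq cabs_sqr_conj.
  by rewrite sumr_const card_ffun card_ord [RHS]mulr_natl.
move=> c cb; apply/eqP; have [G0|G0] := posnP #|G|.
  apply/eqP; apply: big1 => h _; exfalso.
  by have : (0 < #|G|)%N by [apply/card_gt0P; exists (h b)]; rewrite G0.
have : (#|G|%:R : R[i]) != 0 by rewrite pnatr_eq0 -lt0n.
move/mulIf => inj; apply/eqP/inj; rewrite mul0r [LHS]mulr_natr (sum_replace b).
apply: big1 => h _; under eq_bigr => t _ do rewrite replace_eq replace_neq//.
by rewrite -mulr_suml phi0 mul0r.
Qed.

(** The two sides differ by [#|G|] times |m|^2: the second moment about the mean is the smaller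
    one. *)
Lemma sum_sqr_centered_le (psi : G -> R[i]) (m : R[i]) : \sum_t psi t = #|G|%:R * m ->
  \sum_t cabs (psi t - m) ^+ 2 <= \sum_t cabs (psi t) ^+ 2.
Proof.
move=> psim; suff -> : \sum_t cabs (psi t - m) ^+ 2 =
    \sum_t cabs (psi t) ^+ 2 - #|G|%:R * cabs m ^+ 2.
  by rewrite gerBl mulr_ge0// sqr_ge0.
apply: (@complexI R); rewrite rmorphB rmorphM rmorph_nat /= !rmorph_sum /=.
under eq_bigr => t _.
  rewrite cabs_sqr_conj (rmorphB (conjc : R[i] -> R[i])) /= mulrBl !mulrBr -cabs_sqr_conj.
  rewrite -cabs_sqr_conj; over.
rewrite !sumrB -mulr_suml psim -mulr_sumr -conjc_sum psim conjcM.
have -> : conjc (#|G|%:R : R[i]) = #|G|%:R by rewrite rmorph_nat.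
rewrite [X in _ - (_ - X)](_ : _ = #|G|%:R * (m * conjc m)); last first.
  by rewrite sumr_const cabs_sqr_conj [RHS]mulr_natl.
by rewrite cabs_sqr_conj; ring.
Qed.

End SampleVariance.

Section GroupEstimate.
Variables (R : realType) (p d B : nat).
Hypotheses (p_gt0 : (0 < p)%N) (B_gt0 : (0 < B)%N).
Local Notation G := (grid p d).
Local Notation n := (p ^ d)%N.
Implicit Types (u : signal R p d) (h : {ffun 'I_B -> G}) (f : G).

(** The mean of u_t times the character over all t is the Fourier coefficient divided by sqrt n; the
    factor sqrt n makes the average over B samples unbiased. *)
Definition group_estimate u h f : R[i] :=
  (Num.sqrt n%:R / B%:R)%:C%C * \sum_(b < B) u (h b) * character R f (h b).

(** A single sample, [psi t], has second moment equal to the total energy by Parseval. Centring can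
    only lower it, and averaging B independent copies divides it by B. *)
Lemma group_estimate_variance u f :
  \sum_(h : {ffun 'I_B -> G}) cabs (group_estimate u h f - fourier u f) ^+ 2 <=
  (#|G| ^ B)%:R / B%:R * \sum_g cabs (fourier u g) ^+ 2.
Proof.
have BR : 0 < B%:R :> R by rewrite ltr0n.
have nR : 0 < n%:R :> R by exact: nR_gt0.
have GR : #|G|%:R = n%:R :> R by rewrite card_grid.
have sn : Num.sqrt n%:R ^+ 2 = n%:R :> R by rewrite sqr_sqrtr.
have sn0 : Num.sqrt n%:R != 0 :> R by rewrite gt_eqF// sqrtr_gt0.
have snE : Num.sqrt n%:R = n%:R / Num.sqrt n%:R :> R by rewrite -[X in X / _]sn expr2 mulfK.
pose psi t : R[i] := (Num.sqrt n%:R)%:C%C * (u t * character R f t).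
pose phi t := psi t - fourier u f.
have psiE : \sum_t psi t = #|G|%:R * fourier u f.
  rewrite -mulr_sumr fourierE mulrA; congr (_ * _).
  rewrite card_grid -(rmorph_nat (real_complex R)) -rmorphM /=; congr (_%:C)%C.
  exact: snE.
have phi0 : \sum_t phi t = 0.
  by rewrite sumrB psiE sumr_const -[X in _ - X]mulr_natl subrr.
have estE h : cabs (group_estimate u h f - fourier u f) ^+ 2 =
    (B%:R ^+ 2)^-1 * cabs (\sum_b phi (h b)) ^+ 2.
  rewrite -exprVn -exprMn; congr (_ ^+ 2).
  rewrite -[B%:R^-1]ger0_norm ?invr_ge0 ?ler0n// -cabs_real -cabsM; congr cabs.
  rewrite /phi sumrB sumr_const card_ord -[X in _ * (_ - X)]mulr_natl mulrBr.
  congr (_ - _).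
    rewrite -mulr_sumr mulrA -rmorphM /=; congr (_%:C%C * _).
    by rewrite mulrC.
  rewrite mulrA -(rmorph_nat (real_complex R)) -rmorphM /= mulVf ?gt_eqF//.
  by rewrite rmorph1 mul1r.
under eq_bigr do rewrite estE.
rewrite -mulr_sumr -(ler_pM2r nR) -GR -[leLHS]mulrA sum_centered_sqr//.
have phi_le : \sum_t cabs (phi t) ^+ 2 <= \sum_t cabs (psi t) ^+ 2 :=
  sum_sqr_centered_le psiE.
have psi_sum : \sum_t cabs (psi t) ^+ 2 = #|G|%:R * \sum_g cabs (fourier u g) ^+ 2.
  rewrite Parseval// mulr_sumr; apply: eq_bigr => t _.
  by rewrite !cabsM cabs_real cabs_character// mulr1 exprMn real_normK ?num_real// sn GR.
rewrite psi_sum in phi_le.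
move: phi_le; set S := \sum_g _; set P := \sum_t cabs (phi t) ^+ 2 => phi_le.
have -> : (B%:R ^+ 2)^-1 * (B%:R * (#|G| ^ B)%:R * P) = (#|G| ^ B)%:R / B%:R * P.
  by rewrite -!mulrA mulrCA; field; rewrite gt_eqF.
by rewrite -[leRHS]mulrA ler_wpM2l ?divr_ge0// [leRHS]mulrC.
Qed.

(** Chebyshev with variance at most 6 k M^2 / B and deviation M / 24 gives the bad fraction 6 * 576
    / 2^18, which is below 1/64. This is what fixes the size 2^18 k of a group. *)
Lemma card_group_bad u f (k : nat) (M : R) : (0 < k)%N ->
  B%:R = 2 ^+ 18 * k%:R :> R -> 0 < M ->
  \sum_g cabs (fourier u g) ^+ 2 <= (6 * k)%:R * M ^+ 2 ->
  (64 * #|[pred h | (M / 24 < cabs (group_estimate u h f - fourier u f))%R]| <= #|G| ^ B)%N.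
Proof.
move=> k_gt0 BE M0 uM; set bad := [pred h | _].
have k0 : 0 < k%:R :> R by rewrite ltr0n.
have T0 : 0 <= (#|G| ^ B)%:R :> R by [].
have M24 : 0 < (M / 24) ^+ 2 by rewrite exprn_gt0// divr_gt0.
have : #|bad|%:R * (M / 24) ^+ 2 <= (#|G| ^ B)%:R / B%:R * ((6 * k)%:R * M ^+ 2).
  apply: le_trans (_ : (#|G| ^ B)%:R / B%:R * \sum_g cabs (fourier u g) ^+ 2 <= _).
    apply: le_trans (group_estimate_variance u f).
    rewrite mulr_natl -sumr_const big_mkcond; apply: ler_sum => h _.
    rewrite inE; case: ifP => [hb|_]; last exact: sqr_ge0.
    by rewrite ler_sqr ?nnegrE ?cabs_ge0 ?divr_ge0 ?(ltW M0)// ltW.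
  by rewrite ler_wpM2l// divr_ge0.
have -> : (#|G| ^ B)%:R / B%:R * ((6 * k)%:R * M ^+ 2) =
   (#|G| ^ B)%:R * (6 * 576 / 2 ^+ 18) * (M / 24) ^+ 2 :> R.
  by rewrite BE natrM; field; rewrite gt_eqF.
rewrite ler_pM2r// => badT; rewrite -(ler_nat R) natrM.
apply: le_trans (_ : 64 * ((#|G| ^ B)%:R * (6 * 576 / 2 ^+ 18)) <= _).
  by rewrite ler_wpM2l.
by move: T0; lra.
Qed.

End GroupEstimate.

(** * Robust selection among complex estimates *)

Section MajoritySelection.
Variable R : realType.
Implicit Types (v : nat -> R[i]) (N i : nat).

(** The squared distance is written as a real part because a machine test compares real parts; e is
    a squared tolerance. *)
Definition close v (e : R) i j : bool :=
  complex.Re ((v i - v j) * conjc (v i - v j)) <= e.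

Definition votes v e N i : nat := \sum_(j < N) close v e i j.

(* Stands in for a median of complex numbers: a value close to more than half of
   all values is close to one of the good ones. *)
Fixpoint select v e N i : R[i] :=
  if i is i'.+1 then if (N < 2 * votes v e N i')%N then v i' else select v e N i'
  else 0.

Lemma closeE v (e : R) i j : 0 <= e -> close v (e ^+ 2) i j = (cabs (v i - v j) <= e).
Proof. by move=> e0; rewrite /close Re_mul_conj ler_sqr ?nnegrE ?cabs_ge0. Qed.

Lemma votes_card v e N i : votes v e N i = #|[pred j : 'I_N | close v e i j]|.
Proof.
rewrite -sum1_card [RHS]big_mkcond; apply: eq_bigr => j _.
by rewrite inE; case: close.
Qed.

Lemma select_spec v e N i :
  (exists2 j, (j < i)%N & (N < 2 * votes v e N j)%N /\ select v e N i = v j) \/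
  (forall j, (j < i)%N -> (2 * votes v e N j <= N)%N).
Proof.
elim: i => [|i IH] /=; first by right.
case: ltnP => iN; first by left; exists i.
case: IH => [[j ji [jN ->]]|h]; first by left; exists j; rewrite // ltnW.
by right => j; rewrite ltnS leq_eqVlt => /orP[/eqP ->//|]; apply: h.
Qed.

(** Good values are within E of z, hence within 2 E of one another, so each of them collects a
    majority of votes and the default 0 of [select] is never returned. A value with a majority of
    votes has a good voter, and so is within 2 E + E of z. *)
Lemma select_correct v (E : R) (z : R[i]) N : 0 <= E ->
  (2 * #|[pred r : 'I_N | (E < cabs (v r - z))%R]| < N)%N ->
  cabs (select v ((E *+ 2) ^+ 2) N N - z) <= E *+ 3.
Proof.
move=> E0; set bad := [pred r : 'I_N | _] => badN.
set e := (E *+ 2) ^+ 2; pose good := [predC bad].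
have goodN : (N < 2 * #|good|)%N.
  have : (#|bad| + #|good| = N)%N by rewrite cardC card_ord.
  by move: badN; lia.
have clE i j : close v e i j = (cabs (v i - v j) <= E *+ 2).
  by rewrite closeE// mulrn_wge0.
have close_good (r : 'I_N) : good r -> (N < 2 * votes v e N r)%N.
  move=> gr; apply: (leq_trans goodN); rewrite leq_mul2l /=.
  rewrite votes_card; apply/subset_leq_card/fintype.subsetP => j.
  rewrite !inE -!leNgt clE => jg; apply: le_trans (cabsB3 _ z _) _.
  by rewrite mulr2n lerD//; [move: gr; rewrite /= -leNgt|rewrite cabsB].
have [[j jN [jv ->]]|h] := select_spec v e N N; last first.
  have /card_gt0P[r gr] : (0 < #|good|)%N by move: goodN; case: #|good|; rewrite ?muln0.
  by have := h r (ltn_ord r); rewrite leqNgt close_good.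
pose near := [pred s : 'I_N | close v e j s].
(* Two strict majorities of the same N indices must meet. *)
have /card_gt0P[r] : (0 < #|predI good near|)%N.
  rewrite lt0n; apply/eqP => I0; have UI := cardUI good near.
  rewrite I0 addn0 in UI; have := max_card (predU good near); rewrite UI card_ord.
  move: jv goodN; rewrite votes_card -/near.
  by move: #|good| #|near| => a b; lia.
rewrite !inE -leNgt clE => /andP[rg jr].
by rewrite (le_trans (cabsB3 _ (v r) _))// mulrSr lerD.
Qed.

End MajoritySelection.

(** * One halving round, and a sequence of rounds on fresh batches *)

Section RecoveryRound.
Variables (R : realType) (p d : nat) (x : signal R p d) (k : nat) (mu : R).
Variables (L B : nat).
Hypotheses (p_gt0 : (0 < p)%N) (k_gt0 : (0 < k)%N) (k_le : (k <= p ^ d)%N).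
Hypotheses (mu_def : mu = tail_mean k (fourier x)) (mu_gt0 : 0 < mu).
Hypotheses (B_gt0 : (0 < B)%N) (B_def : B%:R = 2 ^+ 18 * k%:R :> R).
Local Notation G := (grid p d).
Local Notation n := (p ^ d)%N.
Local Notation xh := (fourier x).
Local Notation H := (heavy k (fourier x)).
Definition batch := {ffun 'I_L -> {ffun 'I_B -> G}}.
Implicit Types (y : signal R p d) (t : batch) (f : G) (M : R).

Definition estimates y t f (r : nat) : R[i] :=
  if insub r is Some i then group_estimate (x - inverse_fourier y) (t i) f else 0.

Lemma estimatesE y t f (r : 'I_L) :
  estimates y t f r = group_estimate (x - inverse_fourier y) (t r) f.
Proof. by rewrite /estimates valK. Qed.

(** M / 12 is twice the accuracy M / 24 of a good group, as the selection requires; the selected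
    value is then within 3 * M / 24 = M / 8. *)
Definition residual_estimate y t M f : R[i] :=
  select (estimates y t f) ((M / 12) ^+ 2) L L.

Definition round y t M : signal R p d :=
  [ffun f => if complex.Re (residual_estimate y t M f * conjc (residual_estimate y t M f))
                  <= (3 / 8 * M) ^+ 2
             then y f else y f + residual_estimate y t M f].

Definition sound y M : bool :=
  [forall f, (cabs (xh f - y f) <= M) && ((y f != 0) ==> (f \in H))].

Definition accurate y t M : bool :=
  [forall f, cabs (residual_estimate y t M f - (xh f - y f)) <= M / 8].

Lemma soundP y M : reflect ((forall f, cabs (xh f - y f) <= M) /\
  (forall f, y f != 0 -> f \in H)) (sound y M).
Proof.
apply: (iffP forallP) => [h|[h1 h2] f].
  by split=> f; have /andP[] := h f => // _ /implyP.
by rewrite h1; apply/implyP/h2.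
Qed.

(** An estimate of at most 3 M / 8 that is left out bounds the residual by 3 M / 8 + M / 8 = M / 2,
    and one that is added leaves an error of M / 8. A frequency that newly enters the support has
    true modulus at least 3 M / 8 - M / 8 >= mu / 2. *)
Lemma round_sound y t M : sound y M -> mu *+ 2 <= M -> accurate y t M ->
  sound (round y t M) (M / 2).
Proof.
move=> /soundP[yM yH] muM /forallP acc.
have M0 : 0 < M by rewrite (lt_le_trans _ muM)// pmulrn_lgt0.
apply/soundP; split=> f; rewrite [round y t M f]ffunE; set s := residual_estimate y t M f.
  have sM : cabs (s - (xh f - y f)) <= M / 8 := acc f.
  rewrite Re_mul_conj ler_sqr ?nnegrE ?cabs_ge0 ?mulr_ge0 ?(ltW M0)//.
  case: ifPn => hs; last by rewrite opprD addrA cabsB; move: sM M0; lra.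
  have := cabsD (xh f - y f - s) s; rewrite subrK.
  by move: sM hs; rewrite cabsB; lra.
rewrite Re_mul_conj ler_sqr ?nnegrE ?cabs_ge0 ?mulr_ge0 ?(ltW M0)//.
case: ifPn => hs; first exact: yH.
have [y0|/yH//] := eqVneq (y f) 0.
move=> _; rewrite inE -mu_def.
have := cabsD (s - (xh f - y f)) (xh f - y f); rewrite subrK.
have := acc f; rewrite -/s -ltNge y0 subr0 in hs * => sM sD.
by move: hs muM; rewrite mulr2n; lra.
Qed.

(** For a fixed sound y the residual has energy at most 6 k M^2, so each group is bad for at most
    1/64 of its draws. Majority over L groups gives 4^(-L) per frequency, and the factor n is a
    union over the frequencies. *)
Lemma card_not_accurate y M : sound y M -> mu *+ 2 <= M ->
  (4 ^ L * #|[pred t | ~~ accurate y t M]| <= n * #|{: batch}|)%N.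
Proof.
move=> /soundP[yM yH] muM.
have M0 : 0 < M by rewrite (lt_le_trans _ muM)// pmulrn_lgt0.
pose u := x - inverse_fourier y.
have uE f : fourier u f = xh f - y f by rewrite fourierB inverse_fourierK// !ffunE.
have uen : \sum_g cabs (fourier u g) ^+ 2 <= (6 * k)%:R * M ^+ 2.
  under eq_bigr do rewrite uE.
  by apply: residual_energy => //; rewrite -mu_def.
pose bad f := [pred h : {ffun 'I_B -> G} |
  (M / 24 < cabs (group_estimate u h f - fourier u f))%R].
pose fail f := [pred t : batch | (L <= 2 * #|[pred r | bad f (t r)]|)%N].
have rare f : (4 ^ L * #|fail f| <= #|{: batch}|)%N.
  apply: card_majority_bad; rewrite card_ffun card_ord.
  exact: (card_group_bad p_gt0 B_gt0 f k_gt0 B_def M0 uen).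
apply: (@leq_trans (\sum_f 4 ^ L * #|fail f|)); last first.
  by rewrite -(card_grid p d) -sum_nat_const; apply: leq_sum => f _; apply: rare.
rewrite -big_distrr leq_mul2l; apply/orP; right.
rewrite -sum1_card; under [leqRHS]eq_bigr do rewrite -sum1_card.
rewrite [leqRHS](exchange_big_dep predT)//= big_mkcond.
apply: leq_sum => t _; rewrite inE; case: ifPn => //.
rewrite negb_forall => /existsP[f ft]; rewrite (bigD1 f) ?leq_addr//=.
rewrite inE leqNgt; apply: contra ft => ft.
have M12 : M / 12 = M / 24 *+ 2 by rewrite mulr2n; field.
rewrite /residual_estimate M12.
apply: (le_trans (@select_correct _ _ (M / 24) _ _ _ _)).
- by rewrite divr_ge0// ltW.
- apply: leq_ltn_trans ft; rewrite leq_mul2l /=.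
  apply/subset_leq_card/fintype.subsetP => r; rewrite !inE.
  by rewrite estimatesE uE.
- by rewrite -mulr_natl; lra.
Qed.

Fixpoint rounds y M (b : nat -> batch) i : signal R p d :=
  if i is i'.+1 then round (rounds y M b i') (b i') (M / 2 ^+ i') else y.

Lemma eq_rounds y M (b b' : nat -> batch) i : (forall j, (j < i)%N -> b j = b' j) ->
  rounds y M b i = rounds y M b' i.
Proof. by elim: i => //= i IH bb'; rewrite bb'// IH// => j ji; rewrite bb'// ltnW. Qed.

Section Batches.
Variable K : nat.
Definition batches (h : {ffun 'I_K.+1 -> batch}) (j : nat) : batch := h (inord j).

(** The vector entering round i is a function of the batches before i ([eq_rounds]), so batch i is
    fresh for it and [card_bad_coordinate] applies. The lower bound on M says that round i - 1 still
    works at a scale of at least 2 mu. *)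
Lemma card_rounds_not_sound y M i : sound y M -> (i <= K.+1)%N -> mu * 2 ^+ i <= M ->
  (4 ^ L * #|[pred h | ~~ sound (rounds y M (batches h) i) (M / 2 ^+ i)]|
     <= i * n * #|{ffun 'I_K.+1 -> batch}|)%N.
Proof.
move=> yM; elim: i => [|i IH] iK muM.
  rewrite mul0n mul0n leqn0 muln_eq0; apply/orP; right; apply/eqP/eq_card0 => h.
  by rewrite !inE expr0 divr1 yM.
have muMi : mu *+ 2 <= M / 2 ^+ i.
  by rewrite ler_pdivlMr ?exprn_gt0// (le_trans _ muM)// exprS mulrA mulr_natr.
have {}IH := IH (ltnW iK) (le_trans _ muM).
have {}IH := IH (ler_wpM2l (ltW mu_gt0) (ler_weXn2l (ler1n R 2) (leqnSn i))).
(* Inaccuracy is rare only at sound vectors; histories that are already unsound are charged to the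
   induction hypothesis. *)
pose bad y' t := sound y' (M / 2 ^+ i) && ~~ accurate y' t (M / 2 ^+ i).
have E2 : (4 ^ L * #|[pred h : {ffun 'I_K.+1 -> batch} |
    bad (rounds y M (batches h) i) (h (inord i))]| <= n * #|{ffun 'I_K.+1 -> batch}|)%N.
  apply: (@card_bad_coordinate _ _ _ (fun h => rounds y M (batches h) i) bad).
    move=> h t; apply: eq_rounds => j ji; rewrite /batches replace_neq//.
    rewrite -val_eqE /= !inordK ?(ltn_trans ji)//.
    by rewrite neq_ltn ji.
  move=> h; set y' := rounds _ _ _ _.
  have [sy|sy] := boolP (sound y' (M / 2 ^+ i)).
    rewrite (eq_card (B := [pred t | ~~ accurate y' t (M / 2 ^+ i)])).
      exact: card_not_accurate.
    by move=> t; rewrite !inE /bad unfold_in sy.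
  by rewrite eq_card0 ?muln0// => t; rewrite unfold_in /bad (negbTE sy).
rewrite mulSn mulnDl; apply: leq_trans (leq_add E2 IH); rewrite -mulnDr leq_mul2l.
apply/orP; right; rewrite -cardUI (leq_trans _ (leq_addr _ _))//.
apply/subset_leq_card/fintype.subsetP => h; rewrite !inE /= /bad.
set y' := rounds _ _ _ _; rewrite -[h (inord i)]/(batches h i) => bad_h.
case: (boolP (sound y' _)) => sy; rewrite ?orbT//= orbF.
apply: contra bad_h => acc.
have -> : M / 2 ^+ i.+1 = M / 2 ^+ i / 2 by rewrite exprSr invfM mulrA.
exact: round_sound.
Qed.

End Batches.
End RecoveryRound.

(** * Rounding to a coarse grid with shifted cell boundaries *)

Lemma div_offset (P s : nat) : (0 < s < P)%N -> ((4 * P ^ 2 + P - s) %/ P = 4 * P)%N.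
Proof.
move=> /andP[s0 sP]; have P0 : (0 < P)%N by apply: leq_trans sP.
rewrite -addnBA ?(ltnW sP)// expnS expn1 mulnA divnMDl// divn_small ?addn0//.
by rewrite ltn_subrL s0.
Qed.

Section GridRounding.
Variables (R : realType) (q : nat) (delta : R).
Hypothesis delta_gt0 : 0 < delta.
Local Notation Q := (2 ^ q)%N.
Implicit Types (a b : R) (j s : nat) (z w : R[i]).

(* Bisection for floor (a / delta); the machine has no floor operation. *)
Fixpoint fine_index_rec nb acc a : nat :=
  if nb is nb'.+1 then
    fine_index_rec nb' (if ((acc + 2 ^ nb')%:R * delta <= a)%R then acc + 2 ^ nb' else acc)%N a
  else acc.

(** Added before indexing so that cell indices are naturals. At a stage of scale M = 2 Q^2 delta it
    equals 2 M, which exceeds every increment; being a multiple of Q delta, it makes 0 a coarse grid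
    point. *)
Definition rounding_offset : R := (4 * Q ^ 2)%:R * delta.

(** 2 q + 3 bisections distinguish 2^(2 q + 3) = 8 Q^2 cells of width delta, exactly the interval
    from minus to plus the offset. *)
Definition fine_index a : nat := fine_index_rec (2 * q + 3) 0 (a + rounding_offset).

(** A coarse cell consists of Q fine cells and starts at an index congruent to s modulo Q. The shift
    moves only these boundaries: the values are multiples of Q delta for every s. Adding Q before
    subtracting s avoids truncated subtraction. *)
Definition coarse_value s (i : nat) : R :=
  ((i + Q - s) %/ Q)%:R * (Q%:R * delta) - rounding_offset.

Definition grid_round s z : R[i] :=
  Complex (coarse_value s (fine_index (complex.Re z)))
          (coarse_value s (fine_index (complex.Im z))).

(** A fine index i can be off by one. Going from i to i - 1 crosses a boundary when j is i modulo Q,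
    and going to i + 1 when j is i + 1 modulo Q; both parts of z are tested. *)
Definition kills z j : bool :=
  [|| j == (fine_index (complex.Re z) %% Q)%N, j == ((fine_index (complex.Re z)).+1 %% Q)%N,
      j == (fine_index (complex.Im z) %% Q)%N | j == ((fine_index (complex.Im z)).+1 %% Q)%N].

Lemma fine_index_recP nb acc a : acc%:R * delta <= a < (acc + 2 ^ nb)%:R * delta ->
  let i := fine_index_rec nb acc a in i%:R * delta <= a < i.+1%:R * delta.
Proof.
elim: nb acc => [|nb IH] acc /=; first by rewrite expn0 addn1.
move=> /andP[h1 h2]; apply: IH; case: ifPn => h; last by rewrite h1 ltNge.
by rewrite h -addnA addnn -mul2n -expnS.
Qed.

Lemma fine_index_rec_lt nb acc a : (fine_index_rec nb acc a < acc + 2 ^ nb)%N.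
Proof.
elim: nb acc => [|nb IH] acc /=; first by rewrite addn1.
apply: leq_trans (IH _) _; rewrite expnS mul2n -addnn addnA; case: ifP => // _.
by rewrite leq_add2r leq_addr.
Qed.

Lemma fine_index_lt a : (fine_index a < 8 * Q ^ 2)%N.
Proof.
have <- : (2 ^ (2 * q + 3) = 8 * Q ^ 2)%N by rewrite expnD [(2 * q)%N]mulnC expnM mulnC.
exact: fine_index_rec_lt.
Qed.

Lemma fine_indexP a : - rounding_offset <= a < rounding_offset ->
  (fine_index a)%:R * delta <= a + rounding_offset < (fine_index a).+1%:R * delta.
Proof.
move=> /andP[a1 a2]; apply: fine_index_recP; rewrite mul0r add0n.
rewrite -[X in X <= _](subrr rounding_offset) [X in X <= _]addrC lerD2r a1 /=.
have -> : (2 ^ (2 * q + 3))%:R * delta = rounding_offset + rounding_offset.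
  rewrite /rounding_offset -mulrDl -natrD; congr (_%:R * _).
  by rewrite expnD [(2 * q)%N]mulnC expnM; lia.
by rewrite ltrD2r.
Qed.

Lemma fine_index0 : fine_index 0 = (4 * Q ^ 2)%N.
Proof.
have off0 : 0 < rounding_offset by rewrite mulr_gt0// ltr0n muln_gt0 !expn_gt0.
have : - rounding_offset <= 0 < rounding_offset by rewrite off0 oppr_le0 ltW.
move=> /fine_indexP; rewrite add0r !ler_pM2r// !ltr_pM2r// ler_nat ltr_nat ltnS.
by rewrite -eqn_leq => /eqP.
Qed.

(** Needed so that rounding adds nothing to the support. The shift 0 is excluded because it would
    put index 4 Q^2, that of the number 0, into the next coarse cell. *)
Lemma grid_round0 s : (0 < s < Q)%N -> grid_round s 0 = 0.
Proof.
move=> /andP[s0 sQ]; rewrite /grid_round /= fine_index0 /coarse_value.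
rewrite (div_offset (P := Q)) ?s0//.
have -> : (4 * Q)%:R * (Q%:R * delta) - rounding_offset = 0 :> R.
  by rewrite /rounding_offset mulrA -natrM -mulnA subrr.
by [].
Qed.

Lemma coarse_value_near s a : (s < Q)%N -> - rounding_offset <= a < rounding_offset ->
  `|a - coarse_value s (fine_index a)| <= Q%:R * delta.
Proof.
move=> sQ /fine_indexP /andP[]; set i := fine_index a => h1 h2.
have Q0 : (0 < Q)%N by rewrite expn_gt0.
rewrite /coarse_value opprD opprK addrA [a - _]addrC -addrA.
set c := ((i + Q - s) %/ Q)%N.
have c1 : (c * Q <= i + Q - s)%N by exact: leq_trunc_div.
have c2 : (i + Q - s < c.+1 * Q)%N by rewrite ltn_ceil.
rewrite ler_norml mulrA -natrM; apply/andP; split.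
  have : (c * Q)%:R * delta <= (i + Q)%:R * delta.
    by rewrite ler_pM2r// ler_nat (leq_trans c1)// leq_subr.
  by rewrite natrD mulrDl; move: h1; lra.
have : i.+1%:R * delta <= (c.+1 * Q)%:R * delta.
  by rewrite ler_pM2r// ler_nat; move: c2 sQ; move: Q => Q'; lia.
by rewrite mulSn natrD mulrDl; move: h2; lra.
Qed.

(** Numbers within delta have fine indices that differ by at most one, and the two residues avoided
    by s are the only ones where such a step changes the coarse cell. *)
Lemma coarse_value_stable s a b : (s < Q)%N ->
  - rounding_offset <= a < rounding_offset -> - rounding_offset <= b < rounding_offset ->
  `|a - b| <= delta ->
  s != (fine_index a %% Q)%N -> s != ((fine_index a).+1 %% Q)%N ->
  coarse_value s (fine_index a) = coarse_value s (fine_index b).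
Proof.
move=> sQ /fine_indexP /andP[]; set i := fine_index a => a1 a2.
move=> /fine_indexP /andP[]; set j := fine_index b => b1 b2.
rewrite ler_norml => /andP[ab1 ab2] si si1.
have Q0 : (0 < Q)%N by rewrite expn_gt0.
have ij : (i < j.+2)%N.
  rewrite -(ltr_nat R) -(ltr_pM2r delta_gt0) -natr1 mulrDl mul1r.
  by move: a1 b2 ab2; lra.
have ji : (j < i.+2)%N.
  rewrite -(ltr_nat R) -(ltr_pM2r delta_gt0) -natr1 mulrDl mul1r.
  by move: a2 b1 ab1; lra.
rewrite /coarse_value; congr (_%:R * _ - _).
(* The quotient grows from m to m + 1 only if Q divides m + 1 + Q - s. *)
have step m : s != (m.+1 %% Q)%N -> ((m + Q - s) %/ Q = (m.+1 + Q - s) %/ Q)%N.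
  move=> sm; have -> : (m.+1 + Q - s = (m + Q - s).+1)%N by lia.
  rewrite divnS//; suff -> : (Q %| (m + Q - s).+1)%N = false by [].
  apply/negP => /dvdnP[c mc]; move/eqP: sm; apply.
  have -> : (m.+1 = s + (m + Q - s).+1 - Q)%N by lia.
  have c0 : (0 < c)%N by case: c mc.
  rewrite mc -(prednK c0) mulSn addnCA addKn.
  by rewrite addnC modnMDl modn_small.
have [ij1|ij1|->//] := ltngtP i j.
  have -> : j = i.+1 by lia.
  exact: step.
have iE : i = j.+1 by lia.
by rewrite [in LHS]iE; apply/esym/step; rewrite -iE.
Qed.

(** The hypothesis on s concerns z alone. This asymmetry is essential: z is the computed increment,
    which the program can test, while w is the exact one, which it cannot see. *)
Lemma grid_round_stable s z w (M : R) : (s < Q)%N -> 0 <= M < rounding_offset ->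
  cabs z <= M -> cabs w <= M -> cabs (z - w) <= delta -> ~~ kills z s ->
  grid_round s z = grid_round s w.
Proof.
move=> sQ /andP[M0 Moff] zM wM zw; rewrite /kills !negb_or => /and4P[k1 k2 k3 k4].
have bnd (a : R) : `|a| <= M -> - rounding_offset <= a < rounding_offset.
  by rewrite ler_norml => /andP[h1 h2]; rewrite (le_lt_trans h2)// (le_trans _ h1)// lerN2 ltW.
by rewrite /grid_round; congr Complex; apply: coarse_value_stable => //;
  rewrite ?bnd// -?ReB -?ImB ?(le_trans (Re_le_cabs _))// (le_trans (Im_le_cabs _)).
Qed.

Lemma grid_round_near s z (M : R) : (s < Q)%N -> 0 <= M < rounding_offset ->
  cabs z <= M -> cabs (z - grid_round s z) <= (Q%:R * delta) *+ 2.
Proof.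
move=> sQ /andP[M0 Moff] zM.
have bnd (a : R) : `|a| <= M -> - rounding_offset <= a < rounding_offset.
  by rewrite ler_norml => /andP[h1 h2]; rewrite (le_lt_trans h2)// (le_trans _ h1)// lerN2 ltW.
by apply: cabs_le_ReIm; rewrite ?ReB ?ImB; apply: coarse_value_near => //; apply: bnd;
  rewrite ?(le_trans (Re_le_cabs _))// (le_trans (Im_le_cabs _)).
Qed.

End GridRounding.

(** * Stages, the complete recovery, and the union bound over trajectories *)

Fixpoint last_free (P : pred nat) i : nat :=
  if i is i'.+1 then if P i' then last_free P i' else i' else 0.

Lemma last_freeP (P : pred nat) i : (exists2 j, (j < i)%N & ~~ P j) ->
  (last_free P i < i)%N && ~~ P (last_free P i).
Proof.
elim: i => [[]//|i IH] [j ji Pj] /=; case: ifPn => [Pi|->]; last by rewrite leqnn.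
have /andP[h ->] : (last_free P i < i)%N && ~~ P (last_free P i).
  apply: IH; exists j => //; move: ji; rewrite ltnS leq_eqVlt => /orP[/eqP ji|//].
  by rewrite ji Pi in Pj.
by rewrite ltnW.
Qed.

(** The number 0 has fine index 4 Q^2, so all the frequencies with zero increment together kill only
    the shifts 0 and 1 modulo Q. *)
Lemma offset_modn (P : nat) :
  ((4 * P ^ 2) %% P = 0)%N /\ ((4 * P ^ 2).+1 %% P = 1 %% P)%N.
Proof.
rewrite expnS expn1 mulnA modnMl; split=> //.
by rewrite -[(4 * P * P).+1]addn1 modnMDl.
Qed.

Lemma signal_subE (R : realType) (p d : nat) (u v : signal R p d) f :
  (u - v) f = u f - v f.
Proof. by rewrite !ffunE. Qed.

Section Recovery.
Variables (R : realType) (p d : nat) (x : signal R p d) (k : nat) (mu : R).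
Variables (L B q : nat).
Hypotheses (p_gt0 : (0 < p)%N) (k_gt0 : (0 < k)%N) (k_le : (k <= p ^ d)%N).
Hypotheses (mu_def : mu = tail_mean k (fourier x)) (mu_gt0 : 0 < mu).
Hypotheses (B_gt0 : (0 < B)%N) (B_def : B%:R = 2 ^+ 18 * k%:R :> R).
Hypothesis Q_ge : (32 * k <= 2 ^ q)%N.
Local Notation G := (grid p d).
Local Notation n := (p ^ d)%N.
Local Notation xh := (fourier x).
Local Notation H := (heavy k (fourier x)).
Local Notation Q := (2 ^ q)%N.
Local Notation kappa := ((2 * q).+1).
Local Notation batch := (batch p d L B).
Implicit Types (y : signal R p d) (b : nat -> batch) (m : nat) (f : G).

Definition shift_killed (delta : R) (z : signal R p d) j : bool :=
  [exists f, kills q delta (z f) j].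

Definition shift (delta : R) (z : signal R p d) : nat :=
  last_free (shift_killed delta z) Q.

Definition round_to_grid (delta : R) y (z : signal R p d) j : signal R p d :=
  [ffun f => y f + grid_round q delta j (z f)].

Definition scale m : R := mu * 2 ^+ m.

Definition stage y m b : signal R p d :=
  let y' := rounds x y (scale m) b kappa in
  let delta := scale m / 2 ^+ kappa in
  round_to_grid delta y (y' - y) (shift delta (y' - y)).

(** Fuel is needed because m decreases by q. When fewer than 2 q + 1 halvings remain they are done
    without rounding, since no later stage reuses the samples. *)
Fixpoint recover fuel y m b : signal R p d :=
  if fuel is fuel'.+1 then
    if (kappa <= m)%N then recover fuel' (stage y m b) (m - q) b
    else rounds x y (scale m) b m
  else y.

Lemma eq_stage y m b b' : (forall j, (j < kappa)%N -> b j = b' j) ->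
  stage y m b = stage y m b'.
Proof. by move=> bb'; rewrite /stage (eq_rounds _ _ _ bb'). Qed.

Lemma eq_recover fuel y m b b' : (forall j, (j < kappa)%N -> b j = b' j) ->
  recover fuel y m b = recover fuel y m b'.
Proof.
move=> bb'; elim: fuel y m => //= fuel IH y m.
case: leqP => km; last by rewrite (eq_stage _ _ bb') IH.
by apply: eq_rounds => j jm; apply: bb'; apply: leq_trans km; apply: ltnW.
Qed.

Lemma scale_gt0 m : 0 < scale m.
Proof. by rewrite mulr_gt0// exprn_gt0. Qed.

Lemma q_gt0 : (0 < q)%N.
Proof. by move: Q_ge k_gt0; case: q => //; rewrite expn0; lia. Qed.

Definition ideal y m j : signal R p d :=
  round_to_grid (scale m / 2 ^+ kappa) y (xh - y) j.

(** Each frequency of S kills at most four shifts and all others only 0 and 1 modulo Q. That is at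
    most 20 k + 2 shifts, fewer than the 32 k <= Q available. *)
Lemma shift_free delta (z : signal R p d) (S : {set G}) : 0 < delta ->
  (forall f, f \notin S -> z f = 0) -> (#|S| <= 5 * k)%N ->
  (shift delta z < Q)%N && ~~ shift_killed delta z (shift delta z).
Proof.
move=> delta0 zS Sk; apply: last_freeP; apply: contrapT => /forall2NP all_killed.
pose killed f := [:: fine_index q delta (complex.Re (z f)) %% Q;
  (fine_index q delta (complex.Re (z f))).+1 %% Q;
  fine_index q delta (complex.Im (z f)) %% Q;
  (fine_index q delta (complex.Im (z f))).+1 %% Q]%N.
(* A list of all shifts that can be killed; if none were free, it would contain 0, ..., Q - 1. *)
pose s := [:: 0, (1 %% Q)%N & flatten [seq killed f | f <- enum S]]%N.
have : (size (iota 0 Q) <= size s)%N.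
  apply: uniq_leq_size; first exact: iota_uniq.
  move=> i; rewrite mem_iota add0n => /andP[_ iQ].
  have [//|/negP] := all_killed i; rewrite negbK => /existsP[f].
  have [fS|fS] := boolP (f \in S).
    move=> fk; rewrite !in_cons; apply/orP; right; apply/orP; right.
    apply/flattenP; exists (killed f); first by rewrite map_f// mem_enum.
    by rewrite !inE.
  have [e1 e2] := offset_modn Q.
  rewrite /kills zS//= fine_index0// e1 e2 !inE.
  by move=> /or4P[] ->; rewrite ?orbT.
rewrite size_iota /= size_flatten /shape -map_comp sumnE big_map.
rewrite (eq_bigr (fun=> 4%N))// big_const_seq.
rewrite count_predT iter_addn_0 -cardE.
by move: Sk Q_ge k_gt0; move: #|S| => h; move: (2 ^ q)%N => Q'; lia.
Qed.

(** The computed increment y' - y is within delta of the exact xh - y, and the chosen shift is not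
    killed by it. So both round to the same point, which is why the outcome is one of the Q
    sample-free vectors [ideal y m j]. *)
Lemma stage_sound y m b : (kappa <= m)%N -> sound x k y (scale m) ->
  sound x k (rounds x y (scale m) b kappa) (scale m / 2 ^+ kappa) ->
  exists2 j, (j < Q)%N & stage y m b = ideal y m j /\
    sound x k (stage y m b) (scale (m - q)).
Proof.
move=> km /soundP[yM yH] /soundP[]; rewrite /stage /ideal.
set y' := rounds _ _ _ _ _; set delta := _ / _ => y'M y'H.
set M := scale m in yM.
have M0 : 0 < M by exact: scale_gt0.
have delta0 : 0 < delta by rewrite divr_gt0// exprn_gt0.
have zS f : f \notin H -> (y' - y) f = 0.
  move=> fH; have [y0|/yH] := eqVneq (y f) 0; last by rewrite (negbTE fH).
  have [y'0|/y'H] := eqVneq (y' f) 0; last by rewrite (negbTE fH).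
  by rewrite signal_subE y0 y'0 subr0.
have Hk : (#|H| <= 5 * k)%N by apply: card_heavy => //; rewrite -mu_def.
have /andP[jQ jfree] := shift_free delta0 zS Hk.
set j := shift _ _ in jQ jfree *; exists j => //.
have QR : 2 ^+ q = Q%:R :> R by rewrite natrX.
(* The 2 q + 1 halvings divide M by 2^(2 q + 1) = 2 Q^2. *)
have Mdelta : M = 2 * Q%:R ^+ 2 * delta.
  by rewrite /delta -QR -exprM [(q * 2)%N]mulnC -exprS mulrC divfK// expf_neq0.
have Q1 : 1 <= Q%:R :> R by rewrite ler1n expn_gt0.
have offE : rounding_offset q delta = M + M.
  by rewrite /rounding_offset natrM natrX Mdelta; ring.
have dM : delta < M by rewrite Mdelta ltr_pMl// expr2; nra.
have range : 0 <= M + delta < rounding_offset q delta.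
  by rewrite offE ltrD2l dM addr_ge0// ltW.
have zM f : cabs ((y' - y) f) <= M + delta.
  rewrite signal_subE (le_trans (cabsB3 _ (xh f) _))// addrC lerD//.
  by rewrite cabsB.
have rM f : cabs ((xh - y) f) <= M + delta.
  by rewrite signal_subE (le_trans (yM f))// lerDl ltW.
have stageE : round_to_grid delta y (y' - y) j = round_to_grid delta y (xh - y) j.
  apply/ffunP => f; rewrite ffunE [RHS]ffunE; congr (_ + _).
  apply: (grid_round_stable delta0 jQ range (zM f) (rM f)).
    by rewrite !signal_subE opprB addrA subrK cabsB.
  by move: jfree; rewrite negb_exists => /forallP.
split => //; apply/soundP; split => f.
  rewrite stageE [round_to_grid _ _ _ _ _]ffunE opprD addrA.
  have -> : xh f - y f = (xh - y) f by rewrite signal_subE.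
  apply: (le_trans (grid_round_near delta0 jQ range (rM f))).
  have qm : (q <= m)%N by apply: leq_trans km; lia.
  have -> : scale (m - q) = M / 2 ^+ q.
    by rewrite /M /scale -{2}(subnK qm) exprD mulrA mulfK// expf_neq0.
  (* The rounding error 2 Q delta is exactly M / Q, the scale of the next stage. *)
  rewrite Mdelta QR -mulr_natl expr2.
  by rewrite (_ : _ / _ = 2 * (Q%:R * delta))//; field; rewrite gt_eqF// (lt_le_trans _ Q1).
(* A light frequency has zero increment. It kills the shift 0, so j > 0 and the increment is rounded
   to 0. *)
apply: contraR => fH; rewrite ffunE zS//.
have y0 : y f = 0 by apply/eqP; apply: contraR fH => /yH.
rewrite y0 add0r grid_round0// jQ andbT lt0n.
apply: contra jfree => /eqP ->; apply/existsP; exists f.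
by rewrite /kills zS//= fine_index0// (offset_modn Q).1.
Qed.

(** Let c(m) count the units kappa n / 4^L of failure. A stage fails in its own rounds (one unit) or
    ends in one of Q vectors fixed before any sample is seen, from each of which the induction
    hypothesis applies to the same batches. So 1 + Q c(m - q) bounds c(m), and c(m) = 2^(m+1) - 1
    satisfies this because Q >= 2. *)
Lemma card_recover fuel y m : sound x k y (scale m) -> (m < fuel)%N ->
  (4 ^ L * #|[pred h : {ffun 'I_kappa -> batch} |
       ~~ sound x k (recover fuel y m (batches h)) mu]|
     <= (2 ^ m.+1 - 1) * (kappa * n * #|{ffun 'I_kappa -> batch}|))%N.
Proof.
have scaleE m' i : (i <= m')%N -> scale m' / 2 ^+ i = scale (m' - i).
  by move=> im; rewrite /scale -{1}(subnK im) exprD mulrA mulfK// expf_neq0.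
have le_scale m' i : (i <= m')%N -> mu * 2 ^+ i <= scale m'.
  by move=> im; rewrite ler_pM2l// ler_weXn2l// ler1n.
set N := #|{ffun _ -> _}|.
elim: fuel y m => // fuel IH y m yM mf.
have [km|mk] := leqP kappa m; last first.
  rewrite (eq_card (B := [pred h : {ffun 'I_kappa -> batch} |
      ~~ sound x k (rounds x y (scale m) (batches h) m) mu])); last first.
    by move=> h; rewrite !inE /= ltnNge -ltnS mk.
  have := card_rounds_not_sound L p_gt0 k_gt0 k_le mu_def mu_gt0 B_gt0
    B_def yM (ltnW mk) (le_scale _ _ (leqnn m)).
  rewrite scaleE// subnn /scale expr0 mulr1 => /leq_trans; apply.
  rewrite mulnA leq_mul2r; apply/orP; right; rewrite -[leqLHS]mul1n leq_mul//.
    by rewrite expnS; have := expn_gt0 2 m; lia.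
  by rewrite leq_mul2r ltnW ?orbT.
have q0 := q_gt0; have qm : (q <= m)%N by apply: leq_trans km; lia.
pose h_fail := [pred h : {ffun 'I_kappa -> batch} |
  ~~ sound x k (rounds x y (scale m) (batches h) kappa) (scale m / 2 ^+ kappa)].
(* Soundness is part of the event, so that candidates j which no good stage produces contribute
   nothing. *)
pose j_fail j := [pred h : {ffun 'I_kappa -> batch} | sound x k (ideal y m j) (scale (m - q)) &&
  ~~ sound x k (recover fuel (ideal y m j) (m - q) (batches h)) mu].
have h_card : (4 ^ L * #|h_fail| <= kappa * n * N)%N.
  exact: card_rounds_not_sound (le_scale _ _ km).
have j_card j : (4 ^ L * #|j_fail j| <= (2 ^ (m - q).+1 - 1) * (kappa * n * N))%N.
  have [s|s] := boolP (sound x k (ideal y m j) (scale (m - q))).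
    have mqf : (m - q < fuel)%N by move: mf qm q0; lia.
    apply: leq_trans (IH _ _ s mqf); rewrite leq_mul2l; apply/orP; right.
    by apply/subset_leq_card/fintype.subsetP => h; rewrite !inE => /andP[].
  by rewrite eq_card0 ?muln0// => h; rewrite !inE (negbTE s).
apply: (@leq_trans (kappa * n * N + Q * ((2 ^ (m - q).+1 - 1) * (kappa * n * N)))); last first.
  have -> : (2 ^ m.+1 = Q * 2 ^ (m - q).+1)%N by rewrite -expnD addnS subnKC.
  have : (1 < Q)%N by rewrite -{1}(expn0 2) ltn_exp2l.
  have : (0 < 2 ^ (m - q).+1)%N by rewrite expn_gt0.
  move: (2 ^ q)%N (2 ^ _)%N (kappa * n * N)%N => a c e c0 a1.
  rewrite -[X in (X + _)%N]mul1n mulnA -mulnDl leq_mul2r; apply/orP; right.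
  by rewrite mulnBr muln1; nia.
apply: leq_trans (leq_add h_card (_ : (\sum_(j < Q) 4 ^ L * #|j_fail j| <= _)%N)); last first.
  rewrite -[X in (_ <= X * _)%N]card_ord -sum_nat_const.
  by apply: leq_sum => j _; exact: j_card.
rewrite -big_distrr -mulnDr leq_mul2l; apply/orP; right.
rewrite -!sum1_card; under [X in (_ <= _ + X)%N]eq_bigr do rewrite -sum1_card.
rewrite [X in (_ <= _ + X)%N](exchange_big_dep predT)//=.
rewrite big_mkcond [X in (_ <= X + _)%N]big_mkcond -big_split /=.
apply: leq_sum => h _; rewrite !inE.
case: (boolP (sound x k (recover fuel.+1 y m (batches h)) mu)) => //= bad_h.
case: (boolP (sound x k (rounds x y (scale m) (batches h) kappa) _)) => //= hf.
have [j jQ [jE js]] := stage_sound km yM hf.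
rewrite km in bad_h.
rewrite add0n (bigD1 (Ordinal jQ)) ?leq_addr//=.
by rewrite !inE -jE js.
Qed.

End Recovery.

(* Array a occupies the addresses congruent to a modulo 32, so that arrays of
   unbounded length share one memory. A scalar is entry 0 of its array. *)
Definition arr (a i : nat) : nat := (i * 32 + a)%N.

Definition AA (a : nat) (e : iexp) : iexp := IAdd (IMul e (IConst 32)) (IConst a).
Definition AV (a : nat) : iexp := AA a (IConst 0).
Definition IA (a : nat) (e : iexp) : iexp := ILoad (AA a e).
Definition IV (a : nat) : iexp := ILoad (AV a).
Definition CA (a : nat) (e : iexp) : cexp := CLoad (AA a e).
Definition CV (a : nat) : cexp := CLoad (AV a).

Definition For (v b : nat) (body : cmd) : cmd :=
  Seq (ISet (AV v) (IConst 0))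
      (While (BNot (BILe (IV b) (IV v)))
         (Seq body (ISet (AV v) (IAdd (IV v) (IConst 1))))).

Definition Fill (v b a : nat) (base : iexp) (e : cexp) : cmd :=
  For v b (CSet (AA a (IAdd base (IV v))) e).

(** Conservative: only targets that are visibly entries of another array pass; any other address
    counts as a possible write to a. *)
Definition avoids (a : nat) (e : iexp) : bool :=
  if e is IAdd (IMul _ (IConst w)) (IConst b) then [&& w == 32, b < 32 & b != a]%N
  else false.

(* A syntactic criterion: if it holds, then no execution of c writes to the
   integer (complex, for ckeeps) array a. *)
Fixpoint ikeeps (a : nat) (c : cmd) : bool :=
  match c with
  | ISet e _ | DrawIndex e => avoids a e
  | Seq c1 c2 | If _ c1 c2 => ikeeps a c1 && ikeeps a c2
  | While _ c1 => ikeeps a c1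
  | _ => true
  end.

Fixpoint ckeeps (a : nat) (c : cmd) : bool :=
  match c with
  | CSet e _ | Query e _ | DrawSquare e _ _ => avoids a e
  | Seq c1 c2 | If _ c1 c2 => ckeeps a c1 && ckeeps a c2
  | While _ c1 => ckeeps a c1
  | _ => true
  end.

Fixpoint quiet (c : cmd) : bool :=
  match c with
  | Query _ _ | DrawIndex _ | DrawSquare _ _ _ => false
  | Seq c1 c2 | If _ c1 c2 => quiet c1 && quiet c2
  | While _ c1 => quiet c1
  | _ => true
  end.

Lemma arr_inj a b i j : (a < 32)%N -> (b < 32)%N -> arr a i = arr b j -> a = b /\ i = j.
Proof. by rewrite /arr => ? ? ?; split; lia. Qed.

Lemma arr_eq a b i j : (a < 32)%N -> (b < 32)%N ->
  (arr a i == arr b j) = (a == b) && (i == j).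
Proof.
by move=> ha hb; apply/eqP/andP => [/(arr_inj ha hb)[-> ->]|[/eqP -> /eqP ->]].
Qed.

(** * A program logic with step counts and syntactic frame conditions *)

Section ProgramLogic.
Variables (R : realType) (p d W : nat) (x : signal R p d) (tau : nat -> draw R p d).
Local Notation ex := (exec W x tau).
Implicit Types (s : state R) (c : cmd) (Q : state R -> Prop) (a b v i j : nat).

Definition ia s a i : nat := imem s (arr a i).
Definition ca s a i : R[i] := cmem s (arr a i).

Lemma evIA s a e : ieval s (IA a e) = ia s a (ieval s e). Proof. by []. Qed.
Lemma evIV s a : ieval s (IV a) = ia s a 0. Proof. by []. Qed.
Lemma evAdd s e1 e2 : ieval s (IAdd e1 e2) = (ieval s e1 + ieval s e2)%N. Proof. by []. Qed.
Lemma evSub s e1 e2 : ieval s (ISub e1 e2) = (ieval s e1 - ieval s e2)%N. Proof. by []. Qed.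
Lemma evMul s e1 e2 : ieval s (IMul e1 e2) = (ieval s e1 * ieval s e2)%N. Proof. by []. Qed.
Lemma evDiv s e1 e2 : ieval s (IDiv e1 e2) = (ieval s e1 %/ ieval s e2)%N. Proof. by []. Qed.
Lemma evMod s e1 e2 : ieval s (IMod e1 e2) = (ieval s e1 %% ieval s e2)%N. Proof. by []. Qed.
Lemma evConst s i : ieval s (IConst i) = i. Proof. by []. Qed.
Lemma evCA s a e : ceval s (CA a e) = ca s a (ieval s e). Proof. by []. Qed.
Lemma evCV s a : ceval s (CV a) = ca s a 0. Proof. by []. Qed.
Lemma evCNat s e : ceval s (COfNat e) = (ieval s e)%:R. Proof. by []. Qed.
Lemma evCRoot s e : ceval s (CRoot e) = root_of_unity R (ieval s e). Proof. by []. Qed.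
Lemma evCAdd s e1 e2 : ceval s (CAdd e1 e2) = ceval s e1 + ceval s e2. Proof. by []. Qed.
Lemma evCSub s e1 e2 : ceval s (CSub e1 e2) = ceval s e1 - ceval s e2. Proof. by []. Qed.
Lemma evCMul s e1 e2 : ceval s (CMul e1 e2) = ceval s e1 * ceval s e2. Proof. by []. Qed.
Lemma evCDiv s e1 e2 : ceval s (CDiv e1 e2) = ceval s e1 / ceval s e2. Proof. by []. Qed.
Lemma evCConj s e : ceval s (CConj e) = conjc (ceval s e). Proof. by []. Qed.
Lemma evCSqrt s e : ceval s (CSqrt e) = (Num.sqrt (complex.Re (ceval s e)))%:C%C.
Proof. by []. Qed.
Lemma evBILe s e1 e2 : beval s (BILe e1 e2) = (ieval s e1 <= ieval s e2)%N.
Proof. by []. Qed.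
Lemma evBCLe s e1 e2 :
  beval s (BCLe e1 e2) = (complex.Re (ceval s e1) <= complex.Re (ceval s e2)).
Proof. by []. Qed.
Lemma evBNot s e : beval s (BNot e) = ~~ beval s e. Proof. by []. Qed.
Lemma evBAnd s e1 e2 : beval s (BAnd e1 e2) = beval s e1 && beval s e2.
Proof. by []. Qed.
Definition evE := (evIA, evIV, evAdd, evSub, evMul, evDiv, evMod, evConst, evCA, evCV,
  evCNat, evCRoot, evCAdd, evCSub, evCMul, evCDiv, evCConj, evCSqrt,
  evBILe, evBCLe, evBNot, evBAnd).

Lemma avoidsP s a e i : (a < 32)%N -> avoids a e -> (arr a i == ieval s e) = false.
Proof.
move=> ha; case: e => // e1 e2; case: e1 => // e1 e3; case: e3 => // w.
case: e2 => // b /and3P[/eqP -> hb ba]; rewrite !evE -/(arr b (ieval s e1)) arr_eq//.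
by rewrite eq_sym (negbTE ba).
Qed.

Lemma ikeepsP c s s' : ex c s s' -> forall a i, (a < 32)%N -> ikeeps a c ->
  ia s' a i = ia s a i.
Proof.
elim=> //=.
- by move=> e e' {}s _ a i ha he; rewrite /ia /= /upd avoidsP.
- by move=> e {}s _ a i ha he; rewrite /ia /= /upd avoidsP.
- by move=> c1 c2 {}s s1 s2 _ IH1 _ IH2 a i ha /andP[h1 h2]; rewrite IH2// IH1.
- by move=> b c1 c2 {}s s1 _ _ IH a i ha /andP[h1 h2]; rewrite IH.
- by move=> b c1 c2 {}s s1 _ _ IH a i ha /andP[h1 h2]; rewrite IH.
- by move=> b {}c {}s s1 s2 _ _ IH1 _ IH2 a i ha h; rewrite IH2// IH1.
Qed.

Lemma ckeepsP c s s' : ex c s s' -> forall a i, (a < 32)%N -> ckeeps a c ->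
  ca s' a i = ca s a i.
Proof.
elim=> //=.
- by move=> e e' {}s a i ha he; rewrite /ca /= /upd avoidsP.
- by move=> e e' {}s t _ a i ha he; rewrite /ca /= /upd avoidsP.
- by move=> e z r {}s a i ha he; rewrite /ca /= /upd avoidsP.
- by move=> c1 c2 {}s s1 s2 _ IH1 _ IH2 a i ha /andP[h1 h2]; rewrite IH2// IH1.
- by move=> b c1 c2 {}s s1 _ _ IH a i ha /andP[h1 h2]; rewrite IH.
- by move=> b c1 c2 {}s s1 _ _ IH a i ha /andP[h1 h2]; rewrite IH.
- by move=> b {}c {}s s1 s2 _ _ IH1 _ IH2 a i ha h; rewrite IH2// IH1.
Qed.

Lemma quietP c s s' : ex c s s' -> quiet c -> pos s' = pos s /\ reads s' = reads s.
Proof.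
elim=> //=.
- by move=> c1 c2 {}s s1 s2 _ IH1 _ IH2 /andP[/IH1[<- <-] /IH2].
- by move=> b c1 c2 {}s s1 _ _ IH /andP[/IH[-> ->]].
- by move=> b c1 c2 {}s s1 _ _ IH /andP[_ /IH[-> ->]].
- by move=> b {}c {}s s1 s2 _ _ IH1 _ IH2 h; have [-> ->] := IH2 h; have [-> ->] := IH1 h.
Qed.

Definition run c s Q : Prop := exists2 s', ex c s s' & Q s'.

Lemma run_seq c1 c2 s Q1 Q : run c1 s Q1 ->
  (forall s1, ex c1 s s1 -> Q1 s1 -> run c2 s1 Q) -> run (Seq c1 c2) s Q.
Proof.
move=> [s1 e1 q1] h; have [s2 e2 q2] := h s1 e1 q1.
by exists s2 => //; apply: exec_seq e1 e2.
Qed.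

Lemma run_post c s Q1 Q : run c s Q1 ->
  (forall s1, ex c s s1 -> Q1 s1 -> Q s1) -> run c s Q.
Proof. by move=> [s1 e1 q1] h; exists s1 => //; apply: h. Qed.

Lemma run_skip s : run Skip s (fun s' => [/\ ia s' = ia s, ca s' = ca s &
  steps s' = (steps s).+1]).
Proof. by exists (tick s) => //; apply: exec_skip. Qed.

Lemma run_iset a e1 e s : (a < 32)%N -> (ieval s e < W)%N ->
  run (ISet (AA a e1) e) s (fun s' =>
    [/\ forall b j, (b < 32)%N ->
          ia s' b j = if (b == a) && (j == ieval s e1) then ieval s e else ia s b j,
        ca s' = ca s & steps s' = (steps s).+1]).
Proof.
move=> ha eW; eexists; first exact: exec_iset.
split=> // b j hb; rewrite /ia /= /upd -[X in _ == X]/(arr a (ieval s e1)) arr_eq//.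
Qed.

Lemma run_cset a e1 e s : (a < 32)%N ->
  run (CSet (AA a e1) e) s (fun s' =>
    [/\ forall b j, (b < 32)%N ->
          ca s' b j = if (b == a) && (j == ieval s e1) then ceval s e else ca s b j,
        ia s' = ia s & steps s' = (steps s).+1]).
Proof.
move=> ha; eexists; first exact: exec_cset.
split=> // b j hb; rewrite /ca /= /upd -[X in _ == X]/(arr a (ieval s e1)) arr_eq//.
Qed.

Lemma run_seq_iset a e1 e c2 s Q : (a < 32)%N -> (ieval s e < W)%N ->
  (forall s1, (forall b j, (b < 32)%N ->
       ia s1 b j = if (b == a) && (j == ieval s e1) then ieval s e else ia s b j) ->
     ca s1 = ca s -> steps s1 = (steps s).+1 -> run c2 s1 Q) ->
  run (Seq (ISet (AA a e1) e) c2) s Q.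
Proof.
by move=> ha he h; apply: run_seq (run_iset e1 ha he) _ => s1 _ [h1 h2 h3]; apply: h.
Qed.

Lemma run_seq_cset a e1 e c2 s Q : (a < 32)%N ->
  (forall s1, (forall b j, (b < 32)%N ->
       ca s1 b j = if (b == a) && (j == ieval s e1) then ceval s e else ca s b j) ->
     ia s1 = ia s -> steps s1 = (steps s).+1 -> run c2 s1 Q) ->
  run (Seq (CSet (AA a e1) e) c2) s Q.
Proof.
by move=> ha h; apply: run_seq (@run_cset a e1 e s ha) _ => s1 _ [h1 h2 h3]; apply: h.
Qed.

Lemma run_last_iset a e1 e s Q : (a < 32)%N -> (ieval s e < W)%N ->
  (forall s1, (forall b j, (b < 32)%N ->
       ia s1 b j = if (b == a) && (j == ieval s e1) then ieval s e else ia s b j) ->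
     ca s1 = ca s -> steps s1 = (steps s).+1 -> Q s1) ->
  run (ISet (AA a e1) e) s Q.
Proof.
by move=> ha he h; apply: run_post (run_iset e1 ha he) _ => s1 _ [h1 h2 h3]; apply: h.
Qed.

Lemma run_last_cset a e1 e s Q : (a < 32)%N ->
  (forall s1, (forall b j, (b < 32)%N ->
       ca s1 b j = if (b == a) && (j == ieval s e1) then ceval s e else ca s b j) ->
     ia s1 = ia s -> steps s1 = (steps s).+1 -> Q s1) ->
  run (CSet (AA a e1) e) s Q.
Proof.
by move=> ha h; apply: run_post (@run_cset a e1 e s ha) _ => s1 _ [h1 h2 h3]; apply: h.
Qed.

Lemma run_if (b : bexp) c1 c2 s Q :
  (beval s b -> forall s1, ia s1 = ia s -> ca s1 = ca s -> steps s1 = (steps s).+1 ->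
     run c1 s1 Q) ->
  (~~ beval s b -> forall s1, ia s1 = ia s -> ca s1 = ca s -> steps s1 = (steps s).+1 ->
     run c2 s1 Q) ->
  run (If b c1 c2) s Q.
Proof.
move=> h1 h2; have [hb|hb] := boolP (beval s b).
  have [s' e' q'] := h1 hb (tick s) erefl erefl erefl.
  by exists s' => //; apply: exec_if_true.
have [s' e' q'] := h2 hb (tick s) erefl erefl erefl.
by exists s' => //; apply: exec_if_false.
Qed.

(** Guarded by the syntactic test, so that loop invariants need not list the arrays that a body
    leaves alone. *)
Definition ikept c s s' : Prop :=
  forall a i, (a < 32)%N -> ikeeps a c -> ia s' a i = ia s a i.
Definition ckept c s s' : Prop :=
  forall a i, (a < 32)%N -> ckeeps a c -> ca s' a i = ca s a i.

Lemma run_for v b body s (N T : nat)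
    (Inv : nat -> (nat -> nat -> nat) -> (nat -> nat -> R[i]) -> Prop) :
  (v < 32)%N -> (b < 32)%N -> v != b -> ikeeps b body -> ikeeps v body ->
  N = ia s b 0 -> (N < W)%N ->
  (forall s1, (forall a i, (a < 32)%N -> a != v -> ia s1 a i = ia s a i) ->
     ca s1 = ca s -> Inv 0%N (ia s1) (ca s1)) ->
  (forall i s1, (i < N)%N -> ikept (For v b body) s s1 -> ckept body s s1 ->
     ia s1 v 0 = i -> Inv i (ia s1) (ca s1) ->
     run body s1 (fun s2 => (steps s2 <= steps s1 + T)%N /\
       forall s3, ia s3 v 0 = i.+1 ->
       (forall a j, (a < 32)%N -> a != v -> ia s3 a j = ia s2 a j) -> ca s3 = ca s2 ->
         Inv i.+1 (ia s3) (ca s3))) ->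
  run (For v b body) s (fun s' => Inv N (ia s') (ca s') /\
    (steps s' <= steps s + (2 + N * (T + 2)))%N).
Proof.
move=> hv hb vb bb bv NE NW I0 Istep.
have av a : (a < 32)%N -> avoids a (AV v) -> a != v.
  by move=> ha; rewrite /AV /AA /= => /andP[_]; rewrite eq_sym.
have va a : (a < 32)%N -> a != v -> avoids a (AV v).
  by move=> ha; rewrite /AV /AA /= hv eq_sym.
apply: run_seq (run_iset _ _ _) _ => //=; first by rewrite (leq_ltn_trans _ NW).
move=> s1 e1 [ia1 ca1 st1].
have keep0 : ikept (For v b body) s s1.
  move=> a i ha; rewrite /= => /andP[/(av _ ha) av0 _].
  by rewrite ia1// (negbTE av0).
suff loop i s2 : (i <= N)%N -> ikept (For v b body) s s2 -> ckept body s s2 ->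
    ia s2 v 0 = (N - i)%N -> Inv (N - i)%N (ia s2) (ca s2) ->
    run (While (BNot (BILe (IV b) (IV v)))
         (Seq body (ISet (AV v) (IAdd (IV v) (IConst 1))))) s2
      (fun s' => Inv N (ia s') (ca s') /\ (steps s' <= steps s2 + (1 + i * (T + 2)))%N).
  have [|||s' e' [q1 q2]] := loop N s1 (leqnn _) keep0.
  - by move=> a i ha _; rewrite ca1.
  - by rewrite subnn ia1// !eqxx.
  - by rewrite subnn; apply: I0 => // a i ha hav; rewrite ia1// (negbTE hav).
  - by exists s' => //; split=> //; apply: (leq_trans q2); rewrite st1; lia.
have keepb : ikeeps b (For v b body).
  by have := va b hb; rewrite eq_sym vb => /(_ isT) /= ->; rewrite bb.
elim: i s2 => [|i IH] s2 iN k2 c2 v2 Inv2.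
  exists (tick s2).
    by apply: exec_while_false; rewrite !evE v2 negbK k2// subn0 NE.
  by rewrite subn0 in Inv2; split; [|rewrite /=; lia].
have b2 : ia s2 b 0 = N by rewrite k2.
have lt1 : (N - i.+1 < N)%N by lia.
have [s3 e3 [st3 q3]] := Istep _ (tick s2) lt1 k2 c2 v2 Inv2.
have v3 : ia s3 v 0 = (N - i.+1)%N by rewrite (ikeepsP e3).
have [|s4 e4 [ia4 ca4 st4]] := @run_iset v (IConst 0) (IAdd (IV v) (IConst 1)) s3 hv.
  by rewrite !evE v3; lia.
have v4 : ia s4 v 0 = (N - i)%N by rewrite ia4// !evE !eqxx /= v3; lia.
have k4 : ikept (For v b body) s s4.
  move=> a j ha hk; have hk' := hk; move: hk'; rewrite /= => /andP[/(av _ ha) hav /andP[h1 _]].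
  by rewrite ia4// (negbTE hav) /= (ikeepsP e3)// -k2.
have c4 : ckept body s s4.
  by move=> a j ha hk; rewrite ca4 (ckeepsP e3)// -c2.
have Inv4 : Inv (N - i)%N (ia s4) (ca s4).
  have -> : (N - i = (N - i.+1).+1)%N by lia.
  apply: q3 => //; first by rewrite v4; lia.
  by move=> a j ha hav; rewrite ia4// (negbTE hav).
have [s5 e5 [q5 st5]] := IH s4 (ltnW iN) k4 c4 v4 Inv4.
exists s5.
  apply: exec_while_true e5; last exact: exec_seq e3 e4.
  by rewrite !evE v2 b2 -ltnNge.
split=> //; apply: (leq_trans st5); rewrite st4.
by move: st3 => /=; lia.
Qed.

Lemma beval_tick s (b : bexp) : beval (tick s) b = beval s b.
Proof.
have ieT e : ieval (tick s) e = ieval s e.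
  by elim: e => //= [e ->|e1 -> e2 ->|e1 -> e2 ->|e1 -> e2 ->|e1 -> e2 ->|e1 -> e2 ->].
have ceT e : ceval (tick s) e = ceval s e.
  by elim: e => //= [e|e|e|e1 -> e2 ->|e1 -> e2 ->|e1 -> e2 ->|e1 -> e2 ->|e ->|e ->];
    rewrite ?ieT.
by elim: b => //= [e1 e2|e1 e2|b ->|b1 -> b2 ->]; rewrite ?ieT ?ceT.
Qed.

(** The index of the invariant is the variant: it must drop in every turn, hence it bounds the
    number of turns. *)
Lemma run_while (b : bexp) body s (i T : nat)
    (Inv : nat -> (nat -> nat -> nat) -> (nat -> nat -> R[i]) -> Prop) :
  (forall i s1, Inv i (ia s1) (ca s1) -> beval s1 b -> run body s1 (fun s2 =>
     (steps s2 <= steps s1 + T)%N /\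
     exists2 i', (i' < i)%N & Inv i' (ia s2) (ca s2))) ->
  Inv i (ia s) (ca s) ->
  run (While b body) s (fun s' => [/\ ~~ beval s' b,
    exists2 i', (i' <= i)%N & Inv i' (ia s') (ca s') &
    (steps s' <= steps s + (1 + i * (T + 1)))%N]).
Proof.
move=> step; elim/ltn_ind: i s => i IH s Invi.
have [hb|hb] := boolP (beval s b); last first.
  exists (tick s); first exact: exec_while_false.
  by split; [by rewrite beval_tick | exists i | rewrite /=; lia].
have [s2 e2 [st2 [i' ii' Inv2]]] :=
  step i (tick s) Invi (eq_ind_r is_true hb (beval_tick s b)).
have [s3 e3 [nb [j ji' Inv3] st3]] := IH i' ii' s2 Inv2.
exists s3; first exact: exec_while_true hb e2 e3.
split=> //; first by exists j => //; apply: leq_trans ji' (ltnW ii').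
apply: (leq_trans st3); move: st2 => /= st2.
have : (i'.+1 * (T + 1) <= i * (T + 1))%N by rewrite leq_mul2r ii' orbT.
by rewrite mulSn; lia.
Qed.

(** When entry i is computed, the target array is known to be unchanged except at the i entries
    already written. This allows pointwise updates in place. *)
Lemma run_fill v b a (eb : iexp) (e : cexp) s (N base : nat) (g : nat -> R[i]) :
  (v < 32)%N -> (b < 32)%N -> (a < 32)%N -> v != b ->
  N = ia s b 0 -> (N < W)%N ->
  (forall i s1, (i < N)%N ->
     (forall a' j, (a' < 32)%N -> a' != v -> ia s1 a' j = ia s a' j) ->
     (forall a' j, (a' < 32)%N -> a' != a -> ca s1 a' j = ca s a' j) ->
     ia s1 v 0 = i ->
     (forall j, (j < base)%N || (base + i <= j)%N -> ca s1 a j = ca s a j) ->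
     ieval s1 eb = base /\ ceval s1 e = g i) ->
  run (Fill v b a eb e) s (fun s' =>
    (forall j, ca s' a j = if (base <= j < base + N)%N then g (j - base)%N else ca s a j) /\
    (steps s' <= steps s + (2 + N * 3))%N).
Proof.
move=> hv hb ha vb NE NW he.
have kv a' : (a' < 32)%N -> a' != v -> ikeeps a' (Fill v b a eb e).
  by move=> ha' hav; rewrite /= hv /= eq_sym hav.
have ka a' : (a' < 32)%N -> a' != a -> ckeeps a' (CSet (AA a (IAdd eb (IV v))) e).
  by move=> ha' haa; rewrite /= ha eq_sym haa.
pose Inv i (I : nat -> nat -> nat) (C : nat -> nat -> R[i]) := forall j,
  C a j = if (base <= j < base + i)%N then g (j - base)%N else ca s a j.
apply: (run_post (Q1 := fun s' => Inv N (ia s') (ca s') /\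
    (steps s' <= steps s + (2 + N * (1 + 2)))%N)); last first.
  by move=> s' _ [h1 h2]; split.
apply: run_for => //.
  move=> s1 _ -> j; rewrite addn0; case: ifP => //; lia.
move=> i s1 iN k1 c1 v1 Inv1.
have [||||eb1 e1] := he i s1 iN.
- by move=> a' j ha' hav; rewrite k1// kv.
- by move=> a' j ha' haa; rewrite c1// ka.
- by [].
- by move=> j hj; rewrite Inv1; case: ifP => //; lia.
apply: run_post (@run_cset _ _ _ _ ha) _ => s2 _ [ca2 ia2 st2]; split; first by rewrite st2; lia.
move=> s3 _ _ -> j; rewrite ca2// !evE eb1 v1 eqxx /= e1 Inv1.
case: eqP => [->|jne]; first by rewrite addKn; case: ifP => //; lia.
by case: ifP => h1; case: ifP => h2 //; lia.
Qed.

Lemma run_seq_fill v b a (eb : iexp) (e : cexp) c2 s (N base : nat) (g : nat -> R[i]) Q :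
  (v < 32)%N -> (b < 32)%N -> (a < 32)%N -> v != b ->
  N = ia s b 0 -> (N < W)%N ->
  (forall i s1, (i < N)%N ->
     (forall a' j, (a' < 32)%N -> a' != v -> ia s1 a' j = ia s a' j) ->
     (forall a' j, (a' < 32)%N -> a' != a -> ca s1 a' j = ca s a' j) ->
     ia s1 v 0 = i ->
     (forall j, (j < base)%N || (base + i <= j)%N -> ca s1 a j = ca s a j) ->
     ieval s1 eb = base /\ ceval s1 e = g i) ->
  (forall s1, (forall a' j, (a' < 32)%N -> a' != v -> ia s1 a' j = ia s a' j) ->
     (forall a' j, (a' < 32)%N -> a' != a -> ca s1 a' j = ca s a' j) ->
     (forall j, ca s1 a j =
        if (base <= j < base + N)%N then g (j - base)%N else ca s a j) ->
     (steps s1 <= steps s + (2 + N * 3))%N -> run c2 s1 Q) ->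
  run (Seq (Fill v b a eb e) c2) s Q.
Proof.
move=> hv hb ha vb NE NW he h.
apply: run_seq (run_fill hv hb ha vb NE NW he) _ => s1 e1 [h1 h2]; apply: h => //.
  by move=> a' j ha' hav; rewrite (ikeepsP e1)//= hv /= eq_sym hav.
by move=> a' j ha' haa; rewrite (ckeepsP e1)//= ha eq_sym haa.
Qed.

Lemma run_last_fill v b a (eb : iexp) (e : cexp) s (N base : nat) (g : nat -> R[i]) Q :
  (v < 32)%N -> (b < 32)%N -> (a < 32)%N -> v != b ->
  N = ia s b 0 -> (N < W)%N ->
  (forall i s1, (i < N)%N ->
     (forall a' j, (a' < 32)%N -> a' != v -> ia s1 a' j = ia s a' j) ->
     (forall a' j, (a' < 32)%N -> a' != a -> ca s1 a' j = ca s a' j) ->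
     ia s1 v 0 = i ->
     (forall j, (j < base)%N || (base + i <= j)%N -> ca s1 a j = ca s a j) ->
     ieval s1 eb = base /\ ceval s1 e = g i) ->
  (forall s1, (forall a' j, (a' < 32)%N -> a' != v -> ia s1 a' j = ia s a' j) ->
     (forall a' j, (a' < 32)%N -> a' != a -> ca s1 a' j = ca s a' j) ->
     (forall j, ca s1 a j =
        if (base <= j < base + N)%N then g (j - base)%N else ca s a j) ->
     (steps s1 <= steps s + (2 + N * 3))%N -> Q s1) ->
  run (Fill v b a eb e) s Q.
Proof.
move=> hv hb ha vb NE NW he h.
apply: run_post (run_fill hv hb ha vb NE NW he) _ => s1 e1 [h1 h2]; apply: h => //.
  by move=> a' j ha' hav; rewrite (ikeepsP e1)//= hv /= eq_sym hav.
by move=> a' j ha' haa; rewrite (ckeepsP e1)//= ha eq_sym haa.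
Qed.

End ProgramLogic.

Arguments run_last_fill {R p d W x tau v b a eb e s N base g Q}.

(** * Identities behind the radix-2 transform and Bluestein's algorithm *)

Section FastFourierIdentities.
Variable F : fieldType.
Implicit Types (z : F) (a g : nat -> F).

Lemma sum_even_odd (V : nmodType) (f : nat -> V) h :
  \sum_(i < 2 * h) f i = \sum_(i < h) f (2 * i)%N + \sum_(i < h) f (2 * i).+1.
Proof.
elim: h => [|h IH]; first by rewrite muln0 !big_ord0 addr0.
rewrite (_ : 2 * h.+1 = (2 * h).+2)%N; last by lia.
by rewrite !big_ord_recr /= IH addrACA addrA.
Qed.

(* g stores, block by block, the length-h transforms of the S subsequences of a
   of stride S. *)
Definition strided_dft (S h : nat) z a g : Prop := forall u v, (u < S)%N -> (v < h)%N ->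
  g (u * h + v)%N = \sum_(i < h) a (u + S * i)%N * z ^+ (S * i * v)%N.

(** Cooley-Tukey: the subsequence of stride S at u splits into those of stride 2 S at u and u + S.
    The half-length transforms have period h in v, and the power of z taken at the full index
    already contains the sign of the second half. *)
Lemma strided_dft_double (S h : nat) z a g g' : (0 < h)%N -> z ^+ (S * (2 * h)) = 1 ->
  strided_dft (2 * S) h z a g ->
  (forall i, (i < S * (2 * h))%N -> g' i =
     g (i %/ (2 * h) * h + i %% (2 * h) %% h)%N + z ^+ (i %% (2 * h) * S)%N *
     g (i %/ (2 * h) * h + i %% (2 * h) %% h + S * h)%N) ->
  strided_dft S (2 * h) z a g'.
Proof.
move=> h0 zN ga g'E u v uS v2h.
have h20 : (0 < 2 * h)%N by rewrite muln_gt0.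
have vh : (v %% h < h)%N by rewrite ltn_mod.
have zmod i : z ^+ (2 * S * i * (v %% h))%N = z ^+ (2 * S * i * v)%N.
  rewrite {2}(divn_eq v h) mulnDr exprD.
  rewrite (_ : 2 * S * i * (v %/ h * h) = S * (2 * h) * (i * (v %/ h)))%N; last by ring.
  by rewrite (exprM z (S * (2 * h))) zN expr1n mul1r.
rewrite g'E; last first.
  have : (u * (2 * h) + v < u.+1 * (2 * h))%N by rewrite mulSn addnC ltn_add2r.
  by move=> /leq_trans; apply; rewrite leq_mul2r uS orbT.
rewrite divnMDl// (divn_small v2h) addn0 modnMDl (modn_small v2h).
rewrite ga ?(leq_trans uS) ?leq_pmull//.
rewrite (_ : u * h + v %% h + S * h = (u + S) * h + v %% h)%N; last by ring.
rewrite ga//; last by rewrite mul2n -addnn ltn_add2r.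
rewrite (sum_even_odd (fun i => a (u + S * i)%N * z ^+ (S * i * v)%N)); congr (_ + _).
  apply: eq_bigr => i _; rewrite zmod; congr (a _ * z ^+ _); ring.
rewrite mulr_sumr; apply: eq_bigr => i _; rewrite zmod mulrCA -exprD.
by congr (a _ * z ^+ _); ring.
Qed.

Lemma strided_dft1 S z a : strided_dft S 1 z a a.
Proof.
by move=> u [|//] uS _; rewrite big_ord1 /= !muln0 muln1 !addn0 expr0 mulr1.
Qed.

(* Bluestein's chirp, from t f = T (t + f) - T t - T f: triangular numbers instead
   of squares avoid the square roots of the p-th roots of unity. *)
Definition triangular (j : nat) : nat := (j * (j - 1)) %/ 2.

Lemma triangularS j : triangular j.+1 = (triangular j + j)%N.
Proof.
rewrite /triangular subn1 /= [RHS]addnC -divnMDl//; congr (_ %/ _)%N.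
by case: j => // j; rewrite subn1 /=; ring.
Qed.

Lemma triangularD i j : triangular (i + j) = (triangular i + triangular j + i * j)%N.
Proof.
elim: i => [|i IH]; first by rewrite mul0n addn0.
by rewrite addSn !triangularS IH mulSn; ring.
Qed.

Variables (N : nat) (z : F).
Hypotheses (z_prim : N.-primitive_root z) (N_neq0 : N%:R != 0 :> F).
Definition dft a v : F := \sum_(t < N) a t * z ^+ (t * v).

Lemma sum_root c : \sum_(v < N) z ^+ (c * v) = if (N %| c)%N then N%:R else 0.
Proof.
under eq_bigr do rewrite exprM.
rewrite (prim_order_dvd z_prim); case: eqP => [->|/eqP zc].
  by under eq_bigr do rewrite expr1n; rewrite sumr_const card_ord.
apply/eqP; have := subrX1 (z ^+ c) N.
rewrite -exprM mulnC exprM (prim_expr_order z_prim) expr1n subrr => /esym/eqP.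
by rewrite mulf_eq0 subr_eq0 (negbTE zc).
Qed.

(** A second forward transform stands for the inverse one, so the product becomes a cyclic
    convolution evaluated at -f: the condition reads t + s + f = 0 modulo N. *)
Lemma dft_convolution a g f :
  dft (fun v => dft a v * dft g v) f =
  N%:R * \sum_(t < N) a t * \sum_(s < N | (N %| t + s + f)%N) g s.
Proof.
rewrite /dft; under eq_bigr => v _ do rewrite mulr_suml mulr_suml.
rewrite exchange_big mulr_sumr; apply: eq_bigr => t _ /=.
under eq_bigr => v _ do rewrite mulr_sumr mulr_suml.
rewrite exchange_big /= mulrCA mulr_sumr mulr_sumr [RHS]big_mkcond.
apply: eq_bigr => s _ /=.
transitivity (a t * g s * \sum_(v < N) z ^+ ((t + s + f) * v)).
  rewrite mulr_sumr; apply: eq_bigr => v _; rewrite !mulnDl !exprD [(f * v)%N]mulnC.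
  by ring.
by rewrite sum_root; case: ifP => _; ring.
Qed.

Variables (p : nat) (w : F).
Hypotheses (w_neq0 : w != 0) (pN : (2 * p <= N)%N).

(** The factor of w with exponent [triangular] (t + f) depends on t + f only, so the sum is a
    correlation with a chirp. Storing the chirp at reflected indices compensates the sign of f in
    [dft_convolution], and t + f < 2 p <= N excludes wrap-around. *)
Lemma bluestein a f : (f < p)%N ->
  dft (fun v => dft (fun t => if (t < p)%N then a t / w ^+ triangular t else 0) v *
                dft (fun s => w ^+ triangular ((N - s) %% N)) v) f
    / N%:R / w ^+ triangular f =
  \sum_(t < p) a t * w ^+ (f * t).
Proof.
move=> fp; rewrite dft_convolution [N%:R * _]mulrC mulfK//.
have pN1 : (p <= N)%N by lia.
rewrite (big_ord_widen N (fun t : nat => a t * w ^+ (f * t)) pN1) mulr_suml.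
rewrite [RHS]big_mkcond; apply: eq_bigr => t _ /=.
case: ifP => tp; last by rewrite !mul0r.
have tfN : (t + f < N)%N by lia.
have N0 : (0 < N)%N by lia.
have s0N : ((N - (t + f)) %% N < N)%N by rewrite ltn_mod.
have s0E : ((N - (N - (t + f)) %% N) %% N = t + f)%N.
  have [->|tf0] := posnP (t + f)%N; first by rewrite subn0 modnn subn0 modnn.
  by rewrite [((N - _) %% N)%N]modn_small ?subKn ?modn_small//; lia.
(* Exactly one s < N satisfies the divisibility. The residue modulo N matters when t + f = 0, where
   s is 0 and not N. *)
rewrite (bigD1 (Ordinal s0N)) /=; last first.
  apply/eqP; rewrite -addnAC modnDmr subnKC ?modnn//; lia.
rewrite big1 ?addr0 => [|s /andP[sd sne]]; last first.
  case/eqP: sne; apply/val_inj => /=.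
  have [tf0|tf0] := posnP (t + f)%N.
    move: sd; rewrite -addnAC tf0 add0n subn0 modnn => sd.
    by have := ltn_ord s; case: (nat_of_ord s) sd => // s' sd; rewrite ltnNge (dvdn_leq _ sd).
  rewrite modn_small; last by lia.
  move/dvdnP: sd => [c sd]; have := ltn_ord s.
  have : c = 1%N by move: sd (ltn_ord s) tfN tf0; case: c => [|[|c]] //; nia.
  by move=> c1; move: sd; rewrite c1; lia.
rewrite s0E triangularD !exprD [(t * f)%N]mulnC.
have wT j : w ^+ triangular j != 0 by rewrite expf_neq0.
by field; rewrite !wT.
Qed.

End FastFourierIdentities.

(** * Base-p digits, the coding of the grid, and transforms axis by axis *)

Section Digits.
Variable p : nat.
Hypothesis p_gt0 : (0 < p)%N.

Lemma numeral_lt (dig : nat -> nat) j : (forall i, dig i < p)%N ->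
  (\sum_(i < j) dig i * p ^ i < p ^ j)%N.
Proof.
move=> dp; elim: j => [|j IH]; first by rewrite big_ord0.
rewrite big_ord_recr /= expnS -(ltn_add2r (dig j * p ^ j)) in IH *.
apply: (leq_trans IH); rewrite -mulSn leq_mul2r dp orbT//.
Qed.

Lemma digit_low a c i j : (i < j)%N ->
  ((a + p ^ j * c) %/ p ^ i %% p = a %/ p ^ i %% p)%N.
Proof.
move=> ij; rewrite (_ : p ^ j * c = p ^ (j - i.+1) * c * p * p ^ i)%N; last first.
  by rewrite -{1}(subnK ij) expnD expnS; ring.
by rewrite addnC divnMDl ?expn_gt0 ?p_gt0// modnMDl.
Qed.

Lemma digit_high a c j : (a < p ^ j)%N -> (c < p)%N -> ((a + p ^ j * c) %/ p ^ j %% p = c)%N.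
Proof.
move=> aj cp; rewrite addnC mulnC divnMDl ?expn_gt0 ?p_gt0//.
by rewrite divn_small// addn0 modn_small.
Qed.

Lemma numeral_digit (dig : nat -> nat) j i : (forall i, dig i < p)%N -> (i < j)%N ->
  ((\sum_(i < j) dig i * p ^ i) %/ p ^ i %% p = dig i)%N.
Proof.
move=> dp; elim: j => // j IH; rewrite ltnS leq_eqVlt big_ord_recr /=.
move=> /orP[/eqP ->|ij]; rewrite [(dig j * _)%N]mulnC.
  by rewrite digit_high// numeral_lt.
by rewrite digit_low// IH.
Qed.

Lemma modn_expS c j : (c %% p ^ j.+1 = c %% p ^ j + c %/ p ^ j %% p * p ^ j)%N.
Proof.
have pj : (0 < p ^ j)%N by rewrite expn_gt0 p_gt0.
rewrite {1}(divn_eq c (p ^ j)) {1}(divn_eq (c %/ p ^ j) p).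
rewrite mulnDl -addnA -mulnA -expnS modnMDl modn_small; first by rewrite addnC.
apply: (@leq_trans ((c %/ p ^ j %% p).+1 * p ^ j)).
  by rewrite mulSn addnC ltn_add2r ltn_pmod.
by rewrite expnS leq_mul2r ltn_pmod// orbT.
Qed.

Lemma sum_digits c j : (\sum_(i < j) (c %/ p ^ i %% p) * p ^ i = c %% p ^ j)%N.
Proof.
elim: j => [|j IH]; first by rewrite big_ord0 modn1.
by rewrite big_ord_recr /= IH modn_expS.
Qed.

Lemma sum_block (V : nmodType) (m q : nat) (f : nat -> V) :
  \sum_(c < m * q) f c = \sum_(b < q) \sum_(a < m) f (a + m * b)%N.
Proof.
elim: q => [|q IH]; first by rewrite muln0 !big_ord0.
rewrite big_ord_recr /= -IH mulnS addnC big_split_ord /=; congr (_ + _).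
by apply: eq_bigr => i _; rewrite addnC.
Qed.

End Digits.

Section CodedGrid.
Variables p d : nat.
Hypothesis p_gt0 : (0 < p)%N.
Local Notation G := (grid p d).
Implicit Types (t : G) (c : nat).

Definition coordinate t (i : nat) : nat := if insub i is Some i' then t i' : nat else 0.

Lemma coordinateE t (i : 'I_d) : coordinate t i = t i.
Proof. by rewrite /coordinate valK. Qed.

Lemma coordinate_lt t i : (coordinate t i < p)%N.
Proof. by rewrite /coordinate; case: insub. Qed.

Lemma codeE t : code t = (\sum_(i < d) coordinate t i * p ^ i)%N.
Proof. by apply: eq_bigr => i _; rewrite coordinateE. Qed.

Lemma code_lt t : (code t < p ^ d)%N.
Proof. by rewrite codeE numeral_lt//; exact: coordinate_lt. Qed.

Lemma digit_code t (i : 'I_d) : (code t %/ p ^ i %% p = t i)%N.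
Proof. by rewrite codeE numeral_digit ?coordinateE//; exact: coordinate_lt. Qed.

Definition decode c : G := [ffun i : 'I_d => Ordinal (ltn_pmod (c %/ p ^ i) p_gt0)].

Lemma decodeK c : (c < p ^ d)%N -> code (decode c) = c.
Proof.
move=> cn; rewrite /code; under eq_bigr do rewrite ffunE.
by rewrite sum_digits// modn_small.
Qed.

Lemma codeK t : decode (code t) = t.
Proof. by apply/ffunP => i; rewrite ffunE; apply/val_inj; rewrite /= digit_code. Qed.

Lemma code_inj : injective (@code p d).
Proof. exact: can_inj codeK. Qed.

Lemma sum_code (V : nmodType) (f : nat -> V) :
  \sum_(t : G) f (code t) = \sum_(c < p ^ d) f c.
Proof.
rewrite (reindex (fun c : 'I_(p ^ d) => decode c)) /=; last first.
  exists (fun t => Ordinal (code_lt t)) => [c _|t _]; last exact: codeK.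
  by apply/val_inj; rewrite /= decodeK.
by apply: eq_bigr => c _; rewrite decodeK.
Qed.

Variables (F : fieldType) (w : F).
Implicit Types (g : nat -> F).

Definition axis_pass m g c : F := \sum_(a < p) g (a + p * (c %% m))%N * w ^+ (c %/ m * a).

Definition digit_dot j a b : nat := \sum_(i < j) (a %/ p ^ i %% p) * (b %/ p ^ i %% p).

Lemma digit_dotS j a b c f : (a < p ^ j)%N -> (b < p ^ j)%N -> (c < p)%N -> (f < p)%N ->
  digit_dot j.+1 (a + p ^ j * c) (b + p ^ j * f) = (digit_dot j a b + c * f)%N.
Proof.
move=> aj bj cp fp; rewrite /digit_dot big_ord_recr /= !digit_high//; congr addn.
by apply: eq_bigr => i _; rewrite !digit_low.
Qed.

(** After j passes the top j digits, phi, are frequencies, while the low digits b are the not yet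
    transformed time digits moved down by j places. Hence the input is read at a + p^j b. *)
Lemma iter_axis_pass g j b phi : (j <= d)%N -> (b < p ^ (d - j))%N -> (phi < p ^ j)%N ->
  iter j (axis_pass (p ^ d.-1)) g (b + p ^ (d - j) * phi)%N =
  \sum_(a < p ^ j) g (a + p ^ j * b)%N * w ^+ digit_dot j a phi.
Proof.
elim: j b phi => [|j IH] b phi jd bb pp.
  case: phi pp => // _; rewrite muln0 addn0 big_ord1 /= add0n mul1n.
  by rewrite /digit_dot big_ord0 expr0 mulr1.
have pj0 : (0 < p ^ j)%N by rewrite expn_gt0 p_gt0.
pose f := (phi %/ p ^ j)%N; pose phi0 := (phi %% p ^ j)%N.
have phiE : (phi = phi0 + p ^ j * f)%N by rewrite [LHS](divn_eq phi (p ^ j)) addnC mulnC.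
have phi0j : (phi0 < p ^ j)%N by rewrite ltn_mod.
have fp : (f < p)%N by rewrite ltn_divLR// mulnC -expnSr.
have dE : (p ^ (d - j.+1) * p ^ j = p ^ d.-1)%N by rewrite -expnD; congr expn; lia.
have lowlt : (b + p ^ (d - j.+1) * phi0 < p ^ d.-1)%N.
  rewrite -dE; apply: (@leq_trans (p ^ (d - j.+1) * phi0.+1)).
    by rewrite mulnS ltn_add2r.
  by rewrite leq_mul2l phi0j orbT.
rewrite iterS /axis_pass.
have -> : (b + p ^ (d - j.+1) * phi = f * p ^ d.-1 + (b + p ^ (d - j.+1) * phi0))%N.
  by rewrite phiE mulnDr mulnA dE; ring.
rewrite modnMDl divnMDl; last by rewrite expn_gt0 p_gt0.
rewrite (modn_small lowlt) (divn_small lowlt) addn0 expnSr.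
rewrite (sum_block _ _ (fun c => g (c + p ^ j * p * b)%N * w ^+ digit_dot j.+1 c phi)).
apply: eq_bigr => a' _.
have -> : (a' + p * (b + p ^ (d - j.+1) * phi0) = a' + p * b + p ^ (d - j) * phi0)%N.
  by rewrite (_ : (d - j = (d - j.+1).+1)%N) ?expnS; [ring|lia].
rewrite IH ?(ltnW jd)//; last first.
  rewrite (_ : (d - j = (d - j.+1).+1)%N); last by lia.
  rewrite expnS; apply: (@leq_trans (p * b.+1)); last by rewrite leq_mul2l bb orbT.
  by rewrite mulnS ltn_add2r.
rewrite mulr_suml; apply: eq_bigr => a _; rewrite -mulrA -exprD.
rewrite phiE digit_dotS// mulnC; congr (g _ * w ^+ (_ + _)).
- by ring.
- exact: mulnC.
Qed.

Lemma axis_passes_dft g (f : G) :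
  iter d (axis_pass (p ^ d.-1)) g (code f) =
  \sum_(t : G) g (code t) * w ^+ (\sum_(i < d) f i * t i).
Proof.
have := @iter_axis_pass g d 0 (code f) (leqnn _).
rewrite subnn expn0 mul1n add0n => -> //; last exact: code_lt.
under [LHS]eq_bigr do rewrite muln0 addn0.
rewrite -(sum_code (fun c => g c * w ^+ digit_dot d c (code f))).
apply: eq_bigr => t _; congr (_ * w ^+ _); apply: eq_bigr => i _.
by rewrite !digit_code mulnC.
Qed.

End CodedGrid.

(* Arrays 0, ..., 3 of naturals and 0, 1 of complex numbers are scalars placed
   where init_state puts its arguments. *)
Notation iP := 0 (only parsing).
Notation iDim := 1 (only parsing).
Notation iN := 2 (only parsing).
Notation iK := 3 (only parsing).
Notation iLogN := 4 (only parsing).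
Notation iQ := 5 (only parsing).
Notation iQQ := 6 (only parsing).
Notation iKappa := 7 (only parsing).
Notation iM := 8 (only parsing).
Notation iL := 9 (only parsing).
Notation iB := 10 (only parsing).
Notation iNF := 11 (only parsing).
Notation iLogF := 12 (only parsing).
Notation iT := 13 (only parsing).
Notation iH := 14 (only parsing).
Notation iLen := 15 (only parsing).
Notation iI := 16 (only parsing).
Notation iEll := 17 (only parsing).
Notation iRows := 18 (only parsing).
Notation iRow := 19 (only parsing).
Notation iAxis := 20 (only parsing).

Notation cMu := 0 (only parsing).
Notation cRs := 1 (only parsing).
Notation cM := 2 (only parsing).
Notation cy := 3 (only parsing).
Notation cy0 := 4 (only parsing).
Notation cX := 5 (only parsing).
Notation cY := 6 (only parsing).
Notation cPow := 7 (only parsing).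
Notation cZeta := 8 (only parsing).
Notation cChirp := 9 (only parsing).
Notation cD := 10 (only parsing).
Notation cE := 11 (only parsing).

Definition butterfly_index : iexp :=
  IAdd (IMul (IDiv (IV iI) (IV iLen)) (IV iH)) (IMod (IMod (IV iI) (IV iLen)) (IV iH)).

(** Stockham's arrangement: each round writes to the second array [cY] and copies back, so the
    result comes in natural order without bit reversal. *)
Definition fft : cmd :=
  Seq (ISet (AV iH) (IConst 1))
    (For iEll iLogF
      (Seq (ISet (AV iLen) (IMul (IConst 2) (IV iH)))
      (Seq (Fill iI iNF cY (IConst 0)
             (CAdd (CA cX butterfly_index)
                   (CMul (CA cZeta (IMul (IMod (IV iI) (IV iLen)) (IDiv (IV iNF) (IV iLen))))
                         (CA cX (IAdd butterfly_index (IDiv (IV iNF) (IConst 2)))))))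
      (Seq (Fill iI iNF cX (IConst 0) (CA cY (IV iI)))
           (ISet (AV iH) (IV iLen)))))).

Definition fft_cost (N lg : nat) : nat := 3 + lg * (8 + 6 * N).

(** * Programs for the fast transform of the whole grid *)

Section FourierPrograms.
Variables (R : realType) (p d W : nat) (x : signal R p d) (tau : nat -> draw R p d).
Local Notation run := (run W x tau).
Implicit Types (s : state R).

Lemma run_fft s (N lg : nat) (z : R[i]) : N = (2 ^ lg)%N -> (N < W)%N ->
  ia s iNF 0 = N -> ia s iLogF 0 = lg -> z ^+ N = 1 ->
  (forall j, (j < N)%N -> ca s cZeta j = z ^+ j) ->
  run fft s (fun s' =>
    (forall v, (v < N)%N -> ca s' cX v = dft N z (ca s cX) v) /\
    (steps s' <= steps s + fft_cost N lg)%N).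
Proof.
move=> NE NW sN slg zN szeta.
have lgW : (lg < W)%N by apply: ltn_trans NW; rewrite NE ltn_expl.
have N0 : (0 < N)%N by rewrite NE expn_gt0.
apply: run_seq_iset => //; first by rewrite !evE (leq_ltn_trans _ NW).
move=> s1 ia1 ca1 st1.
pose Inv i (I : nat -> nat -> nat) (C : nat -> nat -> R[i]) :=
  I iH 0%N = (2 ^ i)%N /\ strided_dft (2 ^ (lg - i)) (2 ^ i) z (ca s cX) (C cX).
apply: (run_post (Q1 := fun s' => Inv lg (ia s') (ca s') /\
    (steps s' <= steps s1 + (2 + lg * (6 + 6 * N + 2)))%N)); last first.
  move=> s2 _ [[_ h2] st2]; split; last by rewrite st1 in st2; rewrite /fft_cost; lia.
  move=> v vN; have := h2 0%N v; rewrite subnn expn0 -NE => /(_ isT vN).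
  rewrite mul0n add0n => ->; rewrite /dft; apply: eq_bigr => t _.
  by rewrite add0n !mul1n.
apply: run_for => //; first by rewrite ia1.
  move=> s2 ia2 ca2; split; first by rewrite ia2// ia1.
  by rewrite ca2 ca1 subn0; apply: strided_dft1.
move=> i s2 ilg ik2 ck2 s2i [s2h s2X].
have h0 : (0 < 2 ^ i)%N by rewrite expn_gt0.
have SE : (2 ^ (lg - i) = 2 * 2 ^ (lg - i.+1))%N by rewrite -expnS; congr expn; lia.
have NSE : (N = 2 ^ (lg - i.+1) * (2 * 2 ^ i))%N.
  by rewrite NE -expnS -expnD; congr expn; lia.
have LN : (2 * 2 ^ i <= N)%N by rewrite [leqRHS]NSE leq_pmull// expn_gt0.
apply: run_seq_iset => //; first by rewrite !evE s2h (leq_ltn_trans LN).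
move=> s3; rewrite !evE s2h => ia3 ca3 st3.
have s3N : ia s3 iNF 0 = N by rewrite ia3// ik2// ia1.
have NL : (N %/ (2 * 2 ^ i) = 2 ^ (lg - i.+1))%N.
  by rewrite [in LHS]NSE mulnK// muln_gt0 h0.
have N2 : (N %/ 2 = 2 ^ (lg - i.+1) * 2 ^ i)%N by rewrite NSE mulnCA mulKn.
pose g' j : R[i] := ca s2 cX (j %/ (2 * 2 ^ i) * 2 ^ i + j %% (2 * 2 ^ i) %% 2 ^ i)%N +
  z ^+ (j %% (2 * 2 ^ i) * 2 ^ (lg - i.+1))%N *
  ca s2 cX (j %/ (2 * 2 ^ i) * 2 ^ i + j %% (2 * 2 ^ i) %% 2 ^ i + 2 ^ (lg - i.+1) * 2 ^ i)%N.
apply: (run_seq_fill (N := N) (base := 0) (g := g')) => //.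
  move=> j s4 jN ia4 ca4 s4j _; split=> //.
  have vN : ia s4 iNF 0 = N by rewrite ia4.
  have vLen : ia s4 iLen 0 = (2 * 2 ^ i)%N by rewrite ia4// ia3.
  have vH : ia s4 iH 0 = (2 ^ i)%N by rewrite ia4// ia3//= s2h.
  rewrite /butterfly_index !evE s4j vN vLen vH NL N2.
  rewrite [ca s4 cZeta _]ca4// ![ca s4 cX _]ca4// ca3 [ca s2 cZeta _]ck2// ca1 szeta//.
  rewrite [X in (_ < X)%N]NSE mulnC ltn_pmul2l ?expn_gt0// ltn_mod.
  by rewrite muln_gt0 h0.
move=> s4 ia4 ca4 Y4 st4.
apply: (run_seq_fill (N := N) (base := 0) (g := g')) => //; first by rewrite ia4.
  by move=> j s5 jN ia5 ca5 s5j _; split=> //; rewrite !evE s5j ca5// Y4 jN subn0.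
move=> s5 ia5 ca5 X5 st5.
have s5Len : ia s5 iLen 0 = (2 * 2 ^ i)%N by rewrite ia5// ia4// ia3.
apply: run_last_iset => //; first by rewrite !evE s5Len (leq_ltn_trans LN).
move=> s6 ia6 ca6 st6; split; first by rewrite st6; move: st3 st4 st5; lia.
move=> s7 _ ia7 ca7; split; first by rewrite ia7// ia6// !evE s5Len expnS.
rewrite ca7 ca6.
have := strided_dft_double h0 (g := ca s2 cX) (g' := ca s5 cX); rewrite expnS; apply.
- by rewrite -NSE.
- by rewrite -SE.
by move=> j; rewrite -NSE => jN; rewrite X5 jN subn0.
Qed.
End FourierPrograms.

Definition triangle_exp (e : iexp) : iexp := IDiv (IMul e (ISub e (IConst 1))) (IConst 2).

(** Reducing the exponent modulo p lets a table of p powers serve all triangular numbers. *)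
Definition chirp_exp (e : iexp) : cexp := CA cPow (IMod (triangle_exp e) (IV iP)).

(* The factor COfNat (1 - i / p) is the indicator of i < p. *)
Definition line_dft : cmd :=
  Seq (Fill iI iNF cX (IConst 0)
         (CMul (COfNat (ISub (IConst 1) (IDiv (IV iI) (IV iP))))
               (CMul (CA cD (IAdd (IV iI) (IMul (IV iP) (IV iRow))))
                     (CConj (chirp_exp (IV iI))))))
  (Seq fft
  (Seq (Fill iI iNF cX (IConst 0) (CMul (CA cX (IV iI)) (CA cChirp (IV iI))))
  (Seq fft
  (Fill iI iP cE (IMul (IV iRow) (IV iP))
     (CMul (CDiv (CA cX (IV iI)) (COfNat (IV iNF))) (CConj (chirp_exp (IV iI)))))))).

Definition axis_dft : cmd :=
  Seq (For iRow iRows line_dft)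
      (Fill iI iN cD (IConst 0)
         (CA cE (IAdd (IMul (IMod (IV iI) (IV iRows)) (IV iP)) (IDiv (IV iI) (IV iRows))))).

(* Each pass transforms the lowest digit and moves it to the top, so that d passes
   transform all axes and restore the order of the digits. *)
Definition grid_dft : cmd := For iAxis iDim axis_dft.

Definition line_cost (N lg : nat) : nat := 6 + 9 * N + 2 * fft_cost N lg.
Definition axis_cost (p m N lg : nat) : nat := 4 + m * (line_cost N lg + 2) + 3 * (p * m).
Definition dft_cost (p d N lg : nat) : nat := 2 + d * (axis_cost p (p ^ d.-1) N lg + 2).

Section GridFourierProgram.
Variables (R : realType) (p d W : nat) (x : signal R p d) (tau : nat -> draw R p d).
Variables (N lg : nat).
Hypotheses (p_gt0 : (0 < p)%N) (NE : N = (2 ^ lg)%N) (pN : (2 * p <= N)%N).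
Hypotheses (NW : (N < W)%N) (d_gt0 : (0 < d)%N) (nW : (p ^ d < W)%N) (dW : (d < W)%N).
Local Notation run := (run W x tau).
Local Notation ex := (exec W x tau).
Local Notation w := (root_of_unity R p).
Local Notation z := (root_of_unity R N).
Local Notation m := (p ^ d.-1)%N.
Implicit Types (s : state R).

(** The transform of Bluestein's reflected chirp is the same for every line, so it is tabulated
    once. *)
Definition chirp : nat -> R[i] := dft N z (fun j => w ^+ triangular ((N - j) %% N)).

Record tables s : Prop := Tables {
  tables_p : ia s iP 0 = p;
  tables_d : ia s iDim 0 = d;
  tables_n : ia s iN 0 = (p ^ d)%N;
  tables_N : ia s iNF 0 = N;
  tables_lg : ia s iLogF 0 = lg;
  tables_m : ia s iRows 0 = m;
  tables_pow : forall j, (j < p)%N -> ca s cPow j = w ^+ j;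
  tables_zeta : forall j, (j < N)%N -> ca s cZeta j = z ^+ j;
  tables_chirp : forall j, (j < N)%N -> ca s cChirp j = chirp j }.

Lemma tables_eq s s' :
  (forall a, a \in [:: iP; iDim; iN; iNF; iLogF; iRows] -> ia s' a 0 = ia s a 0) ->
  (forall a j, a \in [:: cPow; cZeta; cChirp] -> ca s' a j = ca s a j) ->
  tables s -> tables s'.
Proof.
move=> hi hc [h1 h2 h3 h4 h5 h6 h7 h8 h9]; split; rewrite ?hi// => j jN; rewrite hc//.
- exact: h7.
- exact: h8.
- exact: h9.
Qed.

(** Frame rule: preservation of the tables is reduced to a computation on the syntax of the
    command. *)
Lemma tables_ex c s s' : ex c s s' ->
  all (fun a => ikeeps a c) [:: iP; iDim; iN; iNF; iLogF; iRows] ->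
  all (fun a => ckeeps a c) [:: cPow; cZeta; cChirp] -> tables s -> tables s'.
Proof.
move=> e /allP hi /allP hc; apply: tables_eq.
  move=> a ha; rewrite (ikeepsP e) ?hi//; move: ha; rewrite !inE.
  by do 5?[case/orP]; move/eqP=> ->.
move=> a j ha; rewrite (ckeepsP e) ?hc//; move: ha; rewrite !inE.
by do 2?[case/orP]; move/eqP=> ->.
Qed.

Lemma m_def : (m * p = p ^ d)%N.
Proof. by rewrite -expnSr prednK. Qed.

Lemma m_gt0 : (0 < m)%N. Proof. by rewrite expn_gt0 p_gt0. Qed.

Lemma N_gt0 : (0 < N)%N. Proof. by rewrite NE expn_gt0. Qed.

Lemma pW : (p < W)%N.
Proof. by rewrite (leq_ltn_trans _ nW)// -m_def leq_pmull// m_gt0. Qed.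

Lemma root_of_unity_neq0 j : w ^+ j != 0.
Proof.
apply/eqP => w0; have := root_of_unity_conjX R p j.
by rewrite w0 mulr0 => /esym/eqP; rewrite oner_eq0.
Qed.

Lemma conjc_root j : conjc (w ^+ j) = (w ^+ j)^-1.
Proof.
apply: (mulIf (root_of_unity_neq0 j)).
by rewrite root_of_unity_conjX// mulVf// root_of_unity_neq0.
Qed.

Lemma chirp_expE s e j : tables s -> ieval s e = j ->
  ceval s (CConj (chirp_exp e)) = (w ^+ triangular j)^-1.
Proof.
move=> ts ej; rewrite /chirp_exp /triangle_exp !evE ej tables_p// tables_pow ?ltn_pmod//.
by rewrite root_of_unity_mod// conjc_root.
Qed.

Lemma run_line_dft s b : tables s -> ia s iRow 0 = b ->
  run line_dft s (fun s' =>
    (forall j, ca s' cE j = if (b * p <= j < b * p + p)%N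
       then \sum_(t < p) ca s cD (t + p * b)%N * w ^+ ((j - b * p) * t) else ca s cE j) /\
    (steps s' <= steps s + line_cost N lg)%N).
Proof.
move=> ts sb; have [sP _ _ sN slg _ spow szeta schirp] := ts.
have zN : z ^+ N = 1 by apply: root_of_unity_expr_eq1 N_gt0.
pose a0 t : R[i] := if (t < p)%N then ca s cD (t + p * b)%N / w ^+ triangular t else 0.
apply: (run_seq_fill (N := N) (base := 0) (g := a0)) => //.
  move=> j s1 jN ia1 ca1 s1j _; split=> //.
  have ts1 : tables s1.
    apply: tables_eq ts => [a|a i]; rewrite !inE.
      by do 5?[case/orP]; move/eqP=> ->; rewrite ia1.
    by do 2?[case/orP]; move/eqP=> ->; rewrite ca1.
  rewrite evCMul evCMul (chirp_expE ts1 (j := j))// !evE s1j ia1// sP ia1// sb ca1// /a0.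
  case: ltnP => jp; first by rewrite divn_small// subn0 mul1r.
  have : (0 < j %/ p)%N by rewrite divn_gt0.
  by case: (j %/ p)%N => // i _; rewrite subSS sub0n mul0r.
move=> s1 ia1 ca1 X1 st1.
apply: run_seq (run_fft _ _ NE NW _ _ zN _) _; rewrite ?ia1//.
  by move=> j jN; rewrite ca1// szeta.
move=> s2 e2 [X2 st2].
pose a1 v : R[i] := dft N z a0 v * chirp v.
have X1E : dft N z (ca s1 cX) =1 dft N z a0.
  by move=> v; apply: eq_bigr => t _; rewrite X1 /= ltn_ord subn0.
apply: (run_seq_fill (N := N) (base := 0) (g := a1)) => //.
- by rewrite (ikeepsP e2)// ia1.
- move=> j s3 jN ia3 ca3 s3j X3; split=> //.
  rewrite !evE s3j X3 ?leqnn ?orbT// X2// X1E ca3// (ckeepsP e2)// ca1// schirp//.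
move=> s3 ia3 ca3 X3 st3.
apply: run_seq (run_fft _ _ NE NW _ _ zN _) _.
- by rewrite ia3// (ikeepsP e2)// ia1.
- by rewrite ia3// (ikeepsP e2)// ia1.
- by move=> j jN; rewrite ca3// (ckeepsP e2)// ca1// szeta.
move=> s4 e4 [X4 st4].
have X3E : dft N z (ca s3 cX) =1 dft N z a1.
  by move=> v; apply: eq_bigr => t _; rewrite X3 /= ltn_ord subn0.
have ts4 : tables s4.
  apply: (tables_ex e4) => //; apply: (@tables_eq s2).
  - by move=> a; rewrite !inE; do 5?[case/orP]; move/eqP=> ->; rewrite ia3.
  - by move=> a i; rewrite !inE; do 2?[case/orP]; move/eqP=> ->; rewrite ca3.
  apply: (tables_ex e2) => //; apply: tables_eq ts.
  - by move=> a; rewrite !inE; do 5?[case/orP]; move/eqP=> ->; rewrite ia1.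
  - by move=> a i; rewrite !inE; do 2?[case/orP]; move/eqP=> ->; rewrite ca1.
have row4 : ia s4 iRow 0 = b by rewrite (ikeepsP e4)// ia3// (ikeepsP e2)// ia1.
have E4 j : ca s4 cE j = ca s cE j by rewrite (ckeepsP e4)// ca3// (ckeepsP e2)// ca1.
apply: (run_last_fill (N := p) (base := (b * p)%N)
  (g := fun f => \sum_(t < p) ca s cD (t + p * b)%N * w ^+ (f * t))) => //.
- by rewrite (tables_p ts4).
- exact: pW.
- move=> f s5 fp ia5 ca5 s5f _.
  have ts5 : tables s5.
    apply: tables_eq ts4 => [a|a i]; rewrite !inE.
      by do 5?[case/orP]; move/eqP=> ->; rewrite ia5.
    by do 2?[case/orP]; move/eqP=> ->; rewrite ca5.
  have fN : (f < N)%N by apply: leq_trans fp (leq_trans _ pN); rewrite leq_pmull.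
  split; first by rewrite !evE ia5// row4 ia5// (tables_p ts4).
  rewrite evCMul (chirp_expE ts5 (j := f))// !evE s5f (tables_N ts5) ca5// X4// X3E.
  have <- := bluestein (root_of_unity_prim R N_gt0) _ _ pN
    (fun t => ca s cD (t + p * b)%N) fp => //.
  - by rewrite pnatr_eq0 -lt0n N_gt0.
  - by have := root_of_unity_neq0 1; rewrite expr1.
move=> s5 _ _ E5 st5; split; first by move=> j; rewrite E5 E4.
have pN' : (p <= N)%N by apply: leq_trans pN; rewrite leq_pmull.
move: st5 st4 st3 st2 st1 pN'; rewrite /line_cost.
by move: (fft_cost N lg) => X; lia.
Qed.

Lemma run_axis_dft s (g : nat -> R[i]) : tables s ->
  (forall c, (c < p ^ d)%N -> ca s cD c = g c) ->
  run axis_dft s (fun s' =>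
    (forall c, (c < p ^ d)%N -> ca s' cD c = axis_pass p w m g c) /\
    (steps s' <= steps s + axis_cost p m N lg)%N).
Proof.
move=> ts sD; have mp := m_def; have m0 := m_gt0.
have mW : (m < W)%N by rewrite (leq_ltn_trans _ nW)// -mp leq_pmulr.
pose h j : R[i] := \sum_(t < p) g (t + p * (j %/ p))%N * w ^+ (j %% p * t).
pose Inv b (I : nat -> nat -> nat) (C : nat -> nat -> R[i]) :=
  forall j, (j < b * p)%N -> C cE j = h j.
apply: (run_seq (Q1 := fun s' => Inv m (ia s') (ca s') /\
    (steps s' <= steps s + (2 + m * (line_cost N lg + 2)))%N)).
  apply: run_for => //; first by rewrite (tables_m ts).
  move=> b s1 bm ik1 ck1 s1b Inv1.
  have ts1 : tables s1.
    apply: tables_eq ts => [a|a i]; rewrite !inE.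
      by do 5?[case/orP]; move/eqP=> ->; rewrite ik1.
    by do 2?[case/orP]; move/eqP=> ->; rewrite ck1.
  apply: run_post (run_line_dft ts1 s1b) _ => s2 _ [E2 st2]; split=> //.
  move=> s3 _ _ -> j; rewrite mulSn addnC => jb; rewrite E2 jb andbT.
  case: leqP => jb'; last exact: Inv1.
  rewrite /h; have jE : (j = b * p + (j - b * p))%N by lia.
  have jp : (j - b * p < p)%N by lia.
  have jdiv : (j %/ p = b)%N by rewrite jE divnMDl// (divn_small jp) addn0.
  have jmod : (j %% p = j - b * p)%N by rewrite [in LHS]jE modnMDl (modn_small jp).
  rewrite jdiv jmod.
  apply: eq_bigr => t _; rewrite ck1// sD//.
  rewrite -mp [(m * p)%N]mulnC; apply: (@leq_trans (p * b.+1)); first by rewrite mulnS ltn_add2r.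
  by rewrite leq_mul2l bm orbT.
move=> s1 e1 [Inv1 st1]; have ts1 : tables s1 by apply: (tables_ex e1) ts.
have cm c : (c < p ^ d)%N -> (c %/ m < p)%N by move=> cn; rewrite ltn_divLR// mulnC mp.
apply: (run_last_fill (N := (p ^ d)%N) (base := 0)
  (g := fun c => axis_pass p w m g c)) => //.
- by rewrite (tables_n ts1).
- move=> c s2 cn ia2 ca2 s2c _; split=> //; rewrite !evE s2c !ia2// (tables_m ts1).
  rewrite (tables_p ts1) ca2// Inv1.
    have hd : ((c %% m * p + c %/ m) %/ p = c %% m)%N.
      by rewrite divnMDl// (divn_small (cm c cn)) addn0.
    have hm : ((c %% m * p + c %/ m) %% p = c %/ m)%N.
      by rewrite modnMDl modn_small ?cm.
    by rewrite /h hd hm.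
  apply: (@leq_trans ((c %% m).+1 * p)); last by rewrite leq_mul2r ltn_mod m0 orbT.
  by rewrite mulSn addnC ltn_add2r cm.
move=> s2 _ _ D2 st2; split; first by move=> c cn; rewrite D2 cn subn0.
move: st1 st2; rewrite /axis_cost [(p * m)%N]mulnC mp.
by move: (line_cost N lg) (m * _)%N => X Y; lia.
Qed.

Lemma run_grid_dft s : tables s ->
  run grid_dft s (fun s' =>
    (forall f : grid p d, ca s' cD (code f) =
       \sum_(t : grid p d) ca s cD (code t) * character R f t) /\
    (steps s' <= steps s + dft_cost p d N lg)%N).
Proof.
move=> ts.
pose Inv i (I : nat -> nat -> nat) (C : nat -> nat -> R[i]) :=
  forall c, (c < p ^ d)%N -> C cD c = iter i (axis_pass p w m) (ca s cD) c.
apply: (run_post (Q1 := fun s' => Inv d (ia s') (ca s') /\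
    (steps s' <= steps s + (2 + d * (axis_cost p m N lg + 2)))%N)); last first.
  move=> s1 _ [Inv1 st1]; split=> // f.
  by rewrite Inv1 ?code_lt// axis_passes_dft.
apply: run_for => //; first by rewrite (tables_d ts).
  by move=> s1 _ -> c _.
move=> i s1 id ik1 ck1 s1i Inv1.
have ts1 : tables s1.
  apply: tables_eq ts => [a|a j]; rewrite !inE.
    by do 5?[case/orP]; move/eqP=> ->; rewrite ik1.
  by do 2?[case/orP]; move/eqP=> ->; rewrite ck1.
apply: run_post (run_axis_dft ts1 Inv1) _ => s2 _ [D2 st2]; split=> //.
by move=> s3 _ _ -> c cn; rewrite D2// iterS.
Qed.

End GridFourierProgram.

(** * Programs that turn samples into estimates at all frequencies *)

Notation iBatch := 21 (only parsing).
Notation iGroup := 22 (only parsing).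
Notation iSamp := 23 (only parsing).
Notation iC := 24 (only parsing).
Notation iCount := 25 (only parsing).
Notation iJ := 26 (only parsing).
Notation iCode := 27 (only parsing).
Notation cU := 12 (only parsing).
Notation cXs := 13 (only parsing).
Notation cEst := 14 (only parsing).
Notation cSel := 15 (only parsing).

(* The inverse transform is the conjugate of the transform of the conjugate. *)
Definition time_domain : cmd :=
  Seq (Fill iI iN cD (IConst 0) (CConj (CA cy (IV iI))))
  (Seq grid_dft
  (Fill iI iN cU (IConst 0) (CDiv (CConj (CA cD (IV iI))) (CSqrt (COfNat (IV iN)))))).

Definition sample_position : iexp :=
  IAdd (IMul (IAdd (IMul (IV iBatch) (IV iL)) (IV iGroup)) (IV iB)) (IV iSamp).

Definition add_sample : cmd :=
  Seq (ISet (AV iCode) (IA iT sample_position))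
      (CSet (AA cD (IV iCode))
         (CAdd (CA cD (IV iCode)) (CSub (CA cXs sample_position) (CA cU (IV iCode))))).

(** The B residual samples are accumulated at their grid positions, repetitions adding up, and one
    transform then yields the estimates at all n frequencies. Evaluating each frequency separately
    would cost n B instead of O(n log n). *)
Definition estimate_group : cmd :=
  Seq (Fill iI iN cD (IConst 0) (COfNat (IConst 0)))
  (Seq (For iSamp iB add_sample)
  (Seq grid_dft
  (Fill iI iN cEst (IMul (IV iGroup) (IV iN))
     (CMul (CDiv (CSqrt (COfNat (IV iN))) (COfNat (IV iB))) (CA cD (IV iI)))))).

Definition estimate_all : cmd := For iGroup iL estimate_group.

Definition group_accum_cost (n B : nat) : nat := 2 + 3 * n + (2 + B * 4).
Definition group_cost (p d N lg B : nat) : nat :=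
  group_accum_cost (p ^ d) B + dft_cost p d N lg + (2 + 3 * p ^ d).

Section EstimationPrograms.
Variables (R : realType) (p d W : nat) (x : signal R p d) (tau : nat -> draw R p d).
Variables (N lg L B K : nat).
Hypotheses (p_gt0 : (0 < p)%N) (NE : N = (2 ^ lg)%N) (pN : (2 * p <= N)%N).
Hypotheses (NW : (N < W)%N) (d_gt0 : (0 < d)%N) (nW : (p ^ d < W)%N) (dW : (d < W)%N).
Hypotheses (LW : (L < W)%N) (BW : (B < W)%N).
Local Notation run := (run W x tau).
Local Notation ex := (exec W x tau).
Local Notation n := (p ^ d)%N.
Local Notation G := (grid p d).
Local Notation tables := (@tables R p d N lg).
Implicit Types (s : state R) (y : signal R p d) (f t : G).

Definition holds (a : nat) (v : signal R p d) s : Prop := forall t, ca s a (code t) = v t.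

(** The stream of draws is read in lexicographic order of batch, group and sample. *)
Definition drawn_batch (i : nat) : batch p d L B :=
  [ffun r : 'I_L => [ffun b : 'I_B => (tau ((i * L + r) * B + b)%N).1]].

Record sampled s : Prop := Sampled {
  sampled_tables : tables s;
  sampled_L : ia s iL 0 = L;
  sampled_B : ia s iB 0 = B;
  sampled_T : forall j, (j < K * L * B)%N -> ia s iT j = code (tau j).1;
  sampled_x : forall j, (j < K * L * B)%N -> ca s cXs j = x (tau j).1 }.

Lemma sampled_eq s s' :
  (forall a j, a \in [:: iP; iDim; iN; iNF; iLogF; iRows; iL; iB; iT] -> ia s' a j = ia s a j) ->
  (forall a j, a \in [:: cPow; cZeta; cChirp; cXs] -> ca s' a j = ca s a j) ->
  sampled s -> sampled s'.
Proof.
move=> hi hc [h1 h2 h3 h4 h5]; split; rewrite ?hi//.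
- apply: tables_eq h1 => [a|a j] ha.
    by rewrite hi//; move: ha; rewrite !inE; do 5?[case/orP]; move/eqP=> ->.
  by rewrite hc//; move: ha; rewrite !inE; do 2?[case/orP]; move/eqP=> ->.
- by move=> j jN; rewrite hi// h4.
- by move=> j jN; rewrite hc// h5.
Qed.

Lemma sampled_ex c s s' : ex c s s' ->
  all (fun a => ikeeps a c) [:: iP; iDim; iN; iNF; iLogF; iRows; iL; iB; iT] ->
  all (fun a => ckeeps a c) [:: cPow; cZeta; cChirp; cXs] -> sampled s -> sampled s'.
Proof.
move=> e /allP hi /allP hc; apply: sampled_eq.
  move=> a j ha; rewrite (ikeepsP e) ?hi//; move: ha; rewrite !inE.
  by do 8?[case/orP]; move/eqP=> ->.
move=> a j ha; rewrite (ckeepsP e) ?hc//; move: ha; rewrite !inE.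
by do 3?[case/orP]; move/eqP=> ->.
Qed.

Lemma Re_natr j : complex.Re (j%:R : R[i]) = j%:R.
Proof. by rewrite -(rmorph_nat (real_complex R)). Qed.

Lemma run_time_domain s y : tables s -> holds cy y s ->
  run time_domain s (fun s' => holds cU (inverse_fourier y) s' /\
    (steps s' <= steps s + (4 + 6 * n + dft_cost p d N lg))%N).
Proof.
move=> ts hy.
apply: (run_seq_fill (N := n) (base := 0) (g := fun c => conjc (ca s cy c))) => //.
- by rewrite (tables_n ts).
- by move=> c s1 cn ia1 ca1 s1c _; split=> //; rewrite !evE s1c ca1.
move=> s1 ia1 ca1 D1 st1.
have ts1 : tables s1.
  apply: tables_eq ts => [a|a i]; rewrite !inE.
    by do 5?[case/orP]; move/eqP=> ->; rewrite ia1.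
  by do 2?[case/orP]; move/eqP=> ->; rewrite ca1.
apply: run_seq (run_grid_dft _ _ _ _ _ _ _ _ _ ts1) _ => //.
move=> s2 e2 [D2 st2]; have ts2 : tables s2 by apply: (tables_ex e2) ts1.
apply: (run_last_fill (N := n) (base := 0)
  (g := fun c => conjc (ca s2 cD c) / (Num.sqrt n%:R)%:C%C)) => //.
- by rewrite (tables_n ts2).
- move=> c s3 cn ia3 ca3 s3c _; split=> //; rewrite !evE s3c ca3// ia3// (tables_n ts2).
  by rewrite Re_natr.
move=> s3 _ _ U3 st3; split; last by move: st1 st2 st3; move: (dft_cost _ _ _ _) => X; lia.
move=> t; rewrite U3 code_lt//= subn0 D2 conjc_sum ffunE mulrC -fmorphV; congr (_ * _).
apply: eq_bigr => f _; rewrite D1 code_lt//= subn0 conjcM hy characterC.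
by rewrite conjcK.
Qed.

Lemma run_estimate_group s (i r : nat) u : sampled s -> holds cU u s ->
  ia s iBatch 0 = i -> ia s iGroup 0 = r -> (i < K)%N -> (r < L)%N ->
  run estimate_group s (fun s' =>
    (forall j, ca s' cEst j = if (r * n <= j < r * n + n)%N then
       (Num.sqrt n%:R / B%:R)%:C%C * \sum_(b < B)
          (x - u) (tau ((i * L + r) * B + b)%N).1 *
          character R (decode d p_gt0 (j - r * n)) (tau ((i * L + r) * B + b)%N).1
       else ca s cEst j) /\
    (steps s' <= steps s + group_cost p d N lg B)%N).
Proof.
move=> ss hU si sr iK rL; have ts := sampled_tables ss.
pose tt b := (tau ((i * L + r) * B + b)%N).1.
have posK b : (b < B)%N -> ((i * L + r) * B + b < K * L * B)%N.
  move=> bB; have h1 : ((i * L + r) * B + b < (i * L + r).+1 * B)%N.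
    by rewrite mulSn addnC ltn_add2r.
  apply: (leq_trans h1); rewrite leq_mul2r; apply/orP; right.
  by apply: (@leq_trans (i.+1 * L)); [rewrite mulSn addnC ltn_add2r|rewrite leq_mul2r iK orbT].
apply: (run_seq_fill (N := n) (base := 0) (g := fun c => 0)) => //.
- by rewrite (tables_n ts).
move=> s1 ia1 ca1 D1 st1.
have ss1 : sampled s1.
  apply: sampled_eq ss => [a j|a j]; rewrite !inE.
    by do 8?[case/orP]; move/eqP=> ->; rewrite ia1.
  by do 3?[case/orP]; move/eqP=> ->; rewrite ca1.
pose Inv b (I : nat -> nat -> nat) (C : nat -> nat -> R[i]) :=
  forall t, C cD (code t) = \sum_(b' < b | tt b' == t) (x - u) (tt b').
apply: (run_seq (Q1 := fun s' => Inv B (ia s') (ca s') /\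
    (steps s' <= steps s1 + (2 + B * (2 + 2)))%N)).
  apply: run_for => //; first by rewrite (sampled_B ss1).
    by move=> s2 _ -> t; rewrite big_ord0 D1 code_lt.
  move=> b s2 bB ik2 ck2 s2b Inv2.
  have ss2 : sampled s2.
    apply: sampled_eq ss1 => [a j|a j]; rewrite !inE.
      by do 8?[case/orP]; move/eqP=> ->; rewrite ik2.
    by do 3?[case/orP]; move/eqP=> ->; rewrite ck2.
  have s2pos : ieval s2 sample_position = ((i * L + r) * B + b)%N.
    rewrite /sample_position !evE s2b (sampled_B ss2) (sampled_L ss2) !ik2// !ia1//.
    by rewrite si sr.
  have code2 : ia s2 iT (ieval s2 sample_position) = code (tt b).
    by rewrite s2pos (sampled_T ss2)// posK.
  apply: run_seq_iset => //.
    by rewrite evIA code2 (ltn_trans _ nW)// code_lt.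
  move=> s3; rewrite evIA code2 => ia3 ca3 st3.
  have s3pos : ieval s3 sample_position = ((i * L + r) * B + b)%N.
    by rewrite -s2pos /sample_position !evE !ia3.
  apply: run_last_cset => // s4 ca4 ia4 st4; split; first by rewrite st4 st3; lia.
  move=> s5 _ _ ca5 t; rewrite ca5 ca4// evCAdd evCSub !evCA !evIV s3pos ia3//= ca3.
  rewrite big_mkcond big_ord_recr /= -big_mkcond /= -Inv2.
  rewrite (inj_eq (@code_inj p d p_gt0)) eq_sym.
  case: eqP => [<-|_]; last by rewrite addr0.
  rewrite (sampled_x ss2) ?posK// [ca s2 cU _]ck2// ca1// hU -/(tt b).
  by rewrite signal_subE.
move=> s2 e2 [Inv2 st2].
have ss2 : sampled s2 by apply: (sampled_ex e2) ss1.
apply: run_seq (run_grid_dft _ _ _ _ _ _ _ _ _ (sampled_tables ss2)) _ => //.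
move=> s3 e3 [D3 st3]; have ss3 : sampled s3 by apply: (sampled_ex e3) ss2.
have ts3 := sampled_tables ss3.
have sr3 : ia s3 iGroup 0 = r by rewrite (ikeepsP e3)// (ikeepsP e2)// ia1.
apply: (run_last_fill (N := n) (base := (r * n)%N) (g := fun c =>
    (Num.sqrt n%:R / B%:R)%:C%C * \sum_(b < B) (x - u) (tt b) *
       character R (decode d p_gt0 c) (tt b))) => //.
- by rewrite (tables_n ts3).
- move=> c s4 cn ia4 ca4 s4c _; split; first by rewrite !evE !ia4// sr3 (tables_n ts3).
  rewrite !evE s4c ca4// !ia4// (tables_n ts3) (sampled_B ss3) Re_natr.
  congr (_ * _); first by rewrite rmorphM /= fmorphV /= rmorph_nat.
  rewrite -{1}(decodeK p_gt0 cn) D3.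
  under eq_bigr => t _ do rewrite Inv2 mulr_suml.
  (* Regrouping by draws: each draw contributes at its own position only. *)
  rewrite (exchange_big_dep predT)//=; apply: eq_bigr => b _.
  by rewrite (big_pred1 (tt b))// => t; rewrite eq_sym.
move=> s4 _ _ E4 st4; split.
  move=> j; rewrite E4; case: ifP => // _.
  by rewrite (ckeepsP e3)// (ckeepsP e2)// ca1.
move: st1 st2 st3 st4; rewrite /group_cost /group_accum_cost.
by move: (dft_cost _ _ _ _) n => X Y; lia.
Qed.

End EstimationPrograms.

(** * The program of one halving round *)

Definition estimate_index (e : iexp) : iexp := IAdd (IMul e (IV iN)) (IV iC).
Definition abs_sqr_exp (e : cexp) : cexp := CMul e (CConj e).
Definition sqr_exp (e : cexp) : cexp := CMul e e.
Definition group_diff : cexp :=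
  CSub (CA cEst (estimate_index (IV iI))) (CA cEst (estimate_index (IV iJ))).

Definition count_votes : cmd :=
  For iJ iL (If (BCLe (abs_sqr_exp group_diff) (sqr_exp (CDiv (CV cM) (COfNat (IConst 12)))))
    (ISet (AV iCount) (IAdd (IV iCount) (IConst 1))) Skip).

Definition try_group : cmd :=
  Seq (ISet (AV iCount) (IConst 0)) (Seq count_votes
    (If (BNot (BILe (IMul (IConst 2) (IV iCount)) (IV iL)))
       (CSet (AV cSel) (CA cEst (estimate_index (IV iI)))) Skip)).

Definition update_frequency : cmd :=
  Seq (CSet (AV cSel) (COfNat (IConst 0))) (Seq (For iI iL try_group)
    (If (BCLe (abs_sqr_exp (CV cSel))
              (sqr_exp (CMul (CDiv (COfNat (IConst 3)) (COfNat (IConst 8))) (CV cM))))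
       Skip (CSet (AA cy (IV iC)) (CAdd (CA cy (IV iC)) (CV cSel))))).

Definition update_all : cmd := For iC iN update_frequency.

Definition round_prog : cmd := Seq time_domain (Seq estimate_all update_all).

Definition votes_cost (L : nat) : nat := 2 + L * 4.
Definition frequency_cost (L : nat) : nat := 5 + L * (5 + votes_cost L).
Definition round_cost (p d N lg L B : nat) : nat :=
  (4 + 6 * p ^ d + dft_cost p d N lg) + (2 + L * (group_cost p d N lg B + 2)) +
  (2 + p ^ d * (frequency_cost L + 2)).

Lemma real_complexM (R : realType) (a b : R) : a%:C%C * b%:C%C = (a * b)%:C%C.
Proof. by rewrite rmorphM. Qed.

Lemma real_complex_div (R : realType) (a : R) j : a%:C%C / j%:R = (a / j%:R)%:C%C :> R[i].
Proof. by rewrite rmorphM fmorphV rmorph_nat. Qed.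

Section RoundProgram.
Variables (R : realType) (p d W : nat) (x : signal R p d) (tau : nat -> draw R p d).
Variables (N lg L B K : nat).
Hypotheses (p_gt0 : (0 < p)%N) (NE : N = (2 ^ lg)%N) (pN : (2 * p <= N)%N).
Hypotheses (NW : (N < W)%N) (d_gt0 : (0 < d)%N) (nW : (p ^ d < W)%N) (dW : (d < W)%N).
Hypotheses (LW : (L < W)%N) (BW : (B < W)%N).
Local Notation run := (run W x tau).
Local Notation n := (p ^ d)%N.
Local Notation G := (grid p d).
Local Notation sampled := (sampled x tau N lg L B K).
Local Notation drawn_batch := (drawn_batch tau L B).
Local Notation decode := (decode d p_gt0).
Implicit Types (s : state R) (y : signal R p d) (f t : G).

Lemma run_estimate_all s i y : sampled s -> holds cU (inverse_fourier y) s ->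
  ia s iBatch 0 = i -> (i < K)%N ->
  run estimate_all s (fun s' =>
    (forall r c, (r < L)%N -> (c < n)%N ->
       ca s' cEst (r * n + c)%N = estimates x y (drawn_batch i) (decode c) r) /\
    (steps s' <= steps s + (2 + L * (group_cost p d N lg B + 2)))%N).
Proof.
move=> ss hU si iK.
pose Inv r (I : nat -> nat -> nat) (C : nat -> nat -> R[i]) :=
  forall r' c, (r' < r)%N -> (c < n)%N ->
    C cEst (r' * n + c)%N = estimates x y (drawn_batch i) (decode c) r'.
apply: (run_post (Q1 := fun s' => Inv L (ia s') (ca s') /\
    (steps s' <= steps s + (2 + L * (group_cost p d N lg B + 2)))%N)); last first.
  by move=> s' _ [h1 h2].
apply: run_for => //; first by rewrite (sampled_L ss).
move=> r s1 rL ik1 ck1 s1r Inv1.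
have ss1 : sampled s1.
  apply: sampled_eq ss => [a j|a j]; rewrite !inE.
    by do 8?[case/orP]; move/eqP=> ->; rewrite ik1.
  by do 3?[case/orP]; move/eqP=> ->; rewrite ck1.
have hU1 : holds cU (inverse_fourier y) s1 by move=> t; rewrite ck1.
have si1 : ia s1 iBatch 0 = i by rewrite ik1.
apply: run_post (run_estimate_group p_gt0 NE pN NW d_gt0 nW dW LW BW ss1 hU1 si1 s1r iK rL) _.
move=> s2 _ [E2 st2]; split=> //.
move=> s3 _ _ -> r' c; rewrite ltnS leq_eqVlt => /orP[/eqP ->|r'r] cn.
  rewrite E2 leq_addr ltn_add2l cn /= addKn (estimatesE _ _ _ _ (Ordinal rL)).
  rewrite /group_estimate; congr (_ * _); apply: eq_bigr => b _.
  by rewrite !ffunE.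
rewrite E2 ifF; first exact: Inv1.
apply/negbTE; rewrite negb_and -ltnNge; apply/orP; left.
apply: (@leq_trans (r'.+1 * n)); first by rewrite mulSn addnC ltn_add2r.
by rewrite leq_mul2r r'r orbT.
Qed.

Lemma run_count_votes s (v : nat -> R[i]) (M : R) (i c : nat) :
  ia s iL 0 = L -> ia s iN 0 = n -> ia s iI 0 = i -> ia s iC 0 = c -> ia s iCount 0 = 0 ->
  ca s cM 0 = M%:C%C -> (forall r, (r < L)%N -> ca s cEst (r * n + c)%N = v r) ->
  (i < L)%N ->
  run count_votes s (fun s' => ia s' iCount 0 = votes v ((M / 12) ^+ 2) L i /\
    (steps s' <= steps s + votes_cost L)%N).
Proof.
move=> sL sN si sc s0 sM sv ltiL; set e := (M / 12) ^+ 2.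
pose Inv j (I : nat -> nat -> nat) (C : nat -> nat -> R[i]) :=
  I iCount 0%N = (\sum_(j' < j) close v e i j')%N.
apply: (run_post (Q1 := fun s' => Inv L (ia s') (ca s') /\
    (steps s' <= steps s + (2 + L * (2 + 2)))%N)); last by [].
apply: run_for => //.
  by move=> s1 ia1 _; rewrite /Inv big_ord0 ia1.
move=> j s1 jL ik1 ck1 s1j Inv1.
have bE : beval s1 (BCLe (abs_sqr_exp group_diff)
    (sqr_exp (CDiv (CV cM) (COfNat (IConst 12))))) = close v e i j.
  rewrite /abs_sqr_exp /sqr_exp /group_diff /estimate_index !evE s1j !ik1//.
  rewrite sN si sc !ck1// !sv// sM /close; congr (_ <= _).
  by rewrite real_complex_div real_complexM -expr2.
have jle (j' : nat) : (\sum_(j0 < j') close v e i j0 <= j')%N.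
  elim: j' => [|j' IH]; first by rewrite big_ord0.
  by rewrite big_ord_recr /= -addn1 leq_add// leq_b1.
apply: run_if; rewrite bE => cl s2 ia2 ca2 st2.
  have s2c : ia s2 iCount 0 = (\sum_(j' < j) close v e i j')%N by rewrite ia2.
  apply: run_last_iset => //.
    by rewrite !evE s2c addn1 (leq_ltn_trans _ LW)// (leq_ltn_trans (jle j)).
  move=> s3 ia3 ca3 st3; split; first by rewrite st3 st2; lia.
  by move=> s4 _ ia4 _; rewrite /Inv ia4// ia3// !evE s2c big_ord_recr /= cl.
apply: run_post (run_skip _ _ _ _) _ => s3 _ [ia3 ca3 st3].
split; first by rewrite st3 st2; lia.
by move=> s4 _ ia4 _; rewrite /Inv ia4// ia3 ia2 big_ord_recr /= (negbTE cl) addn0.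
Qed.

Lemma run_update_frequency s (v : nat -> R[i]) (M : R) (c : nat) :
  ia s iL 0 = L -> ia s iN 0 = n -> ia s iC 0 = c ->
  ca s cM 0 = M%:C%C -> (forall r, (r < L)%N -> ca s cEst (r * n + c)%N = v r) ->
  run update_frequency s (fun s' =>
    (forall j, ca s' cy j =
      let u := select v ((M / 12) ^+ 2) L L in
      if (j == c) && ~~ (complex.Re (u * conjc u) <= (3 / 8 * M) ^+ 2)
      then ca s cy j + u else ca s cy j) /\
    (steps s' <= steps s + frequency_cost L)%N).
Proof.
move=> sL sN sc sM sv; set e := (M / 12) ^+ 2.
apply: run_seq_cset => // s1 ca1 ia1 st1.
pose Inv i (I : nat -> nat -> nat) (C : nat -> nat -> R[i]) := C cSel 0%N = select v e L i.
apply: (run_seq (Q1 := fun s' => Inv L (ia s') (ca s') /\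
    (steps s' <= steps s1 + (2 + L * (3 + votes_cost L + 2)))%N)).
  apply: run_for => //; first by rewrite ia1.
    by move=> s2 _ ca2; rewrite /Inv ca2 ca1.
  move=> i s2 ltiL ik2 ck2 s2i Inv2.
  apply: run_seq_iset => //; first by rewrite !evE (leq_ltn_trans _ LW).
  move=> s3 ia3 ca3 st3.
  have sv3 r : (r < L)%N -> ca s3 cEst (r * n + c)%N = v r.
    by move=> rL; rewrite ca3 ck2// ca1// sv.
  have sM3 : ca s3 cM 0 = M%:C%C by rewrite ca3 ck2// ca1.
  apply: run_seq (run_count_votes _ _ _ _ _ sM3 sv3 ltiL) _.
  - by rewrite ia3// ik2// ia1.
  - by rewrite ia3// ik2// ia1.
  - by rewrite ia3.
  - by rewrite ia3// ik2// ia1.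
  - by rewrite ia3.
  move=> s4 e4 [v4 st4].
  have L4 : ia s4 iL 0 = L by rewrite (ikeepsP e4)// ia3// ik2// ia1.
  have sel4 : ca s4 cSel 0 = select v e L i by rewrite (ckeepsP e4)// ca3.
  apply: run_if; rewrite !evE v4 L4 -ltnNge => win s5 ia5 ca5 st5.
    have vE : ceval s5 (CA cEst (estimate_index (IV iI))) = v i.
      have i4 : ia s4 iI 0 = i by rewrite (ikeepsP e4)// ia3.
      have n4 : ia s4 iN 0 = n by rewrite (ikeepsP e4)// ia3// ik2// ia1.
      have c4 : ia s4 iC 0 = c by rewrite (ikeepsP e4)// ia3// ik2// ia1.
      by rewrite /estimate_index !evE ia5 i4 n4 c4 ca5 (ckeepsP e4)// sv3.
    apply: run_last_cset => // s6 ca6 ia6 st6; split.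
      by move: st3 st4 st5 st6; move: (votes_cost L) => X; lia.
    move=> s7 _ _ ca7; rewrite /Inv ca7 ca6// vE /= win //.
  apply: run_post (run_skip _ _ _ _) _ => s6 _ [ia6 ca6 st6]; split.
    by move: st3 st4 st5 st6; move: (votes_cost L) => X; lia.
  by move=> s7 _ _ ca7; rewrite /Inv ca7 ca6 ca5 sel4 /= (negbTE win).
move=> s2 e2 [sel2 st2]; rewrite /Inv in sel2.
have M2 : ca s2 cM 0 = M%:C%C by rewrite (ckeepsP e2)// ca1.
have y2 j : ca s2 cy j = ca s cy j by rewrite (ckeepsP e2)// ca1.
have c2 : ia s2 iC 0 = c by rewrite (ikeepsP e2)// ia1.
set u := select v e L L in sel2 *.
have bE : beval s2 (BCLe (abs_sqr_exp (CV cSel))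
    (sqr_exp (CMul (CDiv (COfNat (IConst 3)) (COfNat (IConst 8))) (CV cM)))) =
    (complex.Re (u * conjc u) <= (3 / 8 * M) ^+ 2).
  rewrite /abs_sqr_exp /sqr_exp !evE sel2 M2; congr (_ <= _).
  rewrite -[3%:R](rmorph_nat (real_complex R)) real_complex_div !real_complexM.
  by rewrite -expr2.
apply: run_if; rewrite bE => hu s3 ia3 ca3 st3.
  apply: run_post (run_skip _ _ _ _) _ => s4 _ [ia4 ca4 st4]; split.
    by move=> j /=; rewrite hu andbF ca4 ca3 y2.
  by move: st1 st2 st3 st4; rewrite /frequency_cost; move: (votes_cost L) => X; lia.
apply: run_last_cset => // s4 ca4 ia4 st4; split.
  move=> j /=; rewrite ca4// hu andbT !evE ia3 c2 !ca3 y2 y2 sel2.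
  by rewrite /=; case: eqP => [->|].
by move: st1 st2 st3 st4; rewrite /frequency_cost; move: (votes_cost L) => X; lia.
Qed.

Lemma run_round s (i : nat) y (M : R) : sampled s -> holds cy y s ->
  ia s iBatch 0 = i -> (i < K)%N -> ca s cM 0 = M%:C%C ->
  run round_prog s (fun s' => holds cy (round x y (drawn_batch i) M) s' /\
    (steps s' <= steps s + round_cost p d N lg L B)%N).
Proof.
move=> ss hy si iK sM.
apply: run_seq (run_time_domain x tau p_gt0 NE pN NW d_gt0 nW dW LW BW (sampled_tables ss) hy) _.
move=> s1 e1 [U1 st1]; have ss1 : sampled s1 by apply: (sampled_ex e1) ss.
have si1 : ia s1 iBatch 0 = i by rewrite (ikeepsP e1).
apply: run_seq (run_estimate_all ss1 U1 si1 iK) _ => s2 e2 [E2 st2].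
have ss2 : sampled s2 by apply: (sampled_ex e2) ss1.
have M2 : ca s2 cM 0 = M%:C%C by rewrite (ckeepsP e2)// (ckeepsP e1).
have y2 j : ca s2 cy j = ca s cy j by rewrite (ckeepsP e2)// (ckeepsP e1).
pose Inv c (I : nat -> nat -> nat) (C : nat -> nat -> R[i]) :=
  forall t, C cy (code t) =
    if (code t < c)%N then round x y (drawn_batch i) M t else y t.
apply: (run_post (Q1 := fun s' => Inv n (ia s') (ca s') /\
    (steps s' <= steps s2 + (2 + n * (frequency_cost L + 2)))%N)); last first.
  move=> s3 _ [Inv3 st3]; split.
    by move=> t; rewrite Inv3 code_lt.
  move: st1 st2 st3; rewrite /round_cost.
  by move: (dft_cost _ _ _ _) (L * _)%N (n * _)%N => X Y Z; lia.
apply: run_for => //; first by rewrite (tables_n (sampled_tables ss2)).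
  by move=> s3 _ -> t; rewrite y2 hy.
move=> c s3 cn ik3 ck3 s3c Inv3.
have sv3 r : (r < L)%N ->
    ca s3 cEst (r * n + c)%N = estimates x y (drawn_batch i) (decode c) r.
  by move=> rL; rewrite ck3// E2.
have M3 : ca s3 cM 0 = M%:C%C by rewrite ck3.
apply: run_post (run_update_frequency _ _ s3c M3 sv3) _.
- by rewrite ik3// (sampled_L ss2).
- by rewrite ik3// (tables_n (sampled_tables ss2)).
move=> s4 _ [y4 st4]; split=> // s5 _ _ -> t; rewrite y4.
rewrite ltnS leq_eqVlt; case: eqP => [tc|tc] /=; last by rewrite Inv3.
rewrite Inv3 tc ltnn [round _ _ _ _ _]ffunE /residual_estimate -tc codeK.
by rewrite /= if_neg.
Qed.

End RoundProgram.

(** * The program of one stage: rounds, choice of a shift, rounding *)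

Notation iMark := 28 (only parsing).
Notation iRe := 29 (only parsing).
Notation iIm := 30 (only parsing).
Notation iShift := 31 (only parsing).

Definition rounds_prog (b : nat) : cmd :=
  For iBatch b (Seq round_prog (CSet (AV cM) (CDiv (CV cM) (COfNat (IConst 2))))).

Definition fine_cells : iexp := IMul (IConst 4) (IMul (IV iQQ) (IV iQQ)).
Definition offset_exp : cexp := CMul (COfNat fine_cells) (CV cM).
Definition imaginary_unit : cexp := CRoot (IConst 4).
Definition move_exp : cexp := CSub (CA cy (IV iC)) (CA cy0 (IV iC)).

(** [iCode] holds the number of bisections, kappa + 2 = 2 q + 3, and [iJ] the current step, starting
    at half of the 8 Q^2 cells; [cM] holds delta here. *)
Definition bisect (e : cexp) : cmd :=
  Seq (ISet (AV iCount) (IConst 0)) (Seq (ISet (AV iJ) fine_cells)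
    (For iGroup iCode
      (Seq (If (BCLe (CMul (COfNat (IAdd (IV iCount) (IV iJ))) (CV cM)) (CAdd e offset_exp))
              (ISet (AV iCount) (IAdd (IV iCount) (IV iJ))) Skip)
           (ISet (AV iJ) (IDiv (IV iJ) (IConst 2)))))).

Definition mark_part (e : cexp) (a : nat) : cmd :=
  Seq (bisect e)
  (Seq (ISet (AA a (IV iC)) (IV iCount))
  (Seq (ISet (AA iMark (IMod (IV iCount) (IV iQQ))) (IConst 1))
       (ISet (AA iMark (IMod (IAdd (IV iCount) (IConst 1)) (IV iQQ))) (IConst 1)))).

(** A machine test sees real parts only, so the imaginary part is read as the real part after
    multiplication by the conjugate of i. *)
Definition mark_all : cmd :=
  For iC iN (Seq (mark_part move_exp iRe)
                 (mark_part (CMul (CConj imaginary_unit) move_exp) iIm)).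

Definition clear_marks : cmd := For iI iQQ (ISet (AA iMark (IV iI)) (IConst 0)).

Definition choose_shift : cmd :=
  Seq (ISet (AV iShift) (IConst 0))
    (For iI iQQ (If (BILe (IA iMark (IV iI)) (IConst 0)) (ISet (AV iShift) (IV iI)) Skip)).

Definition coarse_exp (a : nat) : cexp :=
  CSub (CMul (COfNat (IDiv (ISub (IAdd (IA a (IV iI)) (IV iQQ)) (IV iShift)) (IV iQQ)))
             (CMul (COfNat (IV iQQ)) (CV cM))) offset_exp.

Definition snap : cmd :=
  Fill iI iN cy (IConst 0)
    (CAdd (CA cy0 (IV iI)) (CAdd (coarse_exp iRe) (CMul imaginary_unit (coarse_exp iIm)))).

(* After kappa halvings cM holds the fine mesh M / 2^kappa, and 2 Q times this is
   the scale M / Q of the next stage. *)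
Definition stage_prog : cmd :=
  Seq (Fill iI iN cy0 (IConst 0) (CA cy (IV iI)))
  (Seq (rounds_prog iKappa)
  (Seq clear_marks
  (Seq (ISet (AV iCode) (IAdd (IV iKappa) (IConst 2)))
  (Seq mark_all
  (Seq choose_shift
  (Seq snap
  (Seq (CSet (AV cM) (CMul (CV cM) (COfNat (IMul (IConst 2) (IV iQQ)))))
       (ISet (AV iM) (ISub (IV iM) (IV iQ)))))))))).

Lemma ReD (R : realType) (z w : R[i]) :
  complex.Re (z + w) = complex.Re z + complex.Re w.
Proof. by case: z; case: w. Qed.

Lemma natr_complexM (R : realType) j (a : R) : j%:R * a%:C%C = (j%:R * a)%:C%C :> R[i].
Proof. by rewrite rmorphM rmorph_nat. Qed.

Section StageProgram.
Variables (R : realType) (p d W : nat) (x : signal R p d) (tau : nat -> draw R p d).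
Variables (N lg L B q : nat).
Hypotheses (p_gt0 : (0 < p)%N) (NE : N = (2 ^ lg)%N) (pN : (2 * p <= N)%N).
Hypotheses (NW : (N < W)%N) (d_gt0 : (0 < d)%N) (nW : (p ^ d < W)%N) (dW : (d < W)%N).
Hypotheses (LW : (L < W)%N) (BW : (B < W)%N).
Local Notation Q := (2 ^ q)%N.
Local Notation kappa := ((2 * q).+1).
Hypothesis QW : (8 * Q ^ 2 < W)%N.
Local Notation run := (run W x tau).
Local Notation n := (p ^ d)%N.
Local Notation G := (grid p d).
Local Notation sampled := (sampled x tau N lg L B kappa).
Local Notation drawn_batch := (drawn_batch tau L B).
Local Notation decode := (decode d p_gt0).
Implicit Types (s : state R) (y : signal R p d) (f t : G).

Lemma QltW : (Q < W)%N.
Proof.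
by apply: leq_ltn_trans QW; rewrite expnS expn1 mulnA leq_pmull// muln_gt0 expn_gt0.
Qed.

Lemma kappaW : (kappa < W)%N.
Proof.
apply: leq_ltn_trans QW; rewrite -expnM [(q * 2)%N]mulnC.
have h := ltn_expl q.*2 (isT : (1 < 2)%N).
by move: h; rewrite -mul2n; move: (2 ^ _)%N => X; lia.
Qed.

Lemma run_rounds_prog s (b c : nat) y (M : R) : b \in [:: iKappa; iM] ->
  sampled s -> holds cy y s -> ca s cM 0 = M%:C%C -> ia s b 0 = c -> (c <= kappa)%N ->
  run (rounds_prog b) s (fun s' => [/\ holds cy (rounds x y M drawn_batch c) s',
    ca s' cM 0 = (M / 2 ^+ c)%:C%C &
    (steps s' <= steps s + (2 + c * (round_cost p d N lg L B + 1 + 2)))%N]).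
Proof.
move=> hb ss hy sM sc ck.
have [b32 bI bbody] : [/\ (b < 32)%N, iBatch != b &
    ikeeps b (Seq round_prog (CSet (AV cM) (CDiv (CV cM) (COfNat (IConst 2)))))].
  by move: hb; rewrite !inE => /orP[] /eqP ->.
pose Inv i (I : nat -> nat -> nat) (C : nat -> nat -> R[i]) :=
  (forall t, C cy (code t) = rounds x y M drawn_batch i t) /\ C cM 0%N = (M / 2 ^+ i)%:C%C.
apply: (run_post (Q1 := fun s' => Inv c (ia s') (ca s') /\
    (steps s' <= steps s + (2 + c * (round_cost p d N lg L B + 1 + 2)))%N)); last first.
  by move=> s' _ [[h1 h2] h3]; split.
apply: run_for => //; first by rewrite (leq_ltn_trans ck kappaW).
  by move=> s1 _ ->; rewrite /Inv /= expr0 divr1.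
move=> i s1 ic ik1 ck1 s1i [y1 M1].
have ss1 : sampled s1.
  apply: sampled_eq ss => [a j|a j]; rewrite !inE.
    by do 8?[case/orP]; move/eqP=> ->; rewrite ik1.
  by do 3?[case/orP]; move/eqP=> ->; rewrite ck1.
apply: run_seq (run_round p_gt0 NE pN NW d_gt0 nW dW LW BW ss1 y1 s1i (leq_trans ic ck) M1) _.
move=> s2 e2 [y2 st2]; apply: run_last_cset => // s3 ca3 ia3 st3; split.
  by rewrite st3; lia.
move=> s4 _ _ ca4; split; first by move=> t; rewrite ca4 ca3//=.
rewrite ca4 ca3// !evE !eqxx /= (ckeepsP e2)// M1 real_complex_div.
by rewrite exprSr invfM mulrA.
Qed.

Lemma imaginary_unitE s : ceval s imaginary_unit = Complex 0 1.
Proof.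
rewrite /imaginary_unit evCRoot evConst /root_of_unity.
have -> : pi *+ 2 / 4 = pi / 2 :> R by rewrite -mulr_natl; field.
by rewrite cos_pihalf sin_pihalf.
Qed.

Lemma run_bisect s (e : cexp) (delta a : R) : ia s iQQ 0 = Q -> ia s iCode 0 = (kappa + 2)%N ->
  ca s cM 0 = delta%:C%C ->
  (forall s1, (forall b j, (b < 32)%N -> b \notin [:: iCount; iJ; iGroup] ->
       ia s1 b j = ia s b j) -> ca s1 = ca s -> complex.Re (ceval s1 e) = a) ->
  run (bisect e) s (fun s' => [/\ ia s' iCount 0 = fine_index q delta a, ca s' = ca s &
    (steps s' <= steps s + (4 + 5 * (kappa + 2)))%N]).
Proof.
move=> sQ snb sM he.
have nbE : (kappa + 2 = 2 * q + 3)%N by lia.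
have nb2 : (2 ^ (2 * q + 3) = 8 * Q ^ 2)%N by rewrite expnD [(2 * q)%N]mulnC expnM mulnC.
have offE s1 : ia s1 iQQ 0 = Q -> ca s1 = ca s ->
    ceval s1 offset_exp = (rounding_offset q delta)%:C%C.
  move=> Q1 ca1; rewrite /offset_exp /fine_cells !evE Q1 ca1 sM.
  by rewrite -(rmorph_nat (real_complex R)) real_complexM /rounding_offset expnS expn1.
apply: run_seq_iset => //; first by rewrite !evE (leq_ltn_trans _ QW).
move=> s1 ia1 ca1 st1.
have fcE : ieval s1 fine_cells = (2 ^ (2 * q + 2))%N.
  by rewrite /fine_cells !evE ia1// sQ expnD mulnC mul2n -addnn expnD.
apply: run_seq_iset => //; first by rewrite fcE (ltn_trans _ QW)// -nb2 ltn_exp2l// ltn_add2l.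
rewrite fcE => s2 ia2 ca2 st2.
pose aoff := a + rounding_offset q delta.
(* The third clause keeps the accumulator at most 8 Q^2, hence below the word bound W. *)
pose Inv b (I : nat -> nat -> nat) (C : nat -> nat -> R[i]) :=
  [/\ fine_index_rec delta (2 * q + 3 - b) (I iCount 0%N) aoff = fine_index q delta a,
      (b < 2 * q + 3)%N -> I iJ 0%N = (2 ^ (2 * q + 2 - b))%N,
      (I iCount 0%N + 2 ^ (2 * q + 3 - b) <= 2 ^ (2 * q + 3))%N & C = ca s].
apply: (run_post (Q1 := fun s' => Inv (2 * q + 3)%N (ia s') (ca s') /\
    (steps s' <= steps s2 + (2 + (2 * q + 3) * (3 + 2)))%N)); last first.
  move=> s3 _ [[h1 _ _ h2] st3]; rewrite subnn /= in h1; split => //.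
  by move: st3; rewrite st2 st1; lia.
apply: run_for => //.
- by rewrite ia2//= ia1//= snb.
- by apply: leq_ltn_trans QW; rewrite -nb2 ltnW// ltn_expl.
- move=> s3 ia3 ca3; split; rewrite ?subn0 ?ia3 ?ia2// ?ia1//= ?add0n//.
  by rewrite ca3 ca2 ca1.
move=> b s3 bnb ik3 ck3 s3b [h1 h2 h3 h4]; have {}h2 := h2 bnb.
have nbS : (2 * q + 3 - b = (2 * q + 2 - b).+1)%N by lia.
rewrite nbS /= in h1; rewrite nbS expnS in h3.
set c := ia s3 iCount 0 in h1 h3.
have s3Q : ia s3 iQQ 0 = Q by rewrite ik3// ia2//= ia1.
have s3e : complex.Re (ceval s3 e) = a.
  apply: he => [b' j hb'|]; last exact: h4.
  rewrite !inE !negb_or => /and3P[n1 n2 n3].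
  have keep (v w : nat) : (v < 32)%N -> b' != v -> avoids b' (AV v).
    by move=> hv hn; rewrite /= hv eq_sym.
  rewrite ik3//=; last by rewrite !(eq_sym _ b') n1 n2 n3.
  by rewrite ia2// (negbTE n2) ia1// (negbTE n1).
have bE : beval s3 (BCLe (CMul (COfNat (IAdd (IV iCount) (IV iJ))) (CV cM))
    (CAdd e offset_exp)) = ((c + 2 ^ (2 * q + 2 - b))%:R * delta <= aoff).
  rewrite evBCLe evCAdd (offE _ s3Q h4) ReD s3e evCMul evCNat evAdd !evIV h2 evCV h4 sM.
  by rewrite -(rmorph_nat (real_complex R)) real_complexM.
pose c' := (if ((c + 2 ^ (2 * q + 2 - b))%:R * delta <= aoff)%R
  then c + 2 ^ (2 * q + 2 - b) else c)%N.
have c'lt : (c' < W)%N.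
  apply: leq_ltn_trans QW; rewrite -nb2 (leq_trans _ h3)// /c'.
  by move: (2 ^ (2 * q + 2 - b))%N => X; case: ifP => _; lia.
apply: (run_seq (Q1 := fun s' => [/\ ia s' iCount 0 = c', ca s' = ca s &
    (steps s' <= steps s3 + 2)%N])).
  apply: run_if; rewrite bE => hb s4 ia4 ca4 st4.
    have hc : c' = (c + 2 ^ (2 * q + 2 - b))%N by rewrite /c' hb.
    apply: run_last_iset => //; first by rewrite !evE ia4 h2 -/c -hc.
    move=> s5 ia5 ca5 st5; split; last by rewrite st5 st4; lia.
      by rewrite ia5// !evE ia4 h2 hc.
    by rewrite ca5 ca4.
  apply: run_post (run_skip _ _ _ _) _ => s5 _ [ia5 ca5 st5].
  split; last by rewrite st5 st4; lia.
    by rewrite ia5 ia4 /c' (negbTE hb).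
  by rewrite ca5 ca4.
move=> s4 e4 [c4 ca4 st4].
have J4 : ia s4 iJ 0 = (2 ^ (2 * q + 2 - b))%N by rewrite (ikeepsP e4).
apply: run_last_iset => //.
  rewrite !evE J4 (leq_ltn_trans (leq_div _ _))// (leq_ltn_trans _ QW)// -nb2.
  by rewrite leq_exp2l//; lia.
move=> s5 ia5 ca5 st5; split; first by rewrite st5; move: st4; lia.
move=> s6 _ ia6 ca6.
have nb1 : (2 * q + 3 - b.+1 = 2 * q + 2 - b)%N by lia.
have I6 : ia s6 iCount 0 = c' by rewrite ia6// ia5.
split.
- by rewrite nb1 I6.
- move=> hb1; rewrite ia6// ia5// !evE J4.
  by rewrite (_ : 2 * q + 2 - b = (2 * q + 2 - b.+1).+1)%N ?expnS ?mulKn//; lia.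
- rewrite I6 nb1 (leq_trans _ h3)// /c'.
  by move: (2 ^ (2 * q + 2 - b))%N => X; case: ifP => _; lia.
- by rewrite ca6 ca5 ca4.
Qed.

Lemma fine_indexW delta (a : R) : (fine_index q delta a < W)%N.
Proof. exact: ltn_trans (fine_index_lt _ _ _) QW. Qed.

Lemma run_mark_part s (e : cexp) (b c : nat) (delta a : R) : b \in [:: iRe; iIm] ->
  ia s iQQ 0 = Q -> ia s iCode 0 = (kappa + 2)%N -> ia s iC 0 = c -> (c < W)%N ->
  ca s cM 0 = delta%:C%C ->
  (forall s1, (forall b' j, (b' < 32)%N -> b' \notin [:: iCount; iJ; iGroup] ->
       ia s1 b' j = ia s b' j) -> ca s1 = ca s -> complex.Re (ceval s1 e) = a) ->
  run (mark_part e b) s (fun s' =>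
    [/\ forall j, ia s' b j = if j == c then fine_index q delta a else ia s b j,
        forall j, ia s' iMark j =
          if (j == fine_index q delta a %% Q)%N || (j == (fine_index q delta a).+1 %% Q)%N
          then 1%N else ia s iMark j,
        ca s' = ca s & (steps s' <= steps s + (7 + 5 * (kappa + 2)))%N]).
Proof.
move=> hb sQ snb sc cW sM he; set i0 := fine_index q delta a.
have i0W : (i0 < W)%N := fine_indexW delta a.
have W1 : (1 < W)%N by apply: leq_ltn_trans QltW; rewrite expn_gt0.
have [b32 bm bmods] : [/\ (b < 32)%N, b != iMark & ikeeps b (bisect e)].
  by move: hb; rewrite !inE => /orP[] /eqP ->.
apply: run_seq (run_bisect sQ snb sM he) _ => s1 e1 [i1 ca1 st1].
have c1 : ia s1 iC 0 = c by rewrite (ikeepsP e1).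
have Q1 : ia s1 iQQ 0 = Q by rewrite (ikeepsP e1).
apply: run_seq_iset => //; first by rewrite evIV i1.
move=> s2; rewrite !evIV i1 c1 => ia2 ca2 st2.
have i2 : ia s2 iCount 0 = i0.
  by rewrite ia2//; move: hb; rewrite !inE => /orP[] /eqP ->.
have Q2 : ia s2 iQQ 0 = Q.
  by rewrite ia2//; move: hb; rewrite !inE => /orP[] /eqP ->.
apply: run_seq_iset => // s3; rewrite !evE i2 Q2 => ia3 ca3 st3.
apply: run_last_iset => // s4; rewrite !evE !ia3// i2 Q2 addn1 => ia4 ca4 st4.
split; last by rewrite st4 st3 st2; move: st1; lia.
- move=> j; rewrite ia4// (negbTE bm) /= ia3// (negbTE bm) /= ia2// eqxx /=.
  by case: eqP => // _; rewrite (ikeepsP e1).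
- move=> j; rewrite ia4// eqxx /= orbC; case: eqP => //= _.
  rewrite ia3// eqxx /=; case: eqP => //= _.
  by rewrite ia2// eq_sym (negbTE bm) /= (ikeepsP e1).
- by rewrite ca4 ca3 ca2 ca1.
Qed.

Lemma run_mark_all s (y z : signal R p d) (delta : R) :
  ia s iN 0 = n -> ia s iQQ 0 = Q -> ia s iCode 0 = (kappa + 2)%N ->
  ca s cM 0 = delta%:C%C -> holds cy (y + z) s -> holds cy0 y s ->
  (forall j, (j < Q)%N -> ia s iMark j = 0%N) ->
  run mark_all s (fun s' =>
    [/\ forall f, ia s' iRe (code f) = fine_index q delta (complex.Re (z f)),
        forall f, ia s' iIm (code f) = fine_index q delta (complex.Im (z f)),
        forall j, (j < Q)%N -> (ia s' iMark j == 0%N) = ~~ shift_killed q delta z j,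
        ca s' = ca s &
        (steps s' <= steps s + (2 + n * (14 + 10 * (kappa + 2) + 2)))%N]).
Proof.
move=> sN sQ snb sM hy hy0 m0.
pose Inv c (I : nat -> nat -> nat) (C : nat -> nat -> R[i]) :=
  [/\ forall f, (code f < c)%N -> I iRe (code f) = fine_index q delta (complex.Re (z f)),
      forall f, (code f < c)%N -> I iIm (code f) = fine_index q delta (complex.Im (z f)),
      forall j, (j < Q)%N -> (I iMark j == 0%N) =
        ~~ [exists f, (code f < c)%N && kills q delta (z f) j] & C = ca s].
apply: (run_post (Q1 := fun s' => Inv n (ia s') (ca s') /\
    (steps s' <= steps s + (2 + n * (14 + 10 * (kappa + 2) + 2)))%N)); last first.
  move=> s' _ [[h1 h2 h3 h4] st]; split => //.
  - by move=> f; rewrite h1 ?code_lt.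
  - by move=> f; rewrite h2 ?code_lt.
  - move=> j jQ; rewrite h3//; congr (~~ _); apply: eq_existsb => f.
    by rewrite code_lt.
apply: run_for => //.
  move=> s1 ia1 ca1; split => // j jQ; rewrite ia1// m0// eqxx; apply/esym.
  by rewrite negb_exists; apply/forallP.
move=> c s1 cn ik1 ck1 s1c [h1 h2 h3 h4].
have Q1 : ia s1 iQQ 0 = Q by rewrite ik1.
have nb1 : ia s1 iCode 0 = (kappa + 2)%N by rewrite ik1.
have M1 : ca s1 cM 0 = delta%:C%C by rewrite h4.
have cW : (c < W)%N := ltn_trans cn nW.
pose f0 := decode c; have f0c : code f0 = c by rewrite decodeK.
have moveE s2 : (forall b' j, (b' < 32)%N -> b' \notin [:: iCount; iJ; iGroup] ->
    ia s2 b' j = ia s1 b' j) -> ca s2 = ca s1 -> ceval s2 move_exp = z f0.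
  move=> ia2 ca2; rewrite /move_exp !evE ia2// s1c ca2 h4 -f0c hy hy0.
  by rewrite !ffunE addrC addKr.
apply: run_seq (run_mark_part (b := iRe) (a := complex.Re (z f0)) _ Q1 nb1 s1c cW M1 _) _ => //.
  by move=> s2 ia2 ca2; rewrite moveE.
move=> s2 e2 [re2 m2 ca2 st2].
have Q2 : ia s2 iQQ 0 = Q by rewrite (ikeepsP e2).
have nb2 : ia s2 iCode 0 = (kappa + 2)%N by rewrite (ikeepsP e2).
have c2 : ia s2 iC 0 = c by rewrite (ikeepsP e2).
have M2 : ca s2 cM 0 = delta%:C%C by rewrite ca2.
apply: run_post (run_mark_part (b := iIm) (a := complex.Im (z f0)) _ Q2 nb2 c2 cW M2 _) _ => //.
  move=> s3 ia3 ca3; rewrite evCMul evCConj imaginary_unitE /move_exp !evE ia3// c2.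
  rewrite ca3 ca2 h4 -f0c hy hy0 !ffunE [y f0 + _]addrC addrK.
  by case: (z f0) => u v /=; rewrite mul0r sub0r mulN1r opprK.
move=> s3 e3 [im3 m3 ca3 st3]; split; first by move: st2 st3; lia.
move=> s4 _ ia4 ca4; split.
- move=> f; rewrite ltnS leq_eqVlt => fc; rewrite ia4// (ikeepsP e3)// re2.
  case: eqP fc => [fc _|_ /= fc]; last exact: h1.
  by rewrite /f0 -fc codeK.
- move=> f; rewrite ltnS leq_eqVlt => fc; rewrite ia4// im3.
  case: eqP fc => [fc _|_ /= fc]; first by rewrite /f0 -fc codeK.
  by rewrite (ikeepsP e2)// h2.
- move=> j jQ; rewrite ia4// m3 m2.
  have -> : [exists f, (code f < c.+1)%N && kills q delta (z f) j] =
      kills q delta (z f0) j || [exists f, (code f < c)%N && kills q delta (z f) j].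
    apply/existsP/orP => [[f /andP[]]|[hk|/existsP[f /andP[fc hk]]]].
    - rewrite ltnS leq_eqVlt => /orP[/eqP fc|fc] hk.
        by left; rewrite /f0 -fc codeK.
      by right; apply/existsP; exists f; rewrite fc.
    - by exists f0; rewrite f0c leqnn.
    - by exists f; rewrite ltnS ltnW.
  have ifE (b1 b2 b3 b4 : bool) (v : nat) :
      ((if b1 || b2 then 1 else if b3 || b4 then 1 else v)%N == 0%N) =
      ~~ [|| b3, b4, b1 | b2] && (v == 0%N).
    by case: b1; case: b2; case: b3; case: b4.
  by rewrite negb_or -h3// ifE.
- by rewrite ca4 ca3 ca2.
Qed.

Lemma run_choose_shift s (z : signal R p d) (delta : R) : ia s iQQ 0 = Q ->
  (forall j, (j < Q)%N -> (ia s iMark j == 0%N) = ~~ shift_killed q delta z j) ->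
  run choose_shift s (fun s' => [/\ ia s' iShift 0 = shift q delta z, ca s' = ca s &
    (steps s' <= steps s + (3 + Q * 4))%N]).
Proof.
move=> sQ hm; apply: run_seq_iset => //; first by rewrite evE (leq_ltn_trans _ QltW).
move=> s1 ia1 ca1 st1.
pose Inv i (I : nat -> nat -> nat) (C : nat -> nat -> R[i]) :=
  I iShift 0%N = last_free (shift_killed q delta z) i /\ C = ca s.
apply: (run_post (Q1 := fun s' => Inv Q (ia s') (ca s') /\
    (steps s' <= steps s1 + (2 + Q * (2 + 2)))%N)); last first.
  by move=> s2 _ [[h1 h2] st2]; split => //; move: st2; rewrite st1; lia.
apply: run_for => //; rewrite ?QltW//.
- by rewrite ia1.
- by move=> s2 ia2 ca2; split; rewrite ?ia2 ?ia1 ?ca2.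
move=> i s2 iQ ik2 ck2 s2i [h1 h2].
have mE : beval s2 (BILe (IA iMark (IV iI)) (IConst 0)) = ~~ shift_killed q delta z i.
  by rewrite !evE s2i ik2// ia1// leqn0 hm.
apply: run_if; rewrite mE => hk s3 ia3 ca3 st3.
  apply: run_last_iset => //; first by rewrite evIV ia3 s2i (ltn_trans iQ QltW).
  move=> s4 ia4 ca4 st4; split; first by rewrite st4 st3; lia.
  move=> s5 _ ia5 ca5; split; last by rewrite ca5 ca4 ca3.
  by rewrite ia5// ia4// !evE ia3 s2i /= (negbTE hk).
apply: run_post (run_skip _ _ _ _) _ => s4 _ [ia4 ca4 st4].
split; first by rewrite st4 st3; lia.
move=> s5 _ ia5 ca5; split; last by rewrite ca5 ca4 ca3.
by rewrite ia5// ia4 ia3 h1 /=; move: hk; rewrite negbK => ->.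
Qed.

Lemma run_clear_marks s : ia s iQQ 0 = Q ->
  run clear_marks s (fun s' => (forall j, (j < Q)%N -> ia s' iMark j = 0%N) /\
    (steps s' <= steps s + (2 + Q * 3))%N).
Proof.
move=> sQ; pose Inv i (I : nat -> nat -> nat) (C : nat -> nat -> R[i]) :=
  forall j, (j < i)%N -> I iMark j = 0%N.
apply: (run_post (Q1 := fun s' => Inv Q (ia s') (ca s') /\
    (steps s' <= steps s + (2 + Q * (1 + 2)))%N)); last by [].
apply: run_for => //; rewrite ?QltW//.
move=> i s1 iQ ik1 ck1 s1i Inv1.
apply: run_last_iset => //; first by rewrite evE (leq_ltn_trans _ QltW).
move=> s2 ia2 ca2 st2; split; first by rewrite st2; lia.
move=> s3 _ ia3 _ j; rewrite ltnS leq_eqVlt => ji; rewrite ia3// ia2// !evE s1i eqxx /=.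
by case: eqP ji => //= _; apply: Inv1.
Qed.

Lemma run_snap s (y z : signal R p d) (delta : R) (j : nat) :
  ia s iN 0 = n -> ia s iQQ 0 = Q -> ia s iShift 0 = j -> ca s cM 0 = delta%:C%C ->
  holds cy0 y s ->
  (forall f, ia s iRe (code f) = fine_index q delta (complex.Re (z f))) ->
  (forall f, ia s iIm (code f) = fine_index q delta (complex.Im (z f))) ->
  run snap s (fun s' => holds cy (round_to_grid q delta y z j) s' /\
    (steps s' <= steps s + (2 + n * 3))%N).
Proof.
move=> sN sQ sj sM hy0 hre him.
apply: (run_last_fill (N := n) (base := 0)
  (g := fun c => round_to_grid q delta y z j (decode c))) => //.
  move=> c s1 cn ia1 ca1 s1c _; split=> //.
  have cE : code (decode c) = c by rewrite decodeK.
  have coarseE b (v : R) : b \in [:: iRe; iIm] -> ia s b c = fine_index q delta v ->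
      ceval s1 (coarse_exp b) = (coarse_value q delta j (fine_index q delta v))%:C%C.
    move=> hb bc; have [b32 bI] : (b < 32)%N /\ b != iI.
      by move: hb; rewrite !inE => /orP[] /eqP ->.
    rewrite /coarse_exp /offset_exp /fine_cells !evE s1c !ia1// sQ sj bc ca1// sM.
    rewrite !natr_complexM -rmorphB /=.
    by rewrite /coarse_value /rounding_offset expnS expn1.
  rewrite !evCAdd evCMul imaginary_unitE (coarseE iRe (complex.Re (z (decode c))))//; last first.
    by rewrite -hre cE.
  rewrite (coarseE iIm (complex.Im (z (decode c))))//; last by rewrite -him cE.
  rewrite evCA evIV s1c ca1// ffunE -{1}cE hy0; congr (_ + _).
  by apply/eqP; rewrite eq_complex /=; apply/andP; split; apply/eqP; ring.
move=> s1 _ _ y1 st1; split; last by rewrite (leq_trans st1).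
by move=> f; rewrite y1 code_lt//= subn0 codeK.
Qed.

Definition stage_cost : nat :=
  (2 + 3 * n) + (2 + kappa * (round_cost p d N lg L B + 3)) + (2 + Q * 3) + 3 +
  (2 + n * (16 + 10 * (kappa + 2))) + (3 + Q * 4) + (2 + n * 3).

Lemma run_stage s (m : nat) y (mu : R) : sampled s -> holds cy y s ->
  ia s iKappa 0 = kappa -> ia s iQ 0 = q -> ia s iQQ 0 = Q -> ia s iM 0 = m -> (m < W)%N ->
  (kappa <= m)%N -> ca s cM 0 = (scale mu m)%:C%C ->
  run stage_prog s (fun s' => [/\ holds cy (stage x mu q y m drawn_batch) s',
    ia s' iM 0 = (m - q)%N, ca s' cM 0 = (scale mu (m - q))%:C%C &
    (steps s' <= steps s + stage_cost)%N]).
Proof.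
move=> ss hy sk sq sQ sm mW km sM.
have kW := kappaW; have nW' := nW.
apply: (run_seq_fill (N := n) (base := 0) (g := ca s cy)) => //.
- by rewrite (tables_n (sampled_tables ss)).
- by move=> c s1 cn ia1 ca1 s1c _; split=> //; rewrite !evE s1c ca1.
move=> s1 ia1 ca1 y01 st1.
have ss1 : sampled s1.
  apply: sampled_eq ss => [a j|a j]; rewrite !inE.
    by do 8?[case/orP]; move/eqP=> ->; rewrite ia1.
  by do 3?[case/orP]; move/eqP=> ->; rewrite ca1.
have hy1 : holds cy y s1 by move=> t; rewrite ca1.
have hy01 : holds cy0 y s1 by move=> t; rewrite y01 code_lt//= subn0 hy.
have M1 : ca s1 cM 0 = (scale mu m)%:C%C by rewrite ca1.
have k1 : ia s1 iKappa 0 = kappa by rewrite ia1.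
apply: run_seq (run_rounds_prog (b := iKappa) _ ss1 hy1 M1 k1 (leqnn _)) _ => //.
move=> s2 e2 [hy2 M2 st2].
set yt := rounds _ _ _ _ _ in hy2; set delta := _ / _ in M2.
have Q2 : ia s2 iQQ 0 = Q by rewrite (ikeepsP e2)// ia1.
apply: run_seq (run_clear_marks Q2) _ => s3 e3 [mark3 st3].
have k3 : ia s3 iKappa 0 = kappa by rewrite (ikeepsP e3)// (ikeepsP e2).
have kW2 : (kappa + 2 < W)%N.
  apply: leq_ltn_trans QW; rewrite -expnM [(q * 2)%N]mulnC.
  have h := ltn_expl (2 * q)%N (isT : (1 < 2)%N).
  by move: h; move: (2 ^ _)%N => X; lia.
apply: run_seq_iset => //; first by rewrite !evE k3.
move=> s4; rewrite !evE k3 => ia4 ca4 st4.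
have y4 : holds cy (y + (yt - y)) s4.
  by move=> t; rewrite ca4 (ckeepsP e3)// hy2 addrC subrK.
have y04 : holds cy0 y s4.
  by move=> t; rewrite ca4 (ckeepsP e3)// (ckeepsP e2)// hy01.
have M4 : ca s4 cM 0 = delta%:C%C by rewrite ca4 (ckeepsP e3).
have N4 : ia s4 iN 0 = n.
  by rewrite ia4// (ikeepsP e3)// (ikeepsP e2)// (tables_n (sampled_tables ss1)).
have Q4 : ia s4 iQQ 0 = Q by rewrite ia4// (ikeepsP e3).
have code4 : ia s4 iCode 0 = (kappa + 2)%N by rewrite ia4.
apply: run_seq (run_mark_all N4 Q4 code4 M4 y4 y04 _) _.
  by move=> j jQ; rewrite ia4// mark3.
move=> s5 e5 [re5 im5 mark5 ca5 st5].
have Q5 : ia s5 iQQ 0 = Q by rewrite (ikeepsP e5).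
apply: run_seq (run_choose_shift Q5 mark5) _ => s6 e6 [shift6 ca6 st6].
have Q6 : ia s6 iQQ 0 = Q by rewrite (ikeepsP e6).
have N6 : ia s6 iN 0 = n by rewrite (ikeepsP e6)// (ikeepsP e5).
have M6 : ca s6 cM 0 = delta%:C%C by rewrite ca6 ca5.
have y06 : holds cy0 y s6 by move=> t; rewrite ca6 ca5 y04.
have re6 f : ia s6 iRe (code f) = fine_index q delta (complex.Re ((yt - y) f)).
  by rewrite (ikeepsP e6).
have im6 f : ia s6 iIm (code f) = fine_index q delta (complex.Im ((yt - y) f)).
  by rewrite (ikeepsP e6).
apply: run_seq (run_snap N6 Q6 shift6 M6 y06 re6 im6) _ => s7 e7 [y7 st7].
apply: run_seq_cset => // s8; rewrite !evE (ckeepsP e7)// M6 (ikeepsP e7)// Q6.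
move=> ca8 ia8 st8.
have m7 : ia s7 iM 0 = m.
  rewrite (ikeepsP e7)// (ikeepsP e6)// (ikeepsP e5)// ia4// (ikeepsP e3)//.
  by rewrite (ikeepsP e2)// ia1.
have q7 : ia s7 iQ 0 = q.
  rewrite (ikeepsP e7)// (ikeepsP e6)// (ikeepsP e5)// ia4// (ikeepsP e3)//.
  by rewrite (ikeepsP e2)// ia1.
apply: run_last_iset => //; first by rewrite !evE ia8 m7 q7 (leq_ltn_trans (leq_subr _ _)).
move=> s9; rewrite !evE ia8 m7 q7 => ia9 ca9 st9; split.
- by move=> t; rewrite ca9 ca8//= y7.
- by rewrite ia9.
- rewrite ca9 ca8// -[(2 * Q)%:R](rmorph_nat (real_complex R)) real_complexM eqxx /=.
  congr (_%:C)%C; rewrite /delta /scale -expnS natrX.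
  have qm : (q <= m)%N by apply: leq_trans km; lia.
  rewrite -{1}(subnK qm) exprD (_ : kappa = q.+1 + q)%N; last by lia.
  by rewrite exprD; field; rewrite !expf_neq0.
- move: st1 st2 st3 st4 st5 st6 st7 st8 st9; rewrite /stage_cost.
  have -> : (n * (14 + 10 * (kappa + 2) + 2) = n * (16 + 10 * (kappa + 2)))%N.
    by congr muln; lia.
  have -> : (round_cost p d N lg L B + 1 + 2 = round_cost p d N lg L B + 3)%N by lia.
  move: (kappa * _)%N (n * (16 + _))%N (Q * 3)%N (Q * 4)%N => X1 X2 X3 X4.
  by move: n => X5; lia.
Qed.

End StageProgram.

(** * Setup: logarithms, the initial scale, tables, and the samples *)

Definition log2_loop (c b h l : nat) : cmd :=
  Seq (ISet (AV h) (IConst 1)) (Seq (ISet (AV l) (IConst 0))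
    (While (BNot (BILe (IMul (IConst c) (IV b)) (IV h)))
       (Seq (ISet (AV h) (IMul (IConst 2) (IV h))) (ISet (AV l) (IAdd (IV l) (IConst 1)))))).

(** The least m with Rs <= 2^m is found by doubling [cM] from mu until it reaches mu Rs, since the
    machine has neither logarithm nor floor. *)
Definition scale_loop : cmd :=
  Seq (CSet (AV cM) (CV cMu)) (Seq (ISet (AV iM) (IConst 0))
    (While (BNot (BCLe (CMul (CV cMu) (CV cRs)) (CV cM)))
       (Seq (CSet (AV cM) (CMul (CV cM) (COfNat (IConst 2))))
            (ISet (AV iM) (IAdd (IV iM) (IConst 1)))))).

Definition power_table (a b : nat) : cmd :=
  Seq (CSet (AV cSel) (COfNat (IConst 1)))
    (For iI b (Seq (CSet (AA a (IV iI)) (CV cSel))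
                   (CSet (AV cSel) (CMul (CV cSel) (CRoot (IV b)))))).

Definition chirp_table : cmd :=
  Seq (Fill iI iNF cX (IConst 0)
         (chirp_exp (IMod (ISub (IV iNF) (IV iI)) (IV iNF))))
  (Seq fft (Fill iI iNF cChirp (IConst 0) (CA cX (IV iI)))).

(** All reads happen here. What precedes and follows is [quiet], so the number of reads is known
    exactly and the batches can be reused. *)
Definition draw_samples : cmd :=
  For iI iCount (Seq (DrawIndex (AA iT (IV iI))) (Query (AA cXs (IV iI)) (IA iT (IV iI)))).

Definition log2_cost (l : nat) : nat := 3 + l * 3.

Section SetupPrograms.
Variables (R : realType) (p d W : nat) (x : signal R p d) (tau : nat -> draw R p d).
Local Notation run := (run W x tau).
Implicit Types (s : state R).

Lemma run_log2_loop s (c b h l v : nat) : [&& b < 32, h < 32, l < 32, b != h, b != l & h != l]%N ->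
  ia s b 0 = v -> (2 * (c * v) < W)%N -> (1 < W)%N ->
  run (log2_loop c b h l) s (fun s' => [/\ ia s' h 0 = (2 ^ up_log 2 (c * v))%N,
    ia s' l 0 = up_log 2 (c * v) & (steps s' <= steps s + log2_cost (up_log 2 (c * v)))%N]).
Proof.
move=> /and5P[hb hh hl bh /andP[bl hl']] sb vW W1; set u := up_log 2 (c * v).
have two1 : (1 < 2)%N by [].
apply: run_seq_iset => // s1; rewrite evConst => ia1 ca1 st1.
apply: run_seq_iset => //; first by rewrite evConst (ltn_trans _ W1).
move=> s2; rewrite evConst => ia2 ca2 st2.
pose Inv i (I : nat -> nat -> nat) (C : nat -> nat -> R[i]) :=
  [/\ (i <= u)%N, I l 0%N = (u - i)%N, I h 0%N = (2 ^ (u - i))%N & I b 0%N = v].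
apply: run_post (run_while (i := u) (T := 2) (Inv := Inv) _ _) _.
- move=> i s3 [iu l3 h3 b3]; rewrite !evE h3 b3 -ltnNge => cv.
  have i0 : (0 < i)%N.
    rewrite lt0n; apply/eqP => i0; have := up_logP (c * v) two1.
    by rewrite leqNgt -/u; rewrite i0 subn0 in cv; rewrite cv.
  have lcv : (u - i < c * v)%N := ltn_trans (ltn_expl _ two1) cv.
  apply: run_seq_iset => //; first by rewrite !evE h3; move: vW cv; move: (2 ^ _)%N (c * v)%N; lia.
  move=> s4; rewrite !evE h3 => ia4 ca4 st4.
  have l4 : ia s4 l 0 = (u - i)%N by rewrite ia4// eq_sym (negbTE hl').
  apply: run_last_iset => //; first by rewrite !evE l4; move: vW lcv; move: (c * v)%N; lia.
  move=> s5; rewrite !evE l4 => ia5 ca5 st5; split; first by rewrite st5 st4; lia.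
  have ui : (u - i.-1 = (u - i).+1)%N by lia.
  exists i.-1; first by lia.
  split; first by lia.
  + by rewrite ia5// eqxx /= ui addn1.
  + by rewrite ia5// (negbTE hl') /= ia4// eqxx /= ui expnS.
  + by rewrite ia5// (negbTE bl) /= ia4// (negbTE bh).
- split => //; first by rewrite ia2// eqxx /= subnn.
    by rewrite ia2// (negbTE hl') /= ia1// eqxx /= subnn.
  by rewrite ia2// (negbTE bl) /= ia1// (negbTE bh).
move=> s3 _ [nb [i _ [iu l3 h3 b3]] st3]; move: nb; rewrite !evE h3 b3 negbK => cv.
have uu : (u - i = u)%N.
  by have := up_log_min two1 cv; rewrite -/u; lia.
by split; [rewrite uu|rewrite l3 uu|move: st3; rewrite st2 st1 /log2_cost; lia].
Qed.

Lemma run_scale_loop s (mu Rs : R) (m : nat) : ca s cMu 0 = mu%:C%C -> ca s cRs 0 = Rs%:C%C ->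
  0 < mu -> Rs <= 2 ^+ m -> (forall j, Rs <= 2 ^+ j -> (m <= j)%N) -> (m.+1 < W)%N ->
  run scale_loop s (fun s' => [/\ ca s' cM 0 = (scale mu m)%:C%C, ia s' iM 0 = m &
    (steps s' <= steps s + (3 + m * 3))%N]).
Proof.
move=> sMu sRs mu0 Rm mmin mW.
apply: run_seq_cset => // s1; rewrite !evE sMu => ca1 ia1 st1.
apply: run_seq_iset => //; first by rewrite evConst (ltn_trans _ mW).
move=> s2; rewrite !evE => ia2 ca2 st2.
pose Inv i (I : nat -> nat -> nat) (C : nat -> nat -> R[i]) :=
  [/\ (i <= m)%N, I iM 0%N = (m - i)%N, C cM 0%N = (scale mu (m - i))%:C%C,
      C cMu 0%N = mu%:C%C & C cRs 0%N = Rs%:C%C].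
have condE s' j : ca s' cM 0 = (scale mu j)%:C%C -> ca s' cMu 0 = mu%:C%C ->
    ca s' cRs 0 = Rs%:C%C ->
    beval s' (BCLe (CMul (CV cMu) (CV cRs)) (CV cM)) = (Rs <= 2 ^+ j).
  by move=> h1 h2 h3; rewrite !evE h1 h2 h3 real_complexM /= /scale ler_pM2l.
apply: run_post (run_while (i := m) (T := 2) (Inv := Inv) _ _) _.
- move=> i s3 [im m3 M3 mu3 Rs3]; rewrite evBNot (condE _ _ M3 mu3 Rs3) => Rj.
  have i0 : (0 < i)%N.
    by rewrite lt0n; apply: contra Rj => /eqP ->; rewrite subn0.
  have mi : (m - i.-1 = (m - i).+1)%N by lia.
  apply: run_seq_cset => // s4; rewrite !evE M3 => ca4 ia4 st4.
  apply: run_last_iset => //; first by rewrite !evE ia4 m3; lia.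
  move=> s5; rewrite !evE ia4 m3 => ia5 ca5 st5; split; first by rewrite st5 st4; lia.
  exists i.-1; first by lia.
  split; first by lia.
  + by rewrite ia5// mi addn1.
  + rewrite ca5 ca4// eqxx /= mi mulrC natr_complexM; congr (_%:C)%C.
    by rewrite /scale exprS; ring.
  + by rewrite ca5 ca4.
  + by rewrite ca5 ca4.
- split; rewrite ?subnn ?ca2 ?ca1 ?ia2 ?sRs ?sMu//.
  by rewrite /= /scale expr0 mulr1.
move=> s3 _ [nb [i _ [im m3 M3 mu3 Rs3]] st3].
move: nb; rewrite evBNot (condE _ _ M3 mu3 Rs3) negbK => /mmin mi.
have mm : (m - i = m)%N by lia.
by split; [rewrite M3 mm|rewrite m3 mm|move: st3; rewrite st2 st1; lia].
Qed.

Lemma run_power_table s (a b v : nat) : a \in [:: cPow; cZeta] -> b \in [:: iP; iNF] ->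
  ia s b 0 = v -> (v < W)%N ->
  run (power_table a b) s (fun s' =>
    (forall j, (j < v)%N -> ca s' a j = root_of_unity R v ^+ j) /\
    (steps s' <= steps s + (3 + v * 4))%N).
Proof.
move=> ha hb sb vW.
have [a32 aS] : (a < 32)%N /\ a != cSel by move: ha; rewrite !inE => /orP[] /eqP ->.
have [b32 bI] : (b < 32)%N /\ iI != b by move: hb; rewrite !inE => /orP[] /eqP ->.
apply: run_seq_cset => // s1; rewrite !evE => ca1 ia1 st1.
pose Inv i (I : nat -> nat -> nat) (C : nat -> nat -> R[i]) :=
  C cSel 0%N = root_of_unity R v ^+ i /\
  forall j, (j < i)%N -> C a j = root_of_unity R v ^+ j.
apply: (run_post (Q1 := fun s' => Inv v (ia s') (ca s') /\
    (steps s' <= steps s1 + (2 + v * (2 + 2)))%N)); last first.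
  by move=> s2 _ [[_ h] st2]; split => //; move: st2; rewrite st1; lia.
apply: run_for => //; first by rewrite ia1.
  by move=> s2 _ ca2; split => //; rewrite ca2 ca1// expr0.
move=> i s2 iv ik2 ck2 s2i [c2 h2].
apply: run_seq_cset => // s3; rewrite !evE s2i c2 => ca3 ia3 st3.
have c3 : ca s3 cSel 0 = root_of_unity R v ^+ i by rewrite ca3// eq_sym (negbTE aS).
have b3 : ia s3 b 0 = v.
  by rewrite ia3 ik2 ?ia1//; move: hb; rewrite !inE => /orP[] /eqP ->.
apply: run_last_cset => // s4; rewrite !evE c3 b3 => ca4 ia4 st4.
split; first by rewrite st4 st3; lia.
move=> s5 _ _ ca5; split; first by rewrite ca5 ca4// exprSr.
move=> j; rewrite ltnS leq_eqVlt => ji; rewrite ca5 ca4// (negbTE aS) /= ca3// eqxx /=.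
by case: eqP ji => [->|_ /h2].
Qed.

Lemma run_chirp_table s (N lg : nat) : (0 < p)%N -> N = (2 ^ lg)%N -> (N < W)%N ->
  ia s iP 0 = p -> ia s iNF 0 = N -> ia s iLogF 0 = lg ->
  (forall j, (j < p)%N -> ca s cPow j = root_of_unity R p ^+ j) ->
  (forall j, (j < N)%N -> ca s cZeta j = root_of_unity R N ^+ j) ->
  run chirp_table s (fun s' => (forall j, (j < N)%N -> ca s' cChirp j = chirp R p N j) /\
    (steps s' <= steps s + (4 + 6 * N + fft_cost N lg))%N).
Proof.
move=> p0 NE NW sP sN slg spow szeta.
have N0 : (0 < N)%N by rewrite NE expn_gt0.
apply: (run_seq_fill (N := N) (base := 0)
  (g := fun i => root_of_unity R p ^+ triangular ((N - i) %% N))) => //.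
  move=> i s1 iN' ia1 ca1 s1i _; split=> //.
  rewrite /chirp_exp /triangle_exp !evE s1i !ia1// sN sP ca1// spow ?ltn_pmod//.
  by rewrite root_of_unity_mod.
move=> s1 ia1 ca1 X1 st1.
apply: run_seq (run_fft _ _ NE NW _ _ (root_of_unity_expr_eq1 R N0) _) _; rewrite ?ia1//.
  by move=> j jN; rewrite ca1// szeta.
move=> s2 e2 [X2 st2].
apply: (run_last_fill (N := N) (base := 0) (g := chirp R p N)) => //.
- by rewrite (ikeepsP e2)// ia1.
- move=> i s3 iN' ia3 ca3 s3i _; split=> //; rewrite !evE s3i ca3// X2//.
  by apply: eq_bigr => t _; rewrite X1 /= ltn_ord subn0.
move=> s3 _ _ h3 st3; split; first by move=> j jN; rewrite h3 jN subn0.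
by move: st1 st2 st3; move: (fft_cost _ _) => X; lia.
Qed.

(** The loop is unrolled by hand because the invariants of [run_for] see arrays only, while draws
    depend on the counter [pos] and reads must be counted. *)
Lemma run_draw_samples s (T : nat) : (0 < p)%N -> (p ^ d < W)%N -> (T < W)%N ->
  ia s iCount 0 = T -> pos s = 0%N ->
  run draw_samples s (fun s' =>
    [/\ forall j, (j < T)%N -> ia s' iT j = code (tau j).1,
        forall j, (j < T)%N -> ca s' cXs j = x (tau j).1,
        reads s' = (reads s + T)%N & (steps s' <= steps s + (2 + T * 4))%N]).
Proof.
move=> p0 nW TW sT s0.
have [s1 e1 [ia1 ca1 st1]] :=
  @run_iset R p d W x tau iI (IConst 0) (IConst 0) s isT (leq_ltn_trans (leq0n T) TW).
have p1 : pos s1 = 0%N by have [-> _] := quietP e1 isT.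
have r1 : reads s1 = reads s by have [_ ->] := quietP e1 isT.
suff loop i s2 : (i <= T)%N -> ia s2 iCount 0 = T -> ia s2 iI 0 = (T - i)%N ->
    pos s2 = (T - i)%N ->
    (forall j, (j < T - i)%N -> ia s2 iT j = code (tau j).1) ->
    (forall j, (j < T - i)%N -> ca s2 cXs j = x (tau j).1) ->
    run (While (BNot (BILe (IV iCount) (IV iI)))
         (Seq (Seq (DrawIndex (AA iT (IV iI))) (Query (AA cXs (IV iI)) (IA iT (IV iI))))
            (ISet (AV iI) (IAdd (IV iI) (IConst 1))))) s2 (fun s' =>
    [/\ forall j, (j < T)%N -> ia s' iT j = code (tau j).1,
        forall j, (j < T)%N -> ca s' cXs j = x (tau j).1,
        reads s' = (reads s2 + i)%N & (steps s' <= steps s2 + (1 + i * 4))%N]).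
  have [|||||s2 e2 [h1 h2 h3 h4]] := loop T s1 (leqnn _); rewrite ?subnn//.
  - by rewrite ia1.
  - by rewrite ia1.
  exists s2; first exact: exec_seq e1 e2.
  by split => //; [rewrite h3 r1|move: h4; rewrite st1; lia].
elim: i s2 => [|i IH] s2 iT2 sT2 sI2 sp2 codes vals.
  rewrite subn0 in sI2 codes vals.
  exists (tick s2); first by apply: exec_while_false; rewrite !evE sT2 sI2 leqnn.
  by split => //=; lia.
set j := (T - i.+1)%N in sI2 sp2 codes vals.
have jT : (j < T)%N by rewrite /j; lia.
have jS : (T - i = j.+1)%N by rewrite /j; lia.
pose t := (tau j).1.
have tW : (code t < W)%N by apply: ltn_trans nW; exact: code_lt.
have spt : pos (tick s2) = j by [].
have eD : exec W x tau (DrawIndex (AA iT (IV iI))) (tick s2)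
    (tick (count_draw (iset (arr iT j) (code t) (tick s2)))).
  have -> : arr iT j = ieval (tick s2) (AA iT (IV iI)) by rewrite -sI2.
  by rewrite /t -spt; apply: exec_draw_index; rewrite spt.
set s3 := tick (count_draw _) in eD.
have ia3 b j' : (b < 32)%N -> ia s3 b j' =
    if (b == iT) && (j' == j) then code t else ia s2 b j'.
  by move=> hb; rewrite -(@arr_eq b iT j' j hb isT).
have sI3 : ia s3 iI 0 = j by rewrite ia3.
have eQ : exec W x tau (Query (AA cXs (IV iI)) (IA iT (IV iI))) s3
    (tick (count_read (cset (arr cXs j) (x t) s3))).
  have -> : arr cXs j = ieval s3 (AA cXs (IV iI)) by rewrite -sI3.
  by apply: exec_query; rewrite evIA evIV sI3 ia3// !eqxx.
set s4 := tick (count_read _) in eQ.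
have I4 : ia s4 iI 0 = j by exact: sI3.
have [|s5 e5 [ia5 ca5 st5]] :=
    @run_iset R p d W x tau iI (IConst 0) (IAdd (IV iI) (IConst 1)) s4 isT.
  by rewrite evAdd evConst evIV I4 addn1 (leq_ltn_trans jT).
have ca4 j' : ca s4 cXs j' = if j' == j then x t else ca s2 cXs j'.
  by have /= <- := @arr_eq cXs cXs j' j isT isT.
have p5 : pos s5 = j.+1 by have [-> _] := quietP e5 isT; rewrite /= sp2.
have r5 : reads s5 = (reads s2).+1 by have [_ ->] := quietP e5 isT.
have [|||||s6 e6 [h1 h2 h3 h4]] := IH s5 (ltnW iT2); rewrite ?jS//.
- by rewrite ia5//; have := ia3 iCount 0%N isT; rewrite sT2.
- by rewrite ia5// !evE I4 addn1.
- move=> j' j'j; rewrite ia5//; have := ia3 iT j' isT => E.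
  rewrite [LHS]E eqxx /=; case: eqP => [->//|ne].
  by apply: codes; move: j'j ne; lia.
- move=> j' j'j; rewrite ca5 ca4; case: eqP => [->//|ne].
  by apply: vals; move: j'j ne; lia.
exists s6.
  apply: exec_while_true e6; first by rewrite !evE sT2 sI2 -ltnNge.
  exact: exec_seq (exec_seq eD eQ) e5.
split => //; first by rewrite h3 r5; lia.
by apply: (leq_trans h4); rewrite st5 /s4 /s3 /=; lia.
Qed.

End SetupPrograms.

(** * The complete program and its output phase *)

Definition support_cap : iexp := IMul (IConst 5) (IV iK).

(* The cap makes the output sparse even on unlucky draws. Overwriting address i is
   harmless, since entry i of cy sits at the address 32 i + 3 > i. *)
Definition copy_out : cmd :=
  Seq (ISet (AV iCount) (IConst 0))
    (For iI iN
      (If (BAnd (BNot (BCLe (abs_sqr_exp (CA cy (IV iI))) (COfNat (IConst 0))))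
                (BNot (BILe support_cap (IV iCount))))
        (Seq (CSet (IV iI) (CA cy (IV iI))) (ISet (AV iCount) (IAdd (IV iCount) (IConst 1))))
        (CSet (IV iI) (COfNat (IConst 0))))).

Definition stage_loop : cmd := While (BILe (IV iKappa) (IV iM)) stage_prog.

Definition setup_prog : cmd :=
  Seq (log2_loop 1 iN iCount iLogN)
  (Seq (log2_loop 32 iK iQQ iQ)
  (Seq (log2_loop 2 iP iNF iLogF)
  (Seq (ISet (AV iKappa) (IAdd (IMul (IConst 2) (IV iQ)) (IConst 1)))
  (Seq scale_loop
  (Seq (ISet (AV iL) (IAdd (IAdd (IAdd (IV iM) (IV iKappa)) (IV iLogN)) (IConst 1)))
  (Seq (ISet (AV iB) (IMul (IMul (IConst 512) (IConst 512)) (IV iK)))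
  (Seq (ISet (AV iRows) (IDiv (IV iN) (IV iP)))
  (Seq (power_table cPow iP)
  (Seq (power_table cZeta iNF)
  (Seq chirp_table
       (ISet (AV iCount) (IMul (IMul (IV iKappa) (IV iL)) (IV iB))))))))))))).

Definition recovery_prog : cmd :=
  Seq setup_prog (Seq draw_samples (Seq stage_loop (Seq (rounds_prog iM) copy_out))).

Section RecoveryProgram.
Variables (R : realType) (p d W : nat) (x : signal R p d) (tau : nat -> draw R p d).
Hypotheses (p_gt0 : (0 < p)%N) (nW : (p ^ d < W)%N).
Local Notation run := (run W x tau).
Local Notation n := (p ^ d)%N.
Local Notation G := (grid p d).
Implicit Types (s : state R) (y : signal R p d) (f t : G).

Lemma run_cset_raw (a : iexp) (e : cexp) s :
  run (CSet a e) s (fun s' => [/\ cmem s' = upd (cmem s) (ieval s a) (ceval s e),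
    ia s' = ia s & steps s' = (steps s).+1]).
Proof. by eexists; first exact: exec_cset. Qed.

Lemma cmem_arr s c : cmem s c = ca s (c %% 32) (c %/ 32).
Proof. by rewrite /ca /arr -divn_eq. Qed.

Lemma run_copy_out s y k : ia s iN 0 = n -> ia s iK 0 = k -> holds cy y s -> (5 * k < W)%N ->
  run copy_out s (fun s' =>
    [/\ (#|[pred t | output p d s' t != 0%R]| <= 5 * k)%N,
        (#|[pred t | y t != 0%R]| <= 5 * k)%N -> output p d s' = y &
        (steps s' <= steps s + (3 + n * 5))%N]).
Proof.
move=> sN sk hy kW.
apply: run_seq_iset => //; first by rewrite evConst (leq_ltn_trans _ nW).
move=> s1; rewrite !evE => ia1 ca1 st1.
(* The raw address c of an output is entry c / 32 of array c mod 32. *)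
pose O (C : nat -> nat -> R[i]) f := C (code f %% 32)%N (code f %/ 32)%N.
(* The counter lies between the number of nonzero outputs and the number of nonzero entries of y
   scanned so far. The first bound makes the output sparse; the second keeps the cap from acting
   when y itself is sparse. *)
pose Inv i (I : nat -> nat -> nat) (C : nat -> nat -> R[i]) :=
  [/\ (#|[pred f : G | (code f < i)%N && (O C f != 0%R)]| <= I iCount 0 <= 5 * k)%N,
      (I iCount 0 <= #|[pred f : G | (code f < i)%N && (y f != 0%R)]|)%N,
      (#|[pred t | y t != 0%R]| <= 5 * k)%N -> forall f, (code f < i)%N -> O C f = y f &
      forall f, (i <= code f)%N -> C cy (code f) = y f].
apply: (run_post (Q1 := fun s' => Inv n (ia s') (ca s') /\
    (steps s' <= steps s1 + (2 + n * (3 + 2)))%N)); last first.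
  move=> s2 _ [[/andP[h1 h2] _ h3 _] st2].
  have OE f : output p d s2 f = O (ca s2) f by rewrite ffunE cmem_arr.
  split; last by move: st2; rewrite st1; lia.
    apply: leq_trans h2; apply: leq_trans h1; apply/subset_leq_card/fintype.subsetP => f.
    by rewrite !inE OE code_lt.
  by move=> ysupp; apply/ffunP => f; rewrite OE h3// code_lt.
apply: run_for => //; first by rewrite ia1.
  move=> s2 ia2 ca2; split => //.
  - by rewrite ia2// ia1//= eq_card0// => f; rewrite !inE.
  - by rewrite ia2// ia1.
  - by move=> f _; rewrite ca2 ca1 hy.
move=> i s2 iltn ik2 ck2 s2i [/andP[h1 h2] h3 h4 h5].
pose f0 := decode d p_gt0 i; have f0i : code f0 = i by rewrite decodeK.
have fE f : (code f == i) = (f == f0) by rewrite -{1}f0i (inj_eq (code_inj p_gt0)).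
have y0 : ca s2 cy i = y f0 by rewrite -f0i h5// f0i.
have k2 : ia s2 iK 0 = k by rewrite ik2// ia1.
have codeS (P : pred G) : #|[pred f | (code f < i.+1)%N && P f]| =
    (P f0 + #|[pred f | (code f < i)%N && P f]|)%N.
  rewrite (cardD1 f0) !inE f0i leqnn /=; congr (_ + _)%N; apply: eq_card => f.
  rewrite !inE ltnS [(code f <= i)%N]leq_eqVlt fE.
  case: eqP => [->|_] //=.
  by rewrite f0i ltnn.
have rawC s' c v : cmem s' = upd (cmem s2) i v -> forall a j,
    ca s' a j = if arr a j == i then v else ca s2 a j.
  by move=> hs a j; rewrite /ca hs.
have OC s' v f : cmem s' = upd (cmem s2) i v -> O (ca s') f =
    if f == f0 then v else O (ca s2) f.
  by move=> hs; rewrite /O -!cmem_arr hs /upd fE.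
have cyC s' v f : cmem s' = upd (cmem s2) i v -> (i < code f)%N ->
    ca s' cy (code f) = ca s2 cy (code f).
  move=> hs fi; rewrite /ca hs /upd ifF//; apply/negbTE/eqP; rewrite /arr.
  by move: fi; lia.
have bE : beval s2 (BAnd (BNot (BCLe (abs_sqr_exp (CA cy (IV iI))) (COfNat (IConst 0))))
    (BNot (BILe support_cap (IV iCount)))) = (y f0 != 0) && (ia s2 iCount 0 < 5 * k)%N.
  rewrite /abs_sqr_exp /support_cap !evE s2i k2 y0 -ltnNge; congr (_ && _).
  rewrite Re_mul_conj /= -ltNge lt_neqAle sqr_ge0 andbT eq_sym sqrf_eq0.
  by rewrite cabs_eq0.
have step_lt : (code f0 < i)%N = false by rewrite f0i ltnn.
apply: run_if; rewrite bE => cond s3 ia3 ca3 st3.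
  move/andP: cond => [yf0 cnt].
  apply: run_seq (run_cset_raw _ _ _) _ => s4 _ [cm4 ia4 st4].
  have {}cm4 : cmem s4 = upd (cmem s2) i (y f0).
    have cm3 : cmem s3 = cmem s2.
      by apply/funext => c; rewrite !cmem_arr ca3.
    by rewrite cm4 cm3 !evE ia3 s2i ca3 y0.
  apply: run_last_iset => //.
    by rewrite !evE ia4 ia3 addn1 (leq_ltn_trans cnt).
  move=> s5; rewrite !evE ia4 ia3 => ia5 ca5 st5.
  split; first by rewrite st5 st4 st3; lia.
  move=> s6 _ ia6 ca6; have C6 : ca s6 = ca s4 by rewrite ca6 ca5.
  have I6 : ia s6 iCount 0 = (ia s2 iCount 0).+1 by rewrite ia6// ia5// addn1.
  rewrite C6; split.
  - rewrite I6 cnt andbT codeS (OC _ _ _ cm4) eqxx yf0 add1n ltnS.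
    apply: leq_trans h1; apply/subset_leq_card/fintype.subsetP => f.
    rewrite !inE (OC _ _ _ cm4); case: (f =P f0) => [->|//].
    by rewrite step_lt.
  - by rewrite I6 codeS yf0 add1n ltnS.
  - move=> ysupp f; rewrite (OC _ _ _ cm4) ltnS leq_eqVlt fE.
    by case: eqP => [->//|_ /= fi]; rewrite h4.
  - by move=> f fi; rewrite (cyC _ _ _ cm4)// h5// ltnW.
apply: run_post (run_cset_raw _ _ _) _ => s4 _ [cm4 ia4 st4].
split; first by rewrite st4 st3; lia.
have {}cm4 : cmem s4 = upd (cmem s2) i 0.
  have cm3 : cmem s3 = cmem s2 by apply/funext => c; rewrite !cmem_arr ca3.
  by rewrite cm4 cm3 !evE ia3 s2i.
move=> s5 _ ia5 ->; have I5 : ia s5 iCount 0 = ia s2 iCount 0 by rewrite ia5// ia4 ia3.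
split.
- rewrite I5 h2 andbT codeS (OC _ _ _ cm4) eqxx eqxx add0n.
  apply: leq_trans h1; apply/subset_leq_card/fintype.subsetP => f.
  rewrite !inE (OC _ _ _ cm4); case: (f =P f0) => [->|//].
  by rewrite step_lt.
- by rewrite I5 codeS (leq_trans h3)// leq_addl.
- move=> ysupp f; rewrite (OC _ _ _ cm4) ltnS leq_eqVlt fE.
  case: eqP => [->|_ /= fi]; last by rewrite h4.
  move=> _; apply/esym/eqP; move: cond; rewrite negb_and negbK => /orP[//|].
  (* A nonzero entry would count one more than the counter does and still stay within 5 k, so the
     cap could not have been reached. *)
  apply: contraR => yf0; apply: (@leq_trans #|[pred f | (code f < i.+1)%N && (y f != 0%R)]|).
    by rewrite codeS yf0 add1n ltnS.
  apply: leq_trans ysupp; apply/subset_leq_card/fintype.subsetP => g.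
  by rewrite !inE => /andP[].
- by move=> f fi; rewrite (cyC _ _ _ cm4)// h5// ltnW.
Qed.

End RecoveryProgram.

(** * Correctness of the whole program *)

Section MainProgram.
Variables (R : realType) (p d W : nat) (x : signal R p d) (tau : nat -> draw R p d).
Variables (k m : nat) (mu Rs : R).
Local Notation n := (p ^ d)%N.
Local Notation lgn := (up_log 2 n).
Local Notation q := (up_log 2 (32 * k)).
Local Notation lg := (up_log 2 (2 * p)).
Local Notation Q := (2 ^ q)%N.
Local Notation N := (2 ^ lg)%N.
Local Notation kappa := ((2 * q).+1).
(** Chosen so that 4^L exceeds the number 2^(m+1) of trajectories times kappa n for the events of a
    stage, with another factor n to spare. *)
Definition group_count : nat := m + kappa + lgn + 1.
(* 2^18 k samples; the product keeps the numeral 262144 out of the program. *)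
Definition group_size : nat := 512 * 512 * k.
Local Notation L := group_count.
Local Notation B := group_size.
Definition sample_count : nat := kappa * L * B.
Hypotheses (p_gt0 : (0 < p)%N) (d_gt0 : (0 < d)%N) (mu_gt0 : 0 < mu).
Hypotheses (Rs_le : Rs <= 2 ^+ m) (m_min : forall j, Rs <= 2 ^+ j -> (m <= j)%N).
Hypotheses (W1 : (1 < W)%N) (nW : (2 * n < W)%N) (kW : (2 * (32 * k) < W)%N).
Hypotheses (pW : (2 * (2 * p) < W)%N) (mW : (m.+1 < W)%N) (dW : (d < W)%N).
Hypotheses (QW : (8 * Q ^ 2 < W)%N) (NW : (N < W)%N).
Hypotheses (LW : (L < W)%N) (BW : (B < W)%N) (sampleW : (sample_count < W)%N).
Hypotheses (k_gt0 : (0 < k)%N) (k5W : (5 * k < W)%N).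
Local Notation run := (run W x tau).
Local Notation sampled := (@sampled R p d x tau N lg L B kappa).
Local Notation drawn_batch := (drawn_batch tau L B).
Implicit Types (s : state R) (y : signal R p d).

Definition recovered : signal R p d := recover x mu q m.+1 0 m drawn_batch.

Definition stage_total : nat := stage_cost p d N lg L B q.
Definition round_total : nat := round_cost p d N lg L B.
Definition setup_cost : nat :=
  log2_cost lgn + log2_cost q + log2_cost lg + (3 + m * 3) + 5 + (3 + p * 4) + (3 + N * 4) +
  (4 + 6 * N + fft_cost N lg).
Definition total_cost : nat :=
  setup_cost + (2 + sample_count * 4) + (1 + m * (stage_total + 1)) +
  (2 + kappa * (round_total + 3)) + (3 + n * 5).

Lemma ltW_n : (n < W)%N. Proof. by apply: leq_ltn_trans nW; rewrite leq_pmull. Qed.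

Lemma p_le_N : (2 * p <= N)%N. Proof. exact: up_logP. Qed.

Lemma ltW_kappa : (kappa < W)%N.
Proof.
apply: leq_ltn_trans QW; rewrite -expnM [(q * 2)%N]mulnC.
have h := ltn_expl (2 * q)%N (isT : (1 < 2)%N).
by move: h; move: (2 ^ (2 * q))%N => X; lia.
Qed.

Record prepared s : Prop := Prepared {
  prepared_kappa : ia s iKappa 0 = kappa;
  prepared_q : ia s iQ 0 = q;
  prepared_Q : ia s iQQ 0 = Q;
  prepared_m : ia s iM 0 = m;
  prepared_L : ia s iL 0 = L;
  prepared_B : ia s iB 0 = B;
  prepared_count : ia s iCount 0 = sample_count;
  prepared_tables : tables p d N lg s;
  prepared_scale : ca s cM 0 = (scale mu m)%:C%C }.

Lemma run_setup s : ia s iP 0 = p -> ia s iDim 0 = d -> ia s iN 0 = n -> ia s iK 0 = k ->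
  ca s cMu 0 = mu%:C%C -> ca s cRs 0 = Rs%:C%C ->
  run setup_prog s (fun s' => prepared s' /\ (steps s' <= steps s + setup_cost)%N).
Proof.
move=> sp sd sn sk sMu sRs.
have nW' := ltW_n; have kappaW' := ltW_kappa.
have pW' : (p < W)%N by apply: leq_ltn_trans pW; rewrite mulnA leq_pmull.
apply: run_seq (@run_log2_loop _ _ _ _ _ _ s 1 iN iCount iLogN n isT sn _ W1) _.
  by rewrite mul1n.
rewrite mul1n => s1 e1 [_ lgn1 st1].
have k1 : ia s1 iK 0 = k by rewrite (ikeepsP e1).
apply: run_seq (@run_log2_loop _ _ _ _ _ _ s1 32 iK iQQ iQ k isT k1 kW W1) _.
move=> s2 e2 [Q2 q2 st2].
have p2 : ia s2 iP 0 = p by rewrite (ikeepsP e2)// (ikeepsP e1).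
apply: run_seq (@run_log2_loop _ _ _ _ _ _ s2 2 iP iNF iLogF p isT p2 pW W1) _.
move=> s3 e3 [N3 lg3 st3].
have q3 : ia s3 iQ 0 = q by rewrite (ikeepsP e3).
apply: run_seq_iset => //; first by rewrite !evE q3 addn1.
move=> s4; rewrite !evE q3 addn1 => ia4 ca4 st4.
have Mu4 : ca s4 cMu 0 = mu%:C%C.
  by rewrite ca4 (ckeepsP e3)// (ckeepsP e2)// (ckeepsP e1).
have Rs4 : ca s4 cRs 0 = Rs%:C%C.
  by rewrite ca4 (ckeepsP e3)// (ckeepsP e2)// (ckeepsP e1).
apply: run_seq (run_scale_loop _ _ Mu4 Rs4 mu_gt0 Rs_le m_min mW) _.
move=> s5 e5 [M5 m5 st5].
have kap5 : ia s5 iKappa 0 = kappa by rewrite (ikeepsP e5)// ia4.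
have lgn5 : ia s5 iLogN 0 = lgn.
  by rewrite (ikeepsP e5)// ia4// (ikeepsP e3)// (ikeepsP e2).
have L5 : ieval s5 (IAdd (IAdd (IAdd (IV iM) (IV iKappa)) (IV iLogN)) (IConst 1)) = L.
  by rewrite !evE m5 kap5 lgn5.
apply: run_seq_iset => //; first by rewrite L5.
move=> s6; rewrite L5 => ia6 ca6 st6.
have k6 : ia s6 iK 0 = k by rewrite ia6// (ikeepsP e5)// ia4// (ikeepsP e3)// (ikeepsP e2).
have B6 : ieval s6 (IMul (IMul (IConst 512) (IConst 512)) (IV iK)) = B.
  by rewrite !evE k6.
apply: run_seq_iset => //; first by rewrite B6.
move=> s7; rewrite B6 => ia7 ca7 st7.
have n7 : ia s7 iN 0 = n.
  by rewrite ia7// ia6// (ikeepsP e5)// ia4// (ikeepsP e3)// (ikeepsP e2)// (ikeepsP e1).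
have p7 : ia s7 iP 0 = p by rewrite ia7// ia6// (ikeepsP e5)// ia4// (ikeepsP e3).
have nq : (n %/ p = p ^ d.-1)%N by rewrite -(@m_def p d)// mulnK.
apply: run_seq_iset => //.
  by rewrite !evE n7 p7 (leq_ltn_trans (leq_div _ _)).
move=> s8; rewrite !evE n7 p7 nq => ia8 ca8 st8.
have p8 : ia s8 iP 0 = p by rewrite ia8.
apply: run_seq (@run_power_table _ _ _ _ _ _ s8 cPow iP p isT isT p8 pW') _.
move=> s9 e9 [pow9 st9].
have N9 : ia s9 iNF 0 = N.
  by rewrite (ikeepsP e9)// ia8// ia7// ia6// (ikeepsP e5)// ia4.
apply: run_seq (@run_power_table _ _ _ _ _ _ s9 cZeta iNF N isT isT N9 NW) _.
move=> s10 e10 [zeta10 st10].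
have N10 : ia s10 iNF 0 = N by rewrite (ikeepsP e10).
have p10 : ia s10 iP 0 = p by rewrite (ikeepsP e10)// (ikeepsP e9).
have lg10 : ia s10 iLogF 0 = lg.
  by rewrite (ikeepsP e10)// (ikeepsP e9)// ia8// ia7// ia6// (ikeepsP e5)// ia4.
have pow10 j : (j < p)%N -> ca s10 cPow j = root_of_unity R p ^+ j.
  by move=> jp; rewrite (ckeepsP e10)// pow9.
apply: run_seq (run_chirp_table _ _ p_gt0 (erefl N) NW p10 N10 lg10 pow10 zeta10) _.
move=> s11 e11 [chirp11 st11].
have kap11 : ia s11 iKappa 0 = kappa.
  by rewrite (ikeepsP e11)// (ikeepsP e10)// (ikeepsP e9)// ia8// ia7// ia6.
have L11 : ia s11 iL 0 = L.
  by rewrite (ikeepsP e11)// (ikeepsP e10)// (ikeepsP e9)// ia8// ia7// ia6.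
have B11 : ia s11 iB 0 = B.
  by rewrite (ikeepsP e11)// (ikeepsP e10)// (ikeepsP e9)// ia8// ia7.
have T11 : ieval s11 (IMul (IMul (IV iKappa) (IV iL)) (IV iB)) = sample_count.
  by rewrite !evE kap11 L11 B11.
apply: run_last_iset => //; first by rewrite T11.
move=> s12; rewrite T11 => ia12 ca12 st12; split; last first.
  by move: st1 st2 st3 st4 st5 st6 st7 st8 st9 st10 st11 st12; rewrite /setup_cost; lia.
have q11 : ia s11 iQ 0 = q.
  rewrite (ikeepsP e11)// (ikeepsP e10)// (ikeepsP e9)// ia8// ia7// ia6//.
  by rewrite (ikeepsP e5)// ia4.
have Q11 : ia s11 iQQ 0 = Q.
  rewrite (ikeepsP e11)// (ikeepsP e10)// (ikeepsP e9)// ia8// ia7// ia6//.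
  by rewrite (ikeepsP e5)// ia4// (ikeepsP e3).
have m11 : ia s11 iM 0 = m.
  by rewrite (ikeepsP e11)// (ikeepsP e10)// (ikeepsP e9)// ia8// ia7// ia6.
have n11 : ia s11 iN 0 = n.
  by rewrite (ikeepsP e11)// (ikeepsP e10)// (ikeepsP e9)// ia8.
have d11 : ia s11 iDim 0 = d.
  rewrite (ikeepsP e11)// (ikeepsP e10)// (ikeepsP e9)// ia8// ia7// ia6//.
  by rewrite (ikeepsP e5)// ia4// (ikeepsP e3)// (ikeepsP e2)// (ikeepsP e1).
have rows11 : ia s11 iRows 0 = (p ^ d.-1)%N.
  by rewrite (ikeepsP e11)// (ikeepsP e10)// (ikeepsP e9)// ia8.
have M11 : ca s11 cM 0 = (scale mu m)%:C%C.
  by rewrite (ckeepsP e11)// (ckeepsP e10)// (ckeepsP e9)// ca8 ca7 ca6.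
split; rewrite ?ia12 ?ca12//; split; rewrite ?ia12 ?ca12//.
- by rewrite (ikeepsP e11).
- by rewrite (ikeepsP e11).
- by rewrite (ikeepsP e11).
- by move=> j jp; rewrite (ckeepsP e11)// pow10.
- by move=> j jN; rewrite (ckeepsP e11)// zeta10.
Qed.

Lemma run_stage_loop s : sampled s -> holds cy (0 : signal R p d) s -> ia s iKappa 0 = kappa ->
  ia s iQ 0 = q -> ia s iQQ 0 = Q -> ia s iM 0 = m -> ca s cM 0 = (scale mu m)%:C%C ->
  run stage_loop s (fun s' => (exists y i, [/\ holds cy y s', ia s' iM 0 = i, (i < kappa)%N,
      ca s' cM 0 = (scale mu i)%:C%C & rounds x y (scale mu i) drawn_batch i = recovered]) /\
    (steps s' <= steps s + (1 + m * (stage_total + 1)))%N).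
Proof.
move=> ss hy sk sq sQ sm sM.
(* The invariants of [run_while] see arrays only; a state with these arrays is quantified so that
   [sampled] and [holds] can be used. The last clause says that the recovery still to be done from
   the current vector yields the final result. *)
pose Inv i (I : nat -> nat -> nat) (C : nat -> nat -> R[i]) := exists2 s', I = ia s' /\ C = ca s' &
  [/\ sampled s', [/\ ia s' iKappa 0 = kappa, ia s' iQ 0 = q & ia s' iQQ 0 = Q],
      (i <= m)%N, ia s' iM 0 = i /\ ca s' cM 0 = (scale mu i)%:C%C &
      exists y fuel, [/\ holds cy y s', (i < fuel)%N &
        recover x mu q fuel y i drawn_batch = recovered]].
have q_gt0 : (0 < q)%N by rewrite up_log_gt0 /=; move: k_gt0; lia.
have same s1 s2 : ia s1 = ia s2 -> ca s1 = ca s2 -> sampled s2 -> sampled s1.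
  by move=> h1 h2; apply: sampled_eq => *; rewrite ?h1 ?h2.
apply: run_post (run_while (i := m) (T := stage_total) (Inv := Inv) _ _) _.
- move=> i s1 [s' [I1 C1] [ss' [k' q' Q'] im [m' M'] [y [fuel [hy' fi rec]]]]].
  rewrite !evE I1 k' m' => ki.
  have ss1 : sampled s1 := same _ _ I1 C1 ss'.
  have hy1 : holds cy y s1 by move=> t; rewrite C1.
  have k1 : ia s1 iKappa 0 = kappa by rewrite I1.
  have q1 : ia s1 iQ 0 = q by rewrite I1.
  have Q1 : ia s1 iQQ 0 = Q by rewrite I1.
  have i1 : ia s1 iM 0 = i by rewrite I1.
  have M1 : ca s1 cM 0 = (scale mu i)%:C%C by rewrite C1.
  have imW : (i < W)%N by apply: leq_ltn_trans im (ltn_trans _ mW).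
  apply: run_post (run_stage p_gt0 (erefl N) p_le_N NW d_gt0 ltW_n dW LW BW QW
    ss1 hy1 k1 q1 Q1 i1 imW ki M1) _.
  move=> s2 e2 [hy2 m2 M2 st2]; split=> //.
  exists (i - q)%N; first by lia.
  exists s2 => //; split.
  + by apply: (sampled_ex e2) ss1.
  + by rewrite !(ikeepsP e2)// I1.
  + by rewrite (leq_trans (leq_subr _ _)).
  + by [].
  + case: fuel fi rec => // fuel fi /=; rewrite ki => rec.
    exists (stage x mu q y i drawn_batch), fuel; split => //.
    by move: fi; lia.
- by exists s => //; split => //; exists (0 : signal R p d), m.+1.
move=> s1 _ [nb [i im [s' [I1 C1] [ss' [k' q' Q'] _ [m' M'] [y [fuel [hy' fi rec]]]]]] st1].
split=> //; move: nb; rewrite !evE I1 k' m' -ltnNge => ik.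
exists y, i; rewrite ?I1 ?C1; split=> //; first by move=> t; rewrite C1.
by case: fuel fi rec => //= fuel _; rewrite ltnNge -ltnS ik.
Qed.

Lemma run_recovery s : ia s iP 0 = p -> ia s iDim 0 = d -> ia s iN 0 = n -> ia s iK 0 = k ->
  ca s cMu 0 = mu%:C%C -> ca s cRs 0 = Rs%:C%C -> (forall i, ca s cy i = 0) ->
  pos s = 0%N -> reads s = 0%N ->
  run recovery_prog s (fun s' =>
    [/\ (#|[pred t | output p d s' t != 0%R]| <= 5 * k)%N,
        (#|[pred t | recovered t != 0%R]| <= 5 * k)%N -> output p d s' = recovered,
        reads s' = sample_count &
        (steps s' <= steps s + total_cost)%N]).
Proof.
move=> sp sd sn sk sMu sRs sy spos sreads.
apply: run_seq (run_setup sp sd sn sk sMu sRs) _ => s1 e1 [prep1 st1].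
have [kap1 q1 Q1 m1 L1 B1 count1 ts1 M1] := prep1.
have [pos1 reads1] := quietP e1 isT.
apply: run_seq (run_draw_samples x tau p_gt0 ltW_n sampleW count1 _) _.
  by rewrite pos1.
move=> s2 e2 [T2 X2 reads2 st2].
have ss2 : sampled s2.
  by split=> //; rewrite ?(ikeepsP e2)//; apply: (tables_ex e2) ts1.
have y2 : holds cy (0 : signal R p d) s2.
  by move=> t; rewrite (ckeepsP e2)// (ckeepsP e1)// sy ffunE.
have kap2 : ia s2 iKappa 0 = kappa by rewrite (ikeepsP e2).
have q2 : ia s2 iQ 0 = q by rewrite (ikeepsP e2).
have Q2 : ia s2 iQQ 0 = Q by rewrite (ikeepsP e2).
have m2 : ia s2 iM 0 = m by rewrite (ikeepsP e2).
have M2 : ca s2 cM 0 = (scale mu m)%:C%C by rewrite (ckeepsP e2).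
apply: run_seq (run_stage_loop ss2 y2 kap2 q2 Q2 m2 M2) _.
move=> s3 e3 [[y [i [y3 m3 ik M3 rec]]] st3].
have ss3 : sampled s3 by apply: (sampled_ex e3) ss2.
apply: run_seq (run_rounds_prog p_gt0 (erefl N) p_le_N NW d_gt0 ltW_n dW LW BW QW
  (b := iM) _ ss3 y3 M3 m3 (ltnW ik)) _ => //.
rewrite rec => s4 e4 [y4 M4 st4].
have n4 : ia s4 iN 0 = n.
  by rewrite (ikeepsP e4)// (ikeepsP e3)// (ikeepsP e2)// (ikeepsP e1).
have k4 : ia s4 iK 0 = k.
  by rewrite (ikeepsP e4)// (ikeepsP e3)// (ikeepsP e2)// (ikeepsP e1).
apply: run_post (run_copy_out x tau p_gt0 ltW_n n4 k4 y4 k5W) _ => s5 e5 [h1 h2 st5].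
split=> //.
  have [_ ->] := quietP e5 isT; have [_ ->] := quietP e4 isT; have [_ ->] := quietP e3 isT.
  by rewrite reads2 reads1 sreads.
have ir : (i * (round_cost p d N lg L B + 1 + 2) <= kappa * (round_total + 3))%N.
  rewrite /round_total -addnA leq_mul2r; apply/orP; right; exact: ltnW.
by move: st1 st2 st3 st4 st5 ir; rewrite /total_cost; lia.
Qed.

End MainProgram.

(** * Step counts as polynomials in n, L and kappa *)

Lemma leq_mulR (a b : nat) : (0 < b)%N -> (a <= a * b)%N.
Proof. by move=> b0; rewrite leq_pmulr. Qed.

(** Each axis has n / p lines of cost O(p lg), so everything rests on d lg = O(log n): 2^(lg - 2) <
    p gives d (lg - 2) <= log n, and d <= log n pays for the remaining 2 d. *)
Lemma dft_cost_le (p d : nat) : (1 < p)%N -> (0 < d)%N ->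
  let lg := up_log 2 (2 * p) in
  (dft_cost p d (2 ^ lg) lg <= 700 * (p ^ d * up_log 2 (p ^ d)))%N /\
  (lg <= 3 * up_log 2 (p ^ d))%N /\ (2 ^ lg <= 4 * p)%N.
Proof.
move=> p1 d0 lg; set N := (2 ^ lg)%N; set lgn := up_log 2 (p ^ d).
have two : (1 < 2)%N by [].
have p0 : (0 < p)%N by apply: ltnW.
have p2 : (1 < 2 * p)%N by lia.
have /andP[lg1 lg2] := up_log_bounds two p2; rewrite -/lg in lg1 lg2.
have lg0 : (0 < lg)%N by rewrite up_log_gt0.
have N4 : (N <= 4 * p)%N.
  by rewrite /N -(prednK lg0) expnS; move: lg1; move: (2 ^ lg.-1)%N => X; lia.
have n1 : (1 < p ^ d)%N by rewrite -(exp1n d) ltn_exp2r.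
have lgnP : (p ^ d <= 2 ^ lgn)%N := up_logP _ two.
have dlgn : (d <= lgn)%N.
  rewrite -(@leq_exp2l 2)//; apply: leq_trans lgnP; rewrite leq_exp2r//.
have dlg : (d * lg <= 3 * lgn)%N.
  have h : (d * lg.-2 <= lgn)%N.
    rewrite -(@leq_exp2l 2)//; apply: leq_trans lgnP; rewrite mulnC expnM leq_exp2r//.
    case: (lg) lg1 => [|[|l]] //=.
    by rewrite expnS; move: (2 ^ l)%N => X; lia.
  have : (lg <= lg.-2 + 2)%N by lia.
  move=> h2; apply: (@leq_trans (d * (lg.-2 + 2))); first by rewrite leq_mul2l h2 orbT.
  by rewrite mulnDr; lia.
split; last first.
  by split=> //; apply: leq_trans dlg; rewrite leq_pmull.
have N0 : (0 < N)%N by rewrite expn_gt0.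
have line_le : (line_cost N lg + 2 <= 204 * (p * lg))%N.
  have : (line_cost N lg + 2 <= 51 * (N * lg))%N.
    have h1 := leq_mulR N lg0; have h2 : (lg <= N * lg)%N by rewrite leq_pmull.
    have -> : (line_cost N lg + 2 = 14 + 9 * N + 16 * lg + 12 * (N * lg))%N.
      by rewrite /line_cost /fft_cost; ring.
    by move: h1 h2 lg0; move: (N * lg)%N => X; lia.
  move=> h; apply: (leq_trans h); rewrite -[(204)%N]/(51 * 4)%N -mulnA leq_mul2l /=.
  by rewrite mulnA leq_mul2r N4 orbT.
have axis_le : (axis_cost p (p ^ d.-1) N lg + 2 <= 213 * (p ^ d * lg))%N.
  have mp : (p ^ d.-1 * p = p ^ d)%N by rewrite -expnSr prednK.
  have : (p ^ d.-1 * (line_cost N lg + 2) <= 204 * (p ^ d * lg))%N.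
    rewrite -mp -mulnA mulnCA leq_mul2l; apply/orP; right; exact: line_le.
  have h1 := leq_mulR (p ^ d) lg0.
  rewrite /axis_cost [(p * _)%N]mulnC mp.
  move: (p ^ d.-1 * _)%N => X; move: h1 n1; move: (p ^ d * lg)%N (p ^ d)%N => Y Z; lia.
have : (d * (axis_cost p (p ^ d.-1) N lg + 2) <= 213 * (p ^ d * (d * lg)))%N.
  rewrite [(p ^ d * (d * lg))%N]mulnCA [leqRHS]mulnCA leq_mul2l; apply/orP; right; exact: axis_le.
have : (p ^ d * (d * lg) <= 3 * (p ^ d * lgn))%N.
  by rewrite [leqRHS]mulnCA leq_mul2l dlg orbT.
have : (1 <= p ^ d * lgn)%N by rewrite muln_gt0 (ltnW n1) (leq_trans d0).
rewrite /dft_cost; move: (d * (axis_cost _ _ _ _ + 2))%N (p ^ d * lgn)%N => X Y.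
by move: (p ^ d * (d * lg))%N => Z; lia.
Qed.

Section CostBound.
Variables (p d k m : nat).
Hypotheses (p_gt1 : (1 < p)%N) (d_gt0 : (0 < d)%N) (k_gt0 : (0 < k)%N) (k_le : (k <= p ^ d)%N).
Local Notation n := (p ^ d)%N.
Local Notation lgn := (up_log 2 n).
Local Notation q := (up_log 2 (32 * k)).
Local Notation lg := (up_log 2 (2 * p)).
Local Notation Q := (2 ^ q)%N.
Local Notation N := (2 ^ lg)%N.
Local Notation kappa := ((2 * q).+1).
Local Notation L := (group_count p d k m).
Local Notation B := (group_size k).
Variable b0 : nat.
Hypothesis group_sizeE : B = (b0 * k)%N.

Lemma n_gt1 : (1 < n)%N. Proof. by rewrite -(exp1n d) ltn_exp2r. Qed.

Lemma Q_le : (Q <= 64 * k)%N.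
Proof.
have k1 : (1 < 32 * k)%N by lia.
have /andP[h _] := up_log_bounds (isT : (1 < 2)%N) k1.
have q0 : (0 < q)%N by rewrite up_log_gt0.
by rewrite -(prednK q0) expnS; move: h; move: (2 ^ q.-1)%N => X; lia.
Qed.

Lemma L_ge : [/\ (m <= L)%N, (kappa <= L)%N, (lgn <= L)%N & (0 < L)%N].
Proof. by rewrite /group_count; split; lia. Qed.

(** Two sources of order n L^2: L transforms of cost O(n log n), and the L^2 comparisons of votes at
    each of the n frequencies. *)
Lemma round_cost_le : (round_cost p d N lg L B <= (1500 + 4 * b0) * (n * L ^ 2))%N.
Proof.
have [h1 [h2 h3]] := dft_cost_le p_gt1 d_gt0.
have [mL kL lL L0] := L_ge; have n1 := n_gt1.
have Bn : (B <= b0 * n)%N by rewrite group_sizeE leq_mul2l k_le orbT.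
set D := dft_cost p d N lg in h1 *.
have DL : (D <= 700 * (n * L))%N.
  by apply: (leq_trans h1); rewrite leq_mul2l /= leq_mul2l lL orbT.
have nL : (n <= n * L)%N := leq_mulR n L0.
have n0 : (0 < n)%N := ltnW n1.
have LnL : (L <= n * L)%N by rewrite leq_pmull.
have nLL : (n * L <= n * L ^ 2)%N by rewrite expnS expn1 mulnA leq_pmulr.
have group_le : (group_cost p d N lg B + 2 <= (714 + 4 * b0) * (n * L))%N.
  rewrite /group_cost /group_accum_cost -/D.
  have : (b0 * n <= b0 * (n * L))%N by rewrite leq_mul2l nL orbT.
  move: Bn; rewrite mulnDl -mulnA; move: (b0 * n)%N (b0 * (n * L))%N B => X Y Z.
  by move: DL nL n1; move: (n * L)%N => X'; lia.
have Lgroup : (L * (group_cost p d N lg B + 2) <= (714 + 4 * b0) * (n * L ^ 2))%N.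
  have -> : (n * L ^ 2 = L * (n * L))%N by rewrite expnS expn1; ring.
  by rewrite mulnCA leq_mul2l group_le orbT.
rewrite /round_cost -/D /frequency_cost /votes_cost.
have -> : (n * (5 + L * (5 + (2 + L * 4)) + 2) = 7 * n + 7 * (n * L) + 4 * (n * L ^ 2))%N.
  by rewrite expnS expn1; ring.
move: Lgroup; rewrite [((1500 + _) * _)%N]mulnDl [((714 + _) * _)%N]mulnDl.
move: (L * (group_cost _ _ _ _ _ + 2))%N (4 * b0 * _)%N LnL => X Y.
by clear h1 mL kL lL L0; move: DL nL nLL n1; move: (n * L ^ 2)%N (n * L)%N n D L; lia.
Qed.

Lemma stage_cost_le : (stage_cost p d N lg L B q <= (2100 + 4 * b0) * (kappa * (n * L ^ 2)))%N.
Proof.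
have r := round_cost_le; have n1 := n_gt1; have [mL kL lL L0] := L_ge.
have Qn : (Q <= 64 * n)%N by apply: leq_trans Q_le _; rewrite leq_mul2l k_le orbT.
have nLL : (n <= n * L ^ 2)%N by rewrite leq_pmulr// expn_gt0 L0.
have k0 : (0 < kappa)%N by [].
have knLL : (n * L ^ 2 <= kappa * (n * L ^ 2))%N by rewrite leq_pmull.
have kn : (kappa * n <= kappa * (n * L ^ 2))%N by rewrite leq_mul2l nLL orbT.
have kk : (kappa <= kappa * n)%N by rewrite leq_pmulr// ltnW.
have kr : (kappa * (round_cost p d N lg L B + 3) <=
    (1503 + 4 * b0) * (kappa * (n * L ^ 2)))%N.
  rewrite mulnCA leq_mul2l; apply/orP; right.
  have -> : (1503 + 4 * b0 = 1500 + 4 * b0 + 3)%N by rewrite addnAC.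
  by rewrite mulnDl leq_add// leq_pmulr//; lia.
rewrite /stage_cost.
have -> : (n * (16 + 10 * (kappa + 2)) = 36 * n + 10 * (kappa * n))%N by ring.
move: kr; rewrite [((2100 + _) * _)%N]mulnDl [((1503 + _) * _)%N]mulnDl.
move: (kappa * (round_cost _ _ _ _ _ _ + 3))%N => X.
move: (4 * b0 * _)%N => Y.
move: nLL knLL kn kk n1 Qn; move: (kappa * (n * L ^ 2))%N (n * L ^ 2)%N (kappa * n)%N => X1 X2 X3.
by move: n Q => X4 X5; lia.
Qed.

(** The number of stages is bounded by m <= L rather than by m / q, which the target n log^3 n log k
    can afford. *)
Lemma total_cost_le : (total_cost p d k m <= (5000 + 12 * b0) * (kappa * (n * L ^ 3)))%N.
Proof.
have r := round_cost_le; have st := stage_cost_le; have n1 := n_gt1.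
have [mL kL lL L0] := L_ge.
have [h1 [h2 h3]] := dft_cost_le p_gt1 d_gt0.
have pn : (p <= n)%N by rewrite -{1}(expn1 p) leq_exp2l.
set X := (kappa * (n * L ^ 3))%N.
have n0 : (0 < n)%N := ltnW n1.
have nL : (n * L <= X)%N.
  rewrite /X; apply: (@leq_trans (n * L ^ 3)); last by rewrite leq_pmull.
  by rewrite leq_mul2l expnS leq_pmulr ?orbT// expn_gt0 L0.
have LX : (L <= n * L)%N by rewrite leq_pmull.
have nX : (n <= n * L)%N := leq_mulR n L0.
have knLLX : (kappa * (n * L ^ 2) * L = X)%N by rewrite /X [(L ^ 3)%N]expnSr; ring.
have kLX : (kappa * (n * L) <= X)%N.
  by rewrite /X leq_mul2l leq_mul2l expnS leq_pmulr ?orbT// expn_gt0 L0.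
have stX : (m * (stage_total p d k m + 1) <= (2101 + 4 * b0) * X)%N.
  rewrite -knLLX [(_ * L)%N]mulnC mulnCA leq_mul//.
  have -> : (2101 + 4 * b0 = 2100 + 4 * b0 + 1)%N by rewrite addnAC.
  rewrite mulnDl leq_add// mul1n muln_gt0 /= muln_gt0 n0 expn_gt0 L0//.
have rX : (kappa * (round_total p d k m + 3) <= (1503 + 4 * b0) * X)%N.
  rewrite /X mulnCA leq_mul2l; apply/orP; right.
  have -> : (1503 + 4 * b0 = 1500 + 4 * b0 + 3)%N by rewrite addnAC.
  rewrite mulnDl leq_add//; last first.
    by rewrite leq_pmulr// muln_gt0 n0 expn_gt0 L0.
  apply: (leq_trans r); rewrite leq_mul2l; apply/orP; right.
  by rewrite leq_mul2l leq_exp2l// orbT || rewrite leq_mul2l leq_pexp2l ?orbT.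
have sX : (sample_count p d k m <= b0 * X)%N.
  rewrite /sample_count group_sizeE; apply: (@leq_trans (b0 * (kappa * (n * L)))).
    have -> : (kappa * L * (b0 * k) = b0 * (kappa * (k * L)))%N by ring.
    by rewrite !leq_mul2l leq_mul2r k_le !orbT.
  by rewrite leq_mul2l kLX orbT.
have lgL : (lg <= 3 * L)%N by apply: leq_trans h2 _; rewrite leq_mul2l lL orbT.
have fft_le : (fft_cost N lg <= 3 + 24 * L + 72 * (n * L))%N.
  rewrite /fft_cost -addnA leq_add2l mulnDr leq_add//; first by lia.
  have -> : (72 * (n * L) = (3 * L) * (24 * n))%N by ring.
  by apply: leq_mul => //; lia.
have qL : (q <= L)%N by apply: leq_trans kL; lia.
rewrite /total_cost /setup_cost /log2_cost.
move: stX rX sX; rewrite [((2101 + _) * _)%N]mulnDl.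
rewrite [((1503 + _) * _)%N]mulnDl [((5000 + _) * _)%N]mulnDl.
have -> : (12 * b0 * X = 4 * b0 * X + 4 * b0 * X + 4 * (b0 * X))%N by ring.
move: (m * (stage_total _ _ _ _ + 1))%N (kappa * (round_total _ _ _ _ + 3))%N.
move: (sample_count _ _ _ _) (4 * b0 * X)%N (b0 * X)%N => Z1 Z2 Z3 Z4 Z5.
clear r st h1 h2 knLLX kLX kL n0; clearbody X.
move: nL LX nX n1 pn h3 fft_le lL mL qL lgL L0.
move: (fft_cost _ _) => F0; move: N => F1; move: (n * L)%N => F2.
move: L => F3; move: lgn => F4; move: q => F5; move: lg => F6; move: n => F7.
by move=> *; lia.
Qed.

End CostBound.

(** * Integer logarithms against the natural logarithm *)

Section LogBounds.
Variable R : realType.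

(** The inequality ln (1 + t) <= t at t = -1/2. *)
Lemma ln2_ge : 2^-1 <= ln 2 :> R.
Proof.
have := @le_ln1Dx R (- 2^-1).
have -> : 1 + - 2^-1 = 2^-1 :> R by lra.
rewrite lnV ?posrE ?ltr0n// => h.
by have := h ltac:(lra); lra.
Qed.

Lemma ln2_le : ln 2 <= 1 :> R.
Proof. by have := @le_ln1Dx R 1 ltac:(lra); rewrite -[1 + 1 : R]/2%:R. Qed.

Lemma ln_nat_le (v : nat) : (0 < v)%N -> ln v%:R <= v%:R :> R.
Proof.
move=> v0; have := @le_ln1Dx R (v%:R - 1).
have v1 : 1 <= v%:R :> R by rewrite ler1n.
by rewrite subrKC => h; apply: le_trans (h _) _; lra.
Qed.

Lemma half_le_ln (v : nat) : (1 < v)%N -> 2^-1 <= ln v%:R :> R.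
Proof.
move=> v1; apply: le_trans ln2_ge _.
by rewrite ler_ln ?posrE ?ltr0n ?ler_nat//; lia.
Qed.

Lemma exponent_le (r : R) (j : nat) : 2 ^+ j < r -> j%:R <= 2 * ln r.
Proof.
move=> jr; have r0 : 0 < r by apply: lt_trans jr; rewrite exprn_gt0.
have : ln (2 ^+ j) <= ln r by rewrite ler_ln ?posrE ?exprn_gt0//; exact: ltW.
rewrite lnXn ?ltr0n// -[ln 2 *+ j]mulr_natl => h.
have j0 : 0 <= j%:R :> R by [].
by have l2 := ln2_ge; nra.
Qed.

Lemma up_log_le (v : nat) :
  (0 < v)%N -> (up_log 2 v)%:R <= 1 + 2 * ln v%:R :> R.
Proof.
case: v => [//|[_|v _]]; first by rewrite up_log1 ln1; lra.
have /andP[lo _] := @up_log_bounds 2 v.+2 isT isT.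
have : 2 ^+ (up_log 2 v.+2).-1 < v.+2%:R :> R by rewrite -natrX ltr_nat.
move/exponent_le; case: (up_log 2 v.+2) => [|j] /=.
  by move=> _; have := @half_le_ln v.+2 isT; rewrite mulr0n; lra.
by move=> h; rewrite -natr1; lra.
Qed.

Lemma least_exponent (r : R) :
  exists2 m : nat, r <= 2 ^+ m & forall j, r <= 2 ^+ j -> (m <= j)%N.
Proof.
have ex : exists m, r <= 2 ^+ m :> R.
  exists (Num.trunc r).+1; apply: (le_trans (ltW (truncnS_gt r))).
  by rewrite -natrX ler_nat ltnW// ltn_expl.
by exists (ex_minn ex); case: ex_minnP.
Qed.

End LogBounds.

(** Hides 2^18 behind a variable, so that the unary numeral 262144 does not appear in later
    goals. *)
Lemma group_size_factor (R : realType) :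
  exists b : nat, [/\ forall k, group_size k = (b * k)%N,
    b%:R = 2 ^+ 18 :> R & forall n, (1 < n)%N -> (b <= n ^ 18)%N].
Proof.
have e9 : (512 = 2 ^ 9)%N by [].
exists (512 * 512)%N; split; first by [].
  by rewrite e9 natrM !natrX -exprD.
by move=> n n1; rewrite e9 -expnD leq_exp2r.
Qed.

(** * The asymptotic bounds and the size of machine words *)

Section Bounds.
Variables (R : realType) (p d k m a : nat) (Rs A : R).
Let n := (p ^ d)%N.
Hypotheses (p_gt1 : (1 < p)%N) (d_gt0 : (0 < d)%N).
Hypotheses (k_gt0 : (0 < k)%N) (k_le : (k <= n)%N).
Hypotheses (m_min : forall j, Rs <= 2 ^+ j -> (m <= j)%N).
Hypotheses (lnRs : ln Rs <= A * ln n%:R).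
Hypotheses (a_ge : 58 + 2 * Num.max 0 A <= a%:R).
Variable b : nat.
Hypotheses (bE : group_size k = (b * k)%N).
Hypotheses (b_le : forall v, (1 < v)%N -> (b <= v ^ 18)%N).

Local Notation q := (up_log 2 (32 * k)).
Local Notation kappa := (2 * q).+1.
Local Notation L := (group_count p d k m).

Lemma grid_gt1 : (1 < n)%N.
Proof. by rewrite /n; apply: leq_trans (ltn_expl d p_gt1); lia. Qed.

(** Since ln (32 k) = 5 ln 2 + ln k and ln 2 <= 1, the sum 2 (1 + 2 (5 + ln k)) + 1 gives these
    constants. *)
Lemma kappa_le : kappa%:R <= 23 + 4 * ln k%:R :> R.
Proof.
have := @up_log_le R (32 * k); rewrite muln_gt0 k_gt0 => /(_ isT).
rewrite [(32 * k)%:R]natrM lnM ?posrE ?ltr0n//.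
have -> : ln 32%:R = ln 2 *+ 5 :> R by rewrite -lnXn// -natrX.
move=> h; rewrite -natr1 [(2 * _)%:R]natrM.
by have := ln2_le R; lra.
Qed.

Lemma kappa_le_max : kappa%:R <= 27 * Num.max 1 (ln k%:R) :> R.
Proof.
apply: le_trans kappa_le _.
have h1 : 1 <= Num.max 1 (ln k%:R) :> R by rewrite le_max lexx.
have h2 : ln k%:R <= Num.max 1 (ln k%:R) :> R by rewrite le_max lexx orbT.
by lra.
Qed.

(** Minimality of m gives 2^(m-1) < Rs when m > 0. The maximum with 0 covers negative A, and ln n >=
    1/2 absorbs the additive 1. *)
Lemma exponent_le_ln : m%:R <= (2 + 2 * Num.max 0 A) * ln n%:R.
Proof.
have n1 := @half_le_ln R n grid_gt1.
have A0 : 0 <= Num.max 0 A by rewrite le_max lexx.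
have A1 : A <= Num.max 0 A by rewrite le_max lexx orbT.
case: m m_min => [_|m' min'].
  move: n1 A0; rewrite mulr0n; move: (Num.max 0 A) (ln n%:R) => M l l1 M0.
  by apply: mulr_ge0; lra.
have : 2 ^+ m' < Rs by rewrite ltNge; apply/negP => /min'; rewrite ltnn.
move/exponent_le; rewrite -natr1 => h.
have : A * ln n%:R <= Num.max 0 A * ln n%:R by apply: ler_wpM2r => //; lra.
move: (Num.max 0 A) h lnRs n1 => M h lnRs' n1 h2; lra.
Qed.

(** Adding the four summands of L gives (8 + 2 max 0 A) ln n + 25, and 25 <= 50 ln n because ln n >=
    1/2. This is the origin of 58. *)
Lemma group_count_le : L%:R <= a%:R * ln n%:R :> R.
Proof.
have n1 := @half_le_ln R n grid_gt1.
have mle := exponent_le_ln.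
have kk := kappa_le.
have lnk : ln k%:R <= ln n%:R :> R.
  by rewrite ler_ln ?posrE ?ltr0n ?ler_nat// /n expn_gt0 (ltnW p_gt1).
have lgn : (up_log 2 n)%:R <= 1 + 2 * ln n%:R :> R.
  by apply: up_log_le; rewrite expn_gt0 (ltnW p_gt1).
rewrite /group_count !natrD; apply: le_trans (ler_wpM2r _ a_ge); last by lra.
by move: kk mle lgn; rewrite -/n; lra.
Qed.

Lemma a_gt0 : 1 <= a%:R :> R.
Proof.
have A0 : 0 <= Num.max 0 A by rewrite le_max lexx.
by apply: le_trans a_ge; lra.
Qed.

Let C : R := (5000 + 12 * b)%:R * 27 * a%:R ^+ 3.

Lemma sample_count_le :
  (sample_count p d k m)%:R <=
    C * (k%:R * Num.max 1 (ln k%:R) * ln n%:R) :> R.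
Proof.
have n1 := @half_le_ln R n grid_gt1.
have L1 := group_count_le.
have K1 := kappa_le_max.
have a1 := a_gt0.
have M1 : 1 <= Num.max 1 (ln k%:R) :> R by rewrite le_max lexx.
rewrite /sample_count bE !natrM /C.
move: (Num.max _ _) (ln n%:R) n1 L1 K1 M1 => M l n1 L1 K1 M1.
have h1 : kappa%:R * L%:R <= (27 * M) * (a%:R * l) by apply: ler_pM.
have h2 : (27 * M) * (a%:R * l) * b%:R <=
          (27 * M) * (a%:R ^+ 3 * l) * (5000 + 12 * b)%:R.
  apply: ler_pM => //.
  - by apply: mulr_ge0; apply: mulr_ge0 => //; lra.
  - apply: ler_wpM2l; first by lra.
    apply: ler_wpM2r; first by lra.
    by rewrite exprS ler_peMr// ?exprn_ege1//; lra.
  - by rewrite ler_nat; lia.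
have -> : (5000 + 12 * b)%:R * 27 * a%:R ^+ 3 * (k%:R * M * l) =
  (27 * M) * (a%:R ^+ 3 * l) * (5000 + 12 * b)%:R * k%:R :> R by ring.
rewrite mulrA ler_wpM2r//; apply: le_trans h2.
by rewrite ler_wpM2r.
Qed.

Lemma total_cost_le_ln :
  (total_cost p d k m)%:R <=
    C * (n%:R * ln n%:R ^+ 3 * Num.max 1 (ln k%:R)) :> R.
Proof.
have n1 := @half_le_ln R n grid_gt1.
have L1 := group_count_le.
have K1 := kappa_le_max.
have a1 := a_gt0.
have M1 : 1 <= Num.max 1 (ln k%:R) :> R by rewrite le_max lexx.
apply: (@le_trans _ _ ((5000 + 12 * b) * (kappa * (n * L ^ 3)))%N%:R).
  by rewrite ler_nat; apply: total_cost_le.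
rewrite [((5000 + 12 * b) * _)%N%:R]natrM natrM natrM natrX /C.
move: (Num.max _ _) (ln n%:R) n1 L1 K1 M1 => M l n1 L1 K1 M1.
have h1 : kappa%:R * (n%:R * L%:R ^+ 3) <= (27 * M) * (n%:R * (a%:R * l) ^+ 3).
  have al : 0 <= a%:R * l by apply: mulr_ge0; lra.
  by apply: ler_pM => //; rewrite ?mulr_ge0 ?exprn_ge0// ler_wpM2l// lerXn2r ?nnegrE.
apply: le_trans (ler_wpM2l (ler0n R (5000 + 12 * b)) h1) _.
by rewrite le_eqVlt; apply/orP; left; apply/eqP; ring.
Qed.

Lemma sparsity_constant_ge : 5 <= C.
Proof.
have a1 := a_gt0; rewrite /C.
have h : 1 <= a%:R ^+ 3 :> R by apply: exprn_ege1.
have h2 : 5000 <= (5000 + 12 * b)%:R :> R by rewrite ler_nat; lia.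
by nra.
Qed.

(** The largest power used below is n^(2 a + 21), for the sample count kappa L B with kappa and L at
    most n^(a+1) and B at most n^19. *)
Let K := (2 * a + 40)%N.
Local Notation W := (n ^ K)%N.
Local Notation Q := (2 ^ q)%N.
Local Notation N := (2 ^ up_log 2 (2 * p))%N.

Lemma below_word (j : nat) (v : nat) : (v <= n ^ j)%N -> (j < K)%N -> (v < W)%N.
Proof. by move=> h jK; apply: leq_ltn_trans h _; rewrite ltn_exp2l// grid_gt1. Qed.

Lemma mul_pow (u v i j : nat) :
  (u <= n ^ i)%N -> (v <= n ^ j)%N -> (u * v <= n ^ (i + j))%N.
Proof. by move=> h1 h2; rewrite expnD leq_mul. Qed.

Lemma two_pow (j : nat) : (2 ^ j <= n ^ j)%N.
Proof. by case: j => // j; rewrite leq_exp2r// grid_gt1. Qed.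

Lemma up_log_pow (v : nat) : (1 < v)%N -> (2 ^ up_log 2 v <= 2 * v)%N.
Proof.
move=> v1; have /andP[lo _] := up_log_bounds (isT : (1 < 2)%N) v1.
have : (0 < up_log 2 v)%N by rewrite up_log_gt0.
by case: (up_log 2 v) lo => [//|j] /= lo _; rewrite expnS leq_mul2l ltnW.
Qed.

Lemma word_bounds :
  [/\ [/\ (1 < W)%N, (2 * n < W)%N, (2 * (32 * k) < W)%N, (2 * (2 * p) < W)%N
        & (m.+1 < W)%N],
      [/\ (d < W)%N, (8 * Q ^ 2 < W)%N, (N < W)%N, (L < W)%N &
          (group_size k < W)%N],
      (sample_count p d k m < W)%N & (5 * k < W)%N].
Proof.
have n1 := grid_gt1.
have k1 : (k <= n ^ 1)%N by rewrite expn1.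
have nn : (n <= n ^ 1)%N by rewrite expn1.
have p1 : (p <= n ^ 1)%N by rewrite expn1 /n -[X in (X <= _)%N]expn1 leq_pexp2l// ltnW.
have p2 : (2 <= n ^ 1)%N by rewrite expn1.
have p32 : (32 <= n ^ 5)%N by have := two_pow 5.
have p8 : (8 <= n ^ 3)%N by have := two_pow 3.
(* L <= a ln n <= a n <= 2^a n <= n^(a+1), using n >= 2. *)
have LK : (L <= n ^ a.+1)%N.
  have : L%:R <= (a * n)%:R :> R.
    rewrite natrM; apply: le_trans group_count_le _.
    by rewrite ler_wpM2l// ln_nat_le// ltnW.
  rewrite ler_nat => h; apply: leq_trans h _.
  rewrite expnS mulnC leq_mul2l; apply/orP; right.
  by apply: leq_trans (two_pow a); apply/ltnW/ltn_expl.
have Lge : (m.+1 <= L)%N by rewrite /group_count; lia.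
have kL : (kappa <= L)%N by rewrite /group_count; lia.
have Q7 : (Q <= n ^ 7)%N.
  apply: leq_trans (up_log_pow _) _; first by lia.
  by apply: (@mul_pow _ _ 1 6) => //; apply: (@mul_pow _ _ 5 1).
have B19 : (group_size k <= n ^ 19)%N.
  by rewrite bE; apply: (@mul_pow _ _ 18 1) => //; apply: b_le.
split; [split|split| |].
- by apply: (@below_word 0) => //; rewrite /K addn_gt0 orbT.
- by apply: (@below_word 2); [apply: (@mul_pow _ _ 1 1)|rewrite /K; lia].
- apply: (@below_word 7); last by rewrite /K; lia.
  by apply: (@mul_pow _ _ 1 6) => //; apply: (@mul_pow _ _ 5 1).
- apply: (@below_word 3); last by rewrite /K; lia.
  by apply: (@mul_pow _ _ 1 2) => //; apply: (@mul_pow _ _ 1 1).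
- by apply: (@below_word a.+1); [exact: leq_trans LK|rewrite /K; lia].
- apply: (@below_word 1); last by rewrite /K; lia.
  by rewrite expn1 /n; apply/ltnW/ltn_expl.
- apply: (@below_word 17); last by rewrite /K; lia.
  apply: (@mul_pow _ _ 3 14) => //.
  by have -> : (n ^ 14 = (n ^ 7) ^ 2)%N; [rewrite -expnM|rewrite leq_exp2r].
- apply: (@below_word 3); last by rewrite /K; lia.
  apply: leq_trans (up_log_pow _) _; first by lia.
  by apply: (@mul_pow _ _ 1 2) => //; apply: (@mul_pow _ _ 1 1).
- by apply: (@below_word a.+1) => //; rewrite /K; lia.
- by apply: (@below_word 19) => //; rewrite /K; lia.
- apply: (@below_word (a.+1 + a.+1 + 19)); last by rewrite /K; lia.
  rewrite /sample_count; apply: mul_pow => //; apply: mul_pow => //.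
  exact: leq_trans kL LK.
- apply: (@below_word 4); last by rewrite /K; lia.
  apply: (@mul_pow _ _ 3 1) => //; exact: leq_trans p8.
Qed.

End Bounds.

(** * From counts of sample tables to probabilities *)

Section FiniteValued.
Local Open Scope classical_set_scope.
Variables (R : realType) (dsp : measure_display) (Om : measurableType dsp).
Variables (P : probability Om R) (T : finType) (f : Om -> T) (v : R).
Hypothesis fibre_measurable : forall h, measurable [set w | f w = h].
Hypothesis fibre_prob : forall h, P [set w | f w = h] = v%:E.

Lemma finite_valued_measurable (b : pred T) : measurable [set w | b (f w)].
Proof.
suff h : forall s : seq T, measurable [set w | f w \in s].
  have -> : [set w | b (f w)] = [set w | f w \in enum b] by apply/funext => w /=; rewrite mem_enum.
  exact: h.
elim=> [|h s IH].
  by have -> : [set w | f w \in [::]] = set0 by apply/seteqP; split.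
have -> : [set w | f w \in h :: s] = [set w | f w = h] `|` [set w | f w \in s].
  apply/seteqP; split => w /=; rewrite in_cons.
    by case/orP => [/eqP|]; [left|right].
  by case=> [->|->]; rewrite ?eqxx ?orbT.
exact: measurableU.
Qed.

Lemma finite_valued_prob (b : pred T) :
  (P [set w | b (f w)] <= (#|b|%:R * v)%:E)%E.
Proof.
suff h : forall s : seq T, (P [set w | f w \in s] <= ((size s)%:R * v)%:E)%E.
  have -> : [set w | b (f w)] = [set w | f w \in enum b] by apply/funext => w /=; rewrite mem_enum.
  by rewrite cardE; exact: h.
elim=> [|h s IH].
  have -> : [set w | f w \in [::]] = set0 by apply/seteqP; split.
  by rewrite measure0 mul0r.
have -> : [set w | f w \in h :: s] = [set w | f w = h] `|` [set w | f w \in s].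
  apply/seteqP; split => w /=; rewrite in_cons.
    by case/orP => [/eqP|]; [left|right].
  by case=> [->|->]; rewrite ?eqxx ?orbT.
apply: le_trans (measureU2 _ _ _) _ => //.
  exact: (finite_valued_measurable (fun t => t \in s)).
by rewrite /= -natr1 mulrDl mul1r addrC EFinD leeD// fibre_prob.
Qed.

End FiniteValued.

Section DrawnBatches.
Local Open Scope classical_set_scope.
Variables (R : realType) (p d : nat) (dsp : measure_display).
Variables (Om : measurableType dsp) (P : probability Om R).
Variable tau : Om -> nat -> draw R p d.
Hypothesis tauP : uniform_draws P tau.
Variables K L B : nat.
Hypotheses (L_gt0 : (0 < L)%N) (B_gt0 : (0 < B)%N).
Local Notation NT := (K.+1 * L * B)%N.

Definition drawn_batches (w : Om) : {ffun 'I_K.+1 -> batch p d L B} :=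
  [ffun i : 'I_K.+1 => drawn_batch (tau w) L B i].

(** Inverts the layout of [drawn_batch]: position i belongs to sample i mod B of group (i / B) mod L
    of batch i / B / L. *)
Definition flatten_batches (h : {ffun 'I_K.+1 -> batch p d L B}) (i : 'I_NT) :
    grid p d :=
  h (inord (i %/ B %/ L)) (Ordinal (ltn_pmod (i %/ B) L_gt0))
    (Ordinal (ltn_pmod i B_gt0)).

Lemma drawn_batches_fibre h :
  [set w | drawn_batches w = h] =
  [set w | forall i : 'I_NT, (tau w i).1 = flatten_batches h i].
Proof.
apply/seteqP; split => w /=.
  move=> <- i; rewrite /flatten_batches /drawn_batches /drawn_batch !ffunE /=.
  rewrite inordK; first by rewrite -!divn_eq.
  by rewrite -divnMA ltn_divLR ?muln_gt0 ?B_gt0// [(B * L)%N]mulnC mulnA.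
move=> H; apply/ffunP => i; apply/ffunP => r; apply/ffunP => b.
rewrite /drawn_batches /drawn_batch !ffunE.
have lt : ((i * L + r) * B + b < NT)%N.
  apply: (@leq_trans ((i * L + r).+1 * B)).
    by rewrite mulSn addnC ltn_add2r.
  rewrite leq_mul2r; apply/orP; right.
  apply: (@leq_trans (i.+1 * L)); first by rewrite mulSn addnC -addSn leq_add2r.
  by rewrite leq_mul2r; apply/orP; right.
rewrite (H (Ordinal lt)) /flatten_batches /=.
have e1 : (((i * L + r) * B + b) %/ B = i * L + r)%N.
  by rewrite divnMDl// divn_small// addn0.
have e2 : ((((i * L + r) * B + b) %/ B) %/ L = i)%N.
  by rewrite e1 divnMDl// divn_small// addn0.
have e3 : inord (((i * L + r) * B + b) %/ B %/ L) = i.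
  by apply/val_inj; rewrite /= inordK e2.
congr (h _ _ _) => //; apply/val_inj => /=.
  by rewrite e1 modnMDl modn_small.
by rewrite modnMDl modn_small.
Qed.

Lemma drawn_batches_measurable h : measurable [set w | drawn_batches w = h].
Proof.
rewrite drawn_batches_fibre; case: tauP => _ M _ _ _.
have -> : [set w | forall i : 'I_NT, (tau w i).1 = flatten_batches h i] =
  \bigcap_(i in [set: 'I_NT]) [set w | (tau w i).1 = flatten_batches h i].
  by apply/seteqP; split => w /= H i; [move=> _; exact: H|exact: (H i I)].
apply: fin_bigcap_measurable; first exact: finite_finset.
by move=> i _; exact: M.
Qed.

(** Taking the whole line for the sets of both real coordinates leaves the uniform law of the
    indices, so every table has the same probability. *)
Lemma drawn_batches_prob h :
  P [set w | drawn_batches w = h] = ((p ^ d)%:R ^- NT)%:E.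
Proof.
rewrite drawn_batches_fibre; case: tauP => _ _ _ _ H.
have := H NT (flatten_batches h) (fun=> setT) (fun=> setT)
  (fun=> measurableT) (fun=> measurableT).
have -> : [set w | forall i : 'I_NT,
   [/\ (tau w i).1 = flatten_batches h i, [set: R] (tau w i).2.1 &
       [set: R] (tau w i).2.2]] =
   [set w | forall i : 'I_NT, (tau w i).1 = flatten_batches h i].
  by apply/seteqP; split => w /= G i; [case: (G i)|split].
move=> ->; under eq_bigr => i _ do rewrite !probability_setT !mule1.
by rewrite prodEFin prodr_const card_ord exprVn.
Qed.

Lemma card_batches :
  #|{ffun 'I_K.+1 -> batch p d L B}| = ((p ^ d) ^ NT)%N.
Proof.
rewrite !card_ffun !card_ord -!expnM; congr (p ^ _)%N; ring.
Qed.

End DrawnBatches.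

Lemma tail_full (R : realType) (p d k : nat) (v : signal R p d) :
  (p ^ d <= k)%N -> tail k v = 0.
Proof.
move=> nk; apply/ffunP => t; rewrite !ffunE /largest take_oversize.
  by rewrite mem_sort mem_enum.
by rewrite size_sort -cardE card_grid.
Qed.

(** For n <= 1 <= k nothing remains after removing k coordinates. So mu > 0 excludes n = 1, where ln
    n = 0 and no bound by a multiple of ln n could hold. *)
Lemma tail_mean_gt0_card (R : realType) (p d k : nat) (v : signal R p d) :
  (0 < k)%N -> 0 < tail_mean k v -> (1 < p ^ d)%N.
Proof.
move=> k0; rewrite ltnNge; apply: contraTN => n1.
rewrite /tail_mean tail_full; last exact: leq_trans n1 _.
rewrite /l2_norm big1 ?sqrtr0 ?mul0r ?ltxx// => t _.
by rewrite ffunE /cabs /= expr0n /= addr0 sqrtr0 expr0n.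
Qed.

Lemma cabs_le_linf (R : realType) (p d : nat) (v : signal R p d) t :
  cabs (v t) <= linf_norm v.
Proof. exact: (@le_bigmax _ _ _ _ (fun t => cabs (v t))). Qed.

Lemma linf_norm_le (R : realType) (p d : nat) (v : signal R p d) (M : R) :
  0 <= M -> (forall t, cabs (v t) <= M) -> linf_norm v <= M.
Proof. by move=> M0 h; apply: bigmax_le. Qed.

Lemma sound0 (R : realType) (p d k m : nat) (x : signal R p d) (mu Rs : R) :
  0 < mu -> linf_norm (fourier x) / mu <= Rs -> Rs <= 2 ^+ m ->
  sound x k 0 (scale mu m).
Proof.
move=> mu0; rewrite ler_pdivrMr// => h1 h2; apply/soundP; split => f.
  rewrite [(0 : signal R p d) f]ffunE subr0; apply: le_trans (cabs_le_linf _ _) (le_trans h1 _).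
  by rewrite /scale mulrC ler_wpM2l// ltW.
by rewrite ffunE eqxx.
Qed.

(** In powers of 2, 2 L is at least (m + 1) + kappa + 2 log n, using kappa <= 2^kappa. *)
Lemma group_count_pow (p d k m : nat) :
  (2 ^ m.+1 * ((2 * up_log 2 (32 * k)).+1 * p ^ d) * p ^ d <=
   4 ^ group_count p d k m)%N.
Proof.
have n_le := @up_logP 2 (p ^ d) isT.
set kappa := (2 * _).+1; have k_le : (kappa <= 2 ^ kappa)%N by apply/ltnW/ltn_expl.
rewrite -[4%N]/(2 ^ 2)%N -expnM.
apply: (@leq_trans (2 ^ (m.+1 + (kappa + up_log 2 (p ^ d)) + up_log 2 (p ^ d)))).
  by rewrite !expnD !leq_mul.
by rewrite leq_pexp2l// /group_count -/kappa; lia.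
Qed.

(** * The success event and the main result *)

Section Success.
Local Open Scope classical_set_scope.
Variables (R : realType) (p d k m : nat) (x : signal R p d) (mu : R).
Variables (dsp : measure_display) (Om : measurableType dsp).
Variables (P : probability Om R) (tau : Om -> nat -> draw R p d).
Hypothesis tauP : uniform_draws P tau.
Hypotheses (p_gt0 : (0 < p)%N) (k_gt0 : (0 < k)%N) (k_le : (k <= p ^ d)%N).
Hypotheses (mu_def : mu = tail_mean k (fourier x)) (mu_gt0 : 0 < mu).
Hypothesis start : sound x k 0 (scale mu m).

Local Notation success := [set w | sound x k (recovered x (tau w) k m mu) mu].

Lemma success_probable :
  measurable success /\ ((1 - ((p ^ d)%:R `^ (- 1)))%:E <= P success)%E.
Proof.
pose q := up_log 2 (32 * k); pose L := group_count p d k m.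
pose B := group_size k.
have [b [bE b18 _]] := group_size_factor R.
have B_def : B%:R = 2 ^+ 18 * k%:R :> R by rewrite /B bE natrM b18.
have B0 : (0 < B)%N.
  by rewrite -(ltr0n R) B_def mulr_gt0// ?exprn_gt0// ltr0n.
have L0 : (0 < L)%N by rewrite /L /group_count addn1.
have Q_ge : (32 * k <= 2 ^ q)%N by apply: up_logP.
pose bad := [pred h : {ffun 'I_(2 * q).+1 -> batch p d L B} |
  ~~ sound x k (recover x mu q m.+1 0 m (batches h)) mu].
have recoveredE w : recovered x (tau w) k m mu =
    recover x mu q m.+1 0 m (batches (drawn_batches tau (2 * q) L B w)).
  rewrite /recovered; apply: eq_recover => j jk.
  by rewrite /batches /drawn_batches ffunE inordK.
have fm := drawn_batches_measurable tauP (K := (2 * q)%N) L0 B0.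
have fp := drawn_batches_prob tauP (K := (2 * q)%N) L0 B0.
have badE : ~` success = [set w | bad (drawn_batches tau (2 * q) L B w)].
  by apply/funext => w /=; rewrite recoveredE; apply/propext; split => /negP.
have mb : measurable (~` success).
  by rewrite badE; exact: (finite_valued_measurable fm).
have ms : measurable success by rewrite -[X in measurable X]setCK; exact: measurableC.
split => //.
have -> : P success = (1 - P (~` success))%E.
  by rewrite -probability_setC// setCK.
have n0 : 0 < (p ^ d)%:R :> R by rewrite ltr0n expn_gt0 p_gt0.
(* The bad tables are at most a fraction 1/n of all tables. *)
have count : (#|bad| * p ^ d <= (p ^ d) ^ ((2 * q).+1 * L * B))%N.
  have := card_recover L p_gt0 k_gt0 k_le mu_def mu_gt0 B0 B_def Q_ge
    start (ltnSn m).
  rewrite card_batches -/bad; move: #|bad| ((p ^ d) ^ _)%N => u v uv.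
  have := group_count_pow p d k m; rewrite -/q -/L => h.
  rewrite -(leq_pmul2l (_ : 0 < 4 ^ L)%N) ?expn_gt0// mulnA.
  apply: leq_trans (leq_mul uv (leqnn _)) _.
  apply: leq_trans (leq_mul h (leqnn v)).
  have -> : (2 ^ m.+1 * ((2 * q).+1 * p ^ d) * p ^ d * v =
    2 ^ m.+1 * ((2 * q).+1 * p ^ d * v) * p ^ d)%N by ring.
  by rewrite leq_mul2r leq_mul2r leq_subr !orbT.
have := finite_valued_prob fm fp bad; rewrite -badE => h.
rewrite EFinB leeB// (le_trans h)// lee_fin (powR_inv1 (ltW n0)).
rewrite ler_pdivrMr ?exprn_gt0// mulrC ler_pdivlMr//.
by rewrite -natrX -natrM ler_nat.
Qed.

End Success.

Theorem theorem1p1 :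
  exists alg : cmd, forall R : realType, exists c : R, 0 < c /\
  forall A : R, exists (C : R) (K : nat),
  forall (p d : nat) (x : signal R p d) (k : nat) (Rs : R),
  let n := (p ^ d)%N in
  let mu := l2_norm (tail k (fourier x)) / Num.sqrt k%:R in
  (0 < p)%N -> (0 < d)%N -> (1 <= k <= n)%N ->
  0 < mu ->
  linf_norm (fourier x) / mu <= Rs ->
  ln Rs <= A * ln n%:R ->
  is_min_sparse_dist k (fourier x) (l2_norm (tail k (fourier x))) /\
  forall (dsp : measure_display) (Om : measurableType dsp)
    (P : probability Om R) (tau : Om -> nat -> draw R p d),
  uniform_draws P tau ->
  exists out : Om -> state R,
    (forall w : Om,
      [/\ exec (n ^ K) x (tau w) alg (init_state p d k mu Rs) (out w),
          (reads (out w))%:R <= C * (k%:R * Num.max 1 (ln k%:R) * ln n%:R),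
          (steps (out w))%:R <=
            C * (n%:R * ln n%:R ^+ 3 * Num.max 1 (ln k%:R)) &
          sparse (C * k%:R) (output p d (out w))]) /\
    (exists E : set Om,
      [/\ measurable E,
          (forall w : Om, E w ->
             linf_norm (fourier x - output p d (out w)) <=
             (Num.sqrt k%:R)^-1 * l2_norm (tail k (fourier x))) &
          ((1 - n%:R `^ (- c))%:E <= P E)%E]).
Proof.
(* The failure probability is at most 1/n, so the exponent is c = 1. *)
exists recovery_prog => R; exists 1; split; first exact: ltr01.
move=> A; pose a := (Num.trunc (58 + 2 * Num.max 0 A)).+1.
have a_ge : 58 + 2 * Num.max 0 A <= a%:R by apply/ltW/truncnS_gt.
have [b [bE b18 b_le]] := group_size_factor R.
exists ((5000 + 12 * b)%:R * 27 * a%:R ^+ 3), (2 * a + 40)%N.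
move=> p d x k Rs n mu p0 d0 /andP[k0 kn] mu0 Rs_ge lnRs.
have n1 : (1 < p ^ d)%N by apply: (tail_mean_gt0_card k0 mu0).
have p1 : (1 < p)%N.
  by rewrite ltn_neqAle p0 andbT; apply: contraTneq n1 => <-; rewrite exp1n.
split; first exact: tail_is_min_sparse_dist.
move=> dsp Om P tau tauP.
have [m Rs_le m_min] := least_exponent Rs.
have [[W1 nW kW pW mW] [dW QW NW LW BW] sW k5W] :=
  word_bounds p1 d0 k0 kn m_min lnRs a_ge (bE k) b_le.
have runs w : exists s, exec (n ^ (2 * a + 40)) x (tau w) recovery_prog
    (init_state p d k mu Rs) s /\
  [/\ (#|[pred t | output p d s t != 0%R]| <= 5 * k)%N,
       (#|[pred t | recovered x (tau w) k m mu t != 0%R]| <= 5 * k)%N ->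
       output p d s = recovered x (tau w) k m mu,
       reads s = sample_count p d k m
     & (steps s <= total_cost p d k m)%N].
  (* The addresses 32 i + 3 lie beyond the two complex arguments and hold the default 0 of [nth]:
     the recovery starts from y = 0. *)
  have ca3 i : ca (init_state p d k mu Rs) 3 i = 0.
    by rewrite /ca /arr addnC.
  have [s' ex hs] := run_recovery x (tau w) p0 d0 mu0 Rs_le m_min W1 nW kW pW mW
    dW QW NW LW BW sW k0 k5W (s := init_state p d k mu Rs)
    erefl erefl erefl erefl erefl erefl ca3 erefl erefl.
  by exists s'; split.
have [out outP] := choice runs.
exists out; split.
  move=> w; have [ex [h1 h2 h3 h4]] := outP w; split => //.
  - by rewrite h3; apply: (sample_count_le p1 d0 k0 kn m_min lnRs a_ge (bE k)).
  - apply: (@le_trans _ _ (total_cost p d k m)%:R); first by rewrite ler_nat.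
    by apply: (total_cost_le_ln p1 d0 k0 kn m_min lnRs a_ge (bE k)).
  - apply: (@le_trans _ _ (5 * k)%:R); first by rewrite ler_nat.
    by rewrite natrM ler_wpM2r// (sparsity_constant_ge p1 d0 k0 kn lnRs a_ge (bE k)).
have start := sound0 k mu0 Rs_ge Rs_le.
have [mS PS] := @success_probable R p d k m x mu dsp Om P tau tauP p0 k0 kn erefl mu0 start.
exists [set w | sound x k (recovered x (tau w) k m mu) mu]%classic; split => //.
move=> w /= /soundP[S1 S2]; have [_ [_ eqo _ _]] := outP w.
rewrite eqo.
  (* Soundness at scale mu is the required bound, since mu is the tail norm divided by sqrt k. *)
  rewrite mulrC; apply: linf_norm_le; first exact: ltW.
  by move=> t; rewrite [(_ - _ : signal R p d) t]ffunE [(- _ : signal R p d) t]ffunE.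
(* The support of a sound vector is heavy, hence has at most 5 k elements, and the cap leaves the
   output unchanged. *)
apply: leq_trans (card_heavy k0 kn mu0); apply/subset_leq_card/fintype.subsetP => t.
by rewrite inE => /S2.
Qed.
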